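(* Let $0<\beta<1$ be fixed. There exists a function $c_\beta:(1/2,1)\to\mathbb R$ with the asymptotic behavior $$c_\beta(\sigma)=\big\{\sqrt2+o(1)\big\}(1-\beta)^{1-\sigma}\sqrt{|\log(\sigma-1/2)|}\qquad\text{as }\sigma\to1/2^+,$$ such that for all sufficiently large $T$ (depending on $\beta$) and all $\sigma$ with $\frac12+\frac1{\log_2T}\le\sigma<1$, $$\max_{t\in[T^\beta,T]}\log|\zeta(\sigma+it)|\ge c_\beta(\sigma)\frac{(\log T)^{1-\sigma}}{(\log_2T)^\sigma}.$$
   Context: Here $\zeta$ is the Riemann zeta function and $\log_2T=\log\log T$. *)

(* Defs.v *)
From Stdlib Require Import Reals Lra Lia.
From Coquelicot Require Import Coquelicot.
Open Scope R_scope.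

Definition Cexp (z : C) : C :=
  (exp (Re z) * cos (Im z), exp (Re z) * sin (Im z)).

(** [x ^ s] for a positive real base [x] and a complex exponent [s]. *)
Definition RCpow (x : R) (s : C) : C := Cexp (s * RtoC (ln x))%C.

Definition zeta_seq (s : C) (N : nat) : C :=
  (sum_n_m (G := C_AbelianMonoid) (fun n => RCpow (INR n) (- s)) 1 N
   - RCpow (INR N) (1 - s) / (1 - s))%C.

(** The Riemann zeta function on [Re s > 0], [s <> 1], as the limit of
    [sum_(1 <= n <= N) n^(-s) - N^(1-s) / (1-s)].  The lemmas [zeta_cvg],
    [zeta_dirichlet] and [zeta_holomorphic] below show that the limit exists
    and that [zeta] is the analytic continuation of the Dirichlet series to
    this domain.  Outside the domain the value is meaningless. *)
Definition zeta (s : C) : C :=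
  (real (Lim_seq (fun N => Re (zeta_seq s N))),
   real (Lim_seq (fun N => Im (zeta_seq s N)))).

(** [log |z|], with the value [-oo] at [z = 0] (whereas [ln 0 = 0]). *)
Definition log_abs (z : C) : Rbar :=
  if Ceq_dec z (RtoC 0) then m_infty else Finite (ln (Cmod z)).

Definition is_max_on (f : R -> Rbar) (a b : R) (M : Rbar) : Prop :=
  (exists t, a <= t <= b /\ f t = M) /\
  (forall t, a <= t <= b -> Rbar_le (f t) M).

Lemma C_ext (z w : C) : Re z = Re w -> Im z = Im w -> z = w.
Proof. destruct z, w; simpl; intros -> ->; reflexivity. Qed.

Lemma exp_mono (x y : R) : x <= y -> exp x <= exp y.
Proof.
intros [H | ->]; [apply Rlt_le, exp_increasing, H | apply Rle_refl].
Qed.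

Lemma Cexp_plus (z w : C) : Cexp (z + w) = (Cexp z * Cexp w)%C.
Proof.
apply C_ext; unfold Cexp, Cplus, Cmult, Re, Im; simpl;
  rewrite exp_plus, ?cos_plus, ?sin_plus; ring.
Qed.

Lemma Cmod_Cexp (z : C) : Cmod (Cexp z) = exp (Re z).
Proof.
unfold Cmod, Cexp; simpl fst; simpl snd.
assert (H := sin2_cos2 (Im z)); unfold Rsqr in H.
replace (_ + _) with (exp (Re z) ^ 2 * (sin (Im z) * sin (Im z) + cos (Im z) * cos (Im z))) by ring.
rewrite H, Rmult_1_r; apply sqrt_pow2, Rlt_le, exp_pos.
Qed.

Lemma RCpow_pair (x : R) (s : C) :
  RCpow x s = (exp (Re s * ln x) * cos (Im s * ln x),
               exp (Re s * ln x) * sin (Im s * ln x)).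
Proof.
unfold RCpow, Cexp; apply C_ext; unfold Cmult, RtoC, Re, Im; simpl;
  rewrite !Rmult_0_r, Rminus_0_r, Rplus_0_l; reflexivity.
Qed.

Lemma RCpow_plus (x : R) (s w : C) :
  RCpow x (s + w) = (RCpow x s * RCpow x w)%C.
Proof. unfold RCpow; rewrite Cmult_plus_distr_r; apply Cexp_plus. Qed.

Lemma RCpow_1 (x : R) : 0 < x -> RCpow x 1 = x.
Proof.
intros Hx; rewrite RCpow_pair; simpl; rewrite Rmult_0_l, Rmult_1_l.
rewrite exp_ln, cos_0, sin_0 by assumption; apply C_ext; simpl; ring.
Qed.

Lemma RCpow_one (s : C) : RCpow 1 s = 1.
Proof.
rewrite RCpow_pair, ln_1, !Rmult_0_r, exp_0, cos_0, sin_0.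
apply C_ext; simpl; ring.
Qed.

Lemma Cmod_RCpow (x : R) (s : C) : Cmod (RCpow x s) = Rpower x (Re s).
Proof.
unfold RCpow; rewrite Cmod_Cexp; unfold Rpower; f_equal.
unfold Cmult, RtoC, Re; simpl; ring.
Qed.

Lemma norm_C_R (z : C) : norm (z : C_R_NormedModule) = Cmod z.
Proof.
destruct z as [x y]; unfold norm; simpl; unfold prod_norm, norm, Cmod, abs; simpl.
f_equal; rewrite !Rmult_1_r, <- !Rabs_mult.
rewrite !Rabs_pos_eq; nra.
Qed.

Lemma is_derive_C_pair (f : R -> C) (x : R) (l : C) :
  is_derive (fun t => Re (f t)) x (Re l) ->
  is_derive (fun t => Im (f t)) x (Im l) ->
  is_derive (V := C_R_NormedModule) f x l.
Proof.
intros H1 H2.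
assert (K1 := is_derive_scal_l (V := C_R_NormedModule) _ _ _ (1, 0) H1).
assert (K2 := is_derive_scal_l (V := C_R_NormedModule) _ _ _ (0, 1) H2).
assert (K := is_derive_plus _ _ _ _ _ K1 K2).
replace l with (plus (scal (Re l) ((1, 0) : C_R_NormedModule))
                     (scal (Im l) ((0, 1) : C_R_NormedModule))).
- eapply is_derive_ext; [ | exact K ].
  intros t; apply C_ext; simpl; unfold plus, scal, mult; simpl;
    unfold mult; simpl; ring.
- apply C_ext; simpl; unfold plus, scal, mult; simpl; unfold mult; simpl; ring.
Qed.

Lemma continuous_C_pair (f : R -> C) (x : R) :
  continuous (fun t => Re (f t)) x -> continuous (fun t => Im (f t)) x ->
  continuous (U := C_UniformSpace) f x.
Proof.
intros H1 H2.
assert (K1 := continuous_scal_l (V := C_R_NormedModule) _ (1, 0) _ H1).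
assert (K2 := continuous_scal_l (V := C_R_NormedModule) _ (0, 1) _ H2).
assert (K := continuous_plus (V := C_R_NormedModule) _ _ _ K1 K2).
eapply continuous_ext; [ | exact K ].
intros t; apply C_ext; simpl; unfold plus, scal, mult; simpl;
    unfold mult; simpl; ring.
Qed.

Lemma is_RInt_Cmult (f : R -> C) (a b : R) (h l : C) :
  is_RInt (V := C_R_NormedModule) f a b l ->
  is_RInt (V := C_R_NormedModule) (fun t => h * f t)%C a b (h * l)%C.
Proof.
intros H.
assert (H1 := is_RInt_fct_extend_fst _ _ _ _ H).
assert (H2 := is_RInt_fct_extend_snd _ _ _ _ H).
apply is_RInt_fct_extend_pair; simpl.
- apply (is_RInt_minus (V := R_NormedModule));
    apply (is_RInt_scal (V := R_NormedModule)); assumption.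
- apply (is_RInt_plus (V := R_NormedModule));
    apply (is_RInt_scal (V := R_NormedModule)); assumption.
Qed.

Lemma Cmod_RInt_le (f : R -> C) (a b : R) (l : C) (M : R) :
  a <= b -> (forall x, a <= x <= b -> Cmod (f x) <= M) ->
  is_RInt (V := C_R_NormedModule) f a b l -> Cmod l <= (b - a) * M.
Proof.
intros Hab HM H; rewrite <- norm_C_R.
apply (norm_RInt_le_const (V := C_R_NormedModule) f a b l M Hab); [ | exact H ].
intros x Hx; rewrite norm_C_R; auto.
Qed.

Lemma Cexp_line_int (z : C) (u : R) :
  is_RInt (V := C_R_NormedModule) (fun t => z * Cexp (RtoC t * z))%C 0 u
    (Cexp (RtoC u * z) - 1)%C.
Proof.
assert (K := is_RInt_derive (V := C_R_CompleteNormedModule)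
  (fun t => Cexp (RtoC t * z)) (fun t => z * Cexp (RtoC t * z))%C 0 u).
replace (Cexp (RtoC u * z) - 1)%C with
  (minus (Cexp (RtoC u * z) : C_R_CompleteNormedModule) (Cexp (RtoC 0 * z))).
- apply K; intros t _.
  + destruct z as [x y]; apply is_derive_C_pair;
    unfold Cexp, Cmult, RtoC, Re, Im; simpl; auto_derive; auto; unfold Rminus; ring.
  + destruct z as [x y]; apply continuous_C_pair;
    unfold Cexp, Cmult, RtoC, Re, Im; simpl;
    apply (ex_derive_continuous (V := R_NormedModule)); auto_derive; auto.
- change (Cexp (RtoC u * z) - Cexp (RtoC 0 * z) = Cexp (RtoC u * z) - 1)%C.
  rewrite Cmult_0_l; do 2 f_equal.
  apply C_ext; unfold Cexp, Re, Im; simpl; rewrite ?exp_0, ?cos_0, ?sin_0; ring.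
Qed.

Lemma Cexp_line_bound (z : C) (t : R) :
  0 <= t <= 1 -> Cmod (Cexp (RtoC t * z)) <= exp (Cmod z).
Proof.
intros Ht; rewrite Cmod_Cexp; apply exp_mono.
assert (H := re_le_Cmod z); assert (H0 := Cmod_ge_0 z).
replace (Re (RtoC t * z)) with (t * Re z)
  by (unfold Cmult, RtoC, Re; simpl; ring).
apply Rabs_le_between in H.
apply Rle_trans with (t * Cmod z); [apply Rmult_le_compat_l; lra | ].
rewrite <- (Rmult_1_l (Cmod z)) at 2; apply Rmult_le_compat_r; lra.
Qed.

Lemma Cexp_bound1 (z : C) (u : R) : 0 <= u <= 1 ->
  Cmod (Cexp (RtoC u * z) - 1) <= Cmod z * exp (Cmod z).
Proof.
intros Hu.
assert (H : Cmod (Cexp (RtoC u * z) - 1) <= (u - 0) * (Cmod z * exp (Cmod z))).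
{ eapply Cmod_RInt_le; [lra | | apply Cexp_line_int].
  intros t Ht; simpl; rewrite Cmod_mult; apply Rmult_le_compat_l;
    [apply Cmod_ge_0 | apply Cexp_line_bound; lra]. }
assert (0 <= Cmod z * exp (Cmod z)).
{ apply Rmult_le_pos; [apply Cmod_ge_0 | apply Rlt_le, exp_pos]. }
set (M := Cmod z * exp (Cmod z)) in *; nra.
Qed.

Lemma Cexp_bound2 (z : C) :
  Cmod (Cexp z - 1 - z) <= Cmod z ^ 2 * exp (Cmod z).
Proof.
assert (H := Cexp_line_int z 1).
rewrite Cmult_1_l in H.
assert (H1 := is_RInt_const (V := C_R_NormedModule) 0 1 z).
assert (H2 := is_RInt_minus _ _ _ _ _ _ H H1).
apply (Cmod_RInt_le _ _ _ _ (Cmod z ^ 2 * exp (Cmod z))) in H2; [ | lra | ].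
- replace (Cexp z - 1 - z)%C with
   (minus (Cexp z - 1 : C_R_NormedModule)%C (scal (1 - 0) (z : C_R_NormedModule))).
  + lra.
  + rewrite scal_R_Cmult, Rminus_0_r.
    change ((Cexp z - 1) - (1 * z) = Cexp z - 1 - z)%C; ring.
- intros t Ht; change (Cmod (z * Cexp (RtoC t * z) - z) <= Cmod z ^ 2 * exp (Cmod z)).
  replace (z * Cexp (RtoC t * z) - z)%C with (z * (Cexp (RtoC t * z) - 1))%C by ring.
  rewrite Cmod_mult; simpl; rewrite Rmult_1_r, Rmult_assoc.
  apply Rmult_le_compat_l; [apply Cmod_ge_0 | apply Cexp_bound1; lra].
Qed.

Lemma ln_le_Rpower (x e : R) : 0 < e -> ln x <= Rpower x e / e.
Proof.
intros He; unfold Rpower.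
assert (H := exp_ineq1_le (e * ln x)).
apply (Rmult_le_reg_l e); [exact He | ].
replace (e * (exp (e * ln x) / e)) with (exp (e * ln x)) by (field; lra); lra.
Qed.

Lemma ln_ge_0 (x : R) : 1 <= x -> 0 <= ln x.
Proof. intros Hx; rewrite <- ln_1; apply ln_le; lra. Qed.

Lemma Rpower_anti (x y a : R) :
  0 < y <= x -> a <= 0 -> Rpower x a <= Rpower y a.
Proof.
intros Hxy Ha; unfold Rpower; apply exp_mono.
assert (ln y <= ln x) by (apply ln_le; lra); nra.
Qed.

Lemma p_series (e : R) :
  0 < e -> ex_series (fun k => Rpower (INR (S k)) (- 1 - e)).
Proof.
intros He.
assert (Hb : forall N, sum_n (fun k => Rpower (INR (S k)) (- 1 - e)) N
                 <= 1 + (1 - Rpower (INR (S N)) (- e)) / e).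
{ induction N as [ | N IH].
  - rewrite sum_O; simpl INR; unfold Rpower; rewrite ln_1, !Rmult_0_r, exp_0.
    unfold Rdiv; lra.
  - rewrite sum_Sn; change plus with Rplus.
    set (n := INR (S N)) in *; set (x := INR (S (S N))) in *.
    assert (Hn : 0 < n) by (apply lt_0_INR; lia).
    assert (Hx : x = n + 1) by (unfold x, n; rewrite (S_INR (S N)); reflexivity).
    assert (Hl : / x <= ln x - ln n).
    { assert (H := exp_ineq1_le (ln n - ln x)).
      unfold Rminus in H; rewrite exp_plus, exp_Ropp, !exp_ln in H by lra.
      replace (n * / x) with (1 - / x) in H by (rewrite Hx; field; lra); lra. }
    assert (Hs : Rpower x (- 1 - e) <= (Rpower n (- e) - Rpower x (- e)) / e).
    { replace (Rpower n (- e)) with (Rpower x (- e) * exp (e * (ln x - ln n)))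
        by (unfold Rpower; rewrite <- exp_plus; f_equal; ring).
      replace (Rpower x (- 1 - e)) with (Rpower x (- e) * / x).
      2:{ replace (- 1 - e) with (- e + - (1)) by ring; rewrite Rpower_plus.
          rewrite (Rpower_Ropp x 1), Rpower_1 by lra; reflexivity. }
      assert (H := exp_ineq1_le (e * (ln x - ln n))).
      assert (Hp : 0 < Rpower x (- e)) by apply exp_pos.
      apply (Rmult_le_reg_l e); [exact He | ].
      replace (e * ((Rpower x (- e) * exp (e * (ln x - ln n)) - Rpower x (- e)) / e))
        with (Rpower x (- e) * (exp (e * (ln x - ln n)) - 1)) by (field; lra).
      replace (e * (Rpower x (- e) * / x)) with (Rpower x (- e) * (e * / x)) by ring.
      apply Rmult_le_compat_l; [lra | ].
      apply Rle_trans with (e * (ln x - ln n)); [ | lra].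
      apply Rmult_le_compat_l; lra. }
    unfold Rdiv in *; lra. }
destruct (ex_finite_lim_seq_incr
  (sum_n (fun k => Rpower (INR (S k)) (- 1 - e))) (1 + 1 / e)) as [l Hl].
- intros N; rewrite sum_Sn; change plus with Rplus.
  assert (0 < Rpower (INR (S (S N))) (- 1 - e)) by apply exp_pos; lra.
- intros N; eapply Rle_trans; [apply Hb | ].
  assert (0 < Rpower (INR (S N)) (- e)) by apply exp_pos.
  apply Rplus_le_compat_l; unfold Rdiv; apply Rmult_le_compat_r; [ | lra].
  apply Rlt_le, Rinv_0_lt_compat, He.
- exists l; exact Hl.
Qed.

Definition frac_ker (n : nat) (s : C) (x : R) : C :=
  (RtoC (x - INR n) * RCpow x (- s - 1))%C.

Definition frac_dker (n : nat) (s : C) (x : R) : C :=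
  (- (RtoC (ln x) * frac_ker n s x))%C.

Definition frac_int (n : nat) (s : C) : C :=
  RInt (V := C_R_CompleteNormedModule) (frac_ker n s) (INR n) (INR (S n)).

Definition frac_dint (n : nat) (s : C) : C :=
  RInt (V := C_R_CompleteNormedModule) (frac_dker n s) (INR n) (INR (S n)).

Lemma INR_S_between (n : nat) (x : R) :
  (1 <= n)%nat -> Rmin (INR n) (INR (S n)) <= x <= Rmax (INR n) (INR (S n)) ->
  1 <= INR n <= x /\ x <= INR n + 1.
Proof.
intros Hn; rewrite S_INR, Rmin_left, Rmax_right by lra.
apply le_INR in Hn; simpl in Hn; lra.
Qed.

Lemma continuous_frac_ker (n : nat) (s : C) (x : R) :
  0 < x -> continuous (U := C_UniformSpace) (frac_ker n s) x.
Proof.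
intros Hx; apply continuous_C_pair.
- eapply continuous_ext.
  { intros t; unfold frac_ker; rewrite RCpow_pair; simpl; reflexivity. }
  apply (ex_derive_continuous (V := R_NormedModule)); auto_derive; repeat split; exact Hx.
- eapply continuous_ext.
  { intros t; unfold frac_ker; rewrite RCpow_pair; simpl; reflexivity. }
  apply (ex_derive_continuous (V := R_NormedModule)); auto_derive; repeat split; exact Hx.
Qed.

Lemma continuous_frac_dker (n : nat) (s : C) (x : R) :
  0 < x -> continuous (U := C_UniformSpace) (frac_dker n s) x.
Proof.
intros Hx; apply continuous_C_pair.
- eapply continuous_ext.
  { intros t; unfold frac_dker, frac_ker; rewrite RCpow_pair; simpl; reflexivity. }
  apply (ex_derive_continuous (V := R_NormedModule)); auto_derive; repeat split; exact Hx.
- eapply continuous_ext.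
  { intros t; unfold frac_dker, frac_ker; rewrite RCpow_pair; simpl; reflexivity. }
  apply (ex_derive_continuous (V := R_NormedModule)); auto_derive; repeat split; exact Hx.
Qed.

Lemma is_RInt_frac (n : nat) (s : C) : (1 <= n)%nat ->
  is_RInt (V := C_R_NormedModule) (frac_ker n s) (INR n) (INR (S n))
    (frac_int n s).
Proof.
intros Hn; apply (RInt_correct (V := C_R_CompleteNormedModule)).
apply (ex_RInt_continuous (V := C_R_CompleteNormedModule)); intros x Hx.
apply INR_S_between in Hx; [ | exact Hn]; apply continuous_frac_ker; lra.
Qed.

Lemma is_RInt_dfrac (n : nat) (s : C) : (1 <= n)%nat ->
  is_RInt (V := C_R_NormedModule) (frac_dker n s) (INR n) (INR (S n))
    (frac_dint n s).
Proof.
intros Hn; apply (RInt_correct (V := C_R_CompleteNormedModule)).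
apply (ex_RInt_continuous (V := C_R_CompleteNormedModule)); intros x Hx.
apply INR_S_between in Hx; [ | exact Hn]; apply continuous_frac_dker; lra.
Qed.

Lemma is_derive_RCpow (x : R) (s : C) : 0 < x ->
  is_derive (V := C_R_NormedModule) (fun t => RCpow t s) x
    (s * RCpow x (s - 1))%C.
Proof.
intros Hx.
replace (RCpow x (s - 1)) with (RCpow x s * RtoC (/ x))%C.
2:{ unfold Cminus; rewrite RCpow_plus; f_equal.
    assert (E : exp (- (1) * ln x) = / x)
      by (rewrite <- Ropp_mult_distr_l, Rmult_1_l, exp_Ropp, exp_ln; auto).
    rewrite RCpow_pair; simpl; rewrite E, Ropp_0, Rmult_0_l, cos_0, sin_0.
    apply C_ext; simpl; ring. }
rewrite RCpow_pair.
apply is_derive_C_pair.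
- apply (is_derive_ext (fun t => exp (Re s * ln t) * cos (Im s * ln t))).
  { intros t; rewrite RCpow_pair; reflexivity. }
  destruct s as [a b]; unfold Re, Im; simpl; auto_derive; [repeat split; exact Hx | field; lra].
- apply (is_derive_ext (fun t => exp (Re s * ln t) * sin (Im s * ln t))).
  { intros t; rewrite RCpow_pair; reflexivity. }
  destruct s as [a b]; unfold Re, Im; simpl; auto_derive; [repeat split; exact Hx | field; lra].
Qed.

Lemma is_RInt_RCpow (a b : R) (w : C) : 0 < a <= b ->
  is_RInt (V := C_R_NormedModule) (fun x => w * RCpow x (w - 1))%C a b
    (RCpow b w - RCpow a w)%C.
Proof.
intros Hab.
apply (is_RInt_derive (V := C_R_CompleteNormedModule)
  (fun x => RCpow x w) (fun x => w * RCpow x (w - 1))%C a b);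
  rewrite Rmin_left, Rmax_right by lra; intros x Hx.
- apply is_derive_RCpow; lra.
- assert (Hx0 : 0 < x) by lra.
  apply continuous_C_pair; (eapply continuous_ext;
    [intros t; rewrite RCpow_pair; simpl; reflexivity | ]);
  apply (ex_derive_continuous (V := R_NormedModule));
  auto_derive; repeat split; exact Hx0.
Qed.

Lemma RCpow_S (x : R) (s w : C) : 0 < x -> w = (1 + s)%C ->
  RCpow x w = (RtoC x * RCpow x s)%C.
Proof. intros Hx ->; rewrite RCpow_plus, RCpow_1 by exact Hx; reflexivity. Qed.

Lemma frac_int_eq (n : nat) (s : C) : (1 <= n)%nat -> s <> 1 ->
  (s * frac_int n s)%C =
  ((RCpow (INR (S n)) (1 - s) - RCpow (INR n) (1 - s)) / (1 - s)
   - RCpow (INR (S n)) (- s))%C.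
Proof.
intros Hn Hs.
assert (Hs' : (1 - s)%C <> 0).
{ intros E; apply Hs; rewrite <- (Cplus_0_l s), <- E; ring. }
assert (Hn1 : 1 <= INR n) by (apply (le_INR 1) in Hn; exact Hn).
assert (HS : INR (S n) = INR n + 1) by apply S_INR.
assert (H0 : 0 < INR n <= INR (S n)) by lra.
assert (I1 := is_RInt_Cmult _ _ _ (s / (1 - s))%C _
                (is_RInt_RCpow _ _ (1 - s) H0)).
assert (I2 := is_RInt_Cmult _ _ _ (RtoC (INR n)) _
                (is_RInt_RCpow _ _ (- s) H0)).
assert (I3 := is_RInt_plus _ _ _ _ _ _ I1 I2).
assert (I4 := is_RInt_Cmult _ _ _ s _ (is_RInt_frac n s Hn)).
assert (E : (s * frac_int n s)%C =
   (s / (1 - s) * (RCpow (INR (S n)) (1 - s) - RCpow (INR n) (1 - s))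
    + RtoC (INR n) * (RCpow (INR (S n)) (- s) - RCpow (INR n) (- s)))%C).
{ rewrite <- (is_RInt_unique (V := C_R_CompleteNormedModule) _ _ _ _ I4).
  apply (is_RInt_unique (V := C_R_CompleteNormedModule)).
  eapply is_RInt_ext; [ | exact I3].
  intros x Hx; rewrite Rmin_left, Rmax_right in Hx by lra.
  change (s / (1 - s) * ((1 - s) * RCpow x (1 - s - 1))
          + RtoC (INR n) * (- s * RCpow x (- s - 1))
          = s * (RtoC (x - INR n) * RCpow x (- s - 1)))%C.
  rewrite (RCpow_S x (- s - 1) (1 - s - 1)) by (try lra; ring).
  rewrite RtoC_minus; field; exact Hs'. }
rewrite E.
rewrite (RCpow_S (INR n) (- s) (1 - s)) by (try lra; ring).
rewrite (RCpow_S (INR (S n)) (- s) (1 - s)) by (try lra; ring).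
rewrite HS, RtoC_plus; field; exact Hs'.
Qed.

Lemma zeta_seq_S (n : nat) (s : C) : (1 <= n)%nat -> s <> 1 ->
  zeta_seq s (S n) = (zeta_seq s n - s * frac_int n s)%C.
Proof.
intros Hn Hs; rewrite frac_int_eq by assumption; unfold zeta_seq.
rewrite sum_n_Sm by lia; change plus with Cplus.
assert (Hs' : (1 - s)%C <> 0).
{ intros E; apply Hs; rewrite <- (Cplus_0_l s), <- E; ring. }
field; exact Hs'.
Qed.

Lemma zeta_seq_sum (M : nat) (s : C) : s <> 1 ->
  zeta_seq s (S (S M)) =
  (s / (s - 1)
   - s * sum_n (G := C_AbelianMonoid) (fun k => frac_int (S k) s) M)%C.
Proof.
intros Hs.
assert (H1 : (1 - s)%C <> 0).
{ intros E; apply Hs; rewrite <- (Cplus_0_l s), <- E; ring. }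
assert (H2 : (s - 1)%C <> 0).
{ intros E; apply Hs; rewrite <- (Cplus_0_l 1), <- E; ring. }
induction M as [ | M IH].
- rewrite zeta_seq_S, sum_O by (lia || exact Hs); unfold zeta_seq.
  rewrite sum_n_n; simpl INR; rewrite !RCpow_one.
  field; split; assumption.
- rewrite zeta_seq_S, IH, sum_Sn by (lia || exact Hs); change plus with Cplus.
  ring.
Qed.

Lemma frac_ker_le (n : nat) (s : C) (x : R) :
  INR n <= x <= INR n + 1 ->
  Cmod (frac_ker n s x) <= Rpower x (- 1 - Re s).
Proof.
intros Hx; unfold frac_ker; rewrite Cmod_mult, Cmod_R, Cmod_RCpow.
rewrite Rabs_pos_eq by lra.
replace (Re (- s - 1)) with (- 1 - Re s)
  by (destruct s; unfold Cminus, Cplus, Copp, RtoC, Re; simpl; ring).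
rewrite <- (Rmult_1_l (Rpower x (- 1 - Re s))) at 2.
apply Rmult_le_compat_r; [apply Rlt_le, exp_pos | lra].
Qed.

Lemma frac_int_le (n : nat) (s : C) : (1 <= n)%nat -> 0 < Re s ->
  Cmod (frac_int n s) <= Rpower (INR n) (- 1 - Re s).
Proof.
intros Hn Hs.
assert (Hn1 : 1 <= INR n) by (apply (le_INR 1) in Hn; exact Hn).
replace (Rpower (INR n) (- 1 - Re s))
  with ((INR (S n) - INR n) * Rpower (INR n) (- 1 - Re s))
  by (rewrite S_INR; ring).
eapply Cmod_RInt_le; [rewrite S_INR; lra | | apply is_RInt_frac, Hn].
intros x Hx; rewrite S_INR in Hx.
eapply Rle_trans; [apply frac_ker_le; lra | apply Rpower_anti; lra].
Qed.

Lemma frac_dint_le (n : nat) (s : C) : (1 <= n)%nat -> 0 < Re s ->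
  Cmod (frac_dint n s) <= 2 / Re s * Rpower (INR n) (- 1 - Re s / 2).
Proof.
intros Hn Hs.
assert (Hn1 : 1 <= INR n) by (apply (le_INR 1) in Hn; exact Hn).
assert (H2 : 0 < 2 / Re s) by (apply Rdiv_lt_0_compat; lra).
replace (2 / Re s * Rpower (INR n) (- 1 - Re s / 2))
  with ((INR (S n) - INR n) * (2 / Re s * Rpower (INR n) (- 1 - Re s / 2)))
  by (rewrite S_INR; ring).
eapply Cmod_RInt_le; [rewrite S_INR; lra | | apply is_RInt_dfrac, Hn].
intros x Hx; rewrite S_INR in Hx; unfold frac_dker.
rewrite Cmod_opp, Cmod_mult, Cmod_R, Rabs_pos_eq by (apply ln_ge_0; lra).
apply Rle_trans with (2 / Re s * Rpower x (Re s / 2) * Rpower x (- 1 - Re s)).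
- apply Rmult_le_compat;
    [apply ln_ge_0; lra | apply Cmod_ge_0 | | apply frac_ker_le; lra].
  eapply Rle_trans; [apply (ln_le_Rpower x (Re s / 2)); lra | ].
  right; field; lra.
- rewrite Rmult_assoc, <- Rpower_plus; apply Rmult_le_compat_l; [lra | ].
  replace (Re s / 2 + (- 1 - Re s)) with (- 1 - Re s / 2) by field.
  apply Rpower_anti; lra.
Qed.

Lemma frac_rem_le (n : nat) (s h : C) :
  (1 <= n)%nat -> 0 < Re s -> Cmod h <= Re s / 4 ->
  Cmod (frac_int n (s + h) - frac_int n s - h * frac_dint n s) <=
  Cmod h ^ 2 * (64 / Re s ^ 2) * Rpower (INR n) (- 1 - Re s / 2).
Proof.
intros Hn Hs Hh.
assert (Hn1 : 1 <= INR n) by (apply (le_INR 1) in Hn; exact Hn).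
assert (I := is_RInt_minus _ _ _ _ _ _
  (is_RInt_minus _ _ _ _ _ _ (is_RInt_frac n (s + h) Hn) (is_RInt_frac n s Hn))
  (is_RInt_Cmult _ _ _ h _ (is_RInt_dfrac n s Hn))).
change (minus (minus (frac_int n (s + h)) (frac_int n s)) (h * frac_dint n s)%C)
  with (frac_int n (s + h) - frac_int n s - h * frac_dint n s)%C in I.
set (B := Cmod h ^ 2 * (64 / Re s ^ 2)).
assert (HB : 0 <= B).
{ apply Rmult_le_pos; [apply pow_le, Cmod_ge_0 | ].
  apply Rlt_le, Rdiv_lt_0_compat; [lra | apply pow_lt, Hs]. }
replace (B * Rpower (INR n) (- 1 - Re s / 2))
  with ((INR (S n) - INR n) * (B * Rpower (INR n) (- 1 - Re s / 2)))
  by (rewrite S_INR; ring).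
eapply Cmod_RInt_le; [rewrite S_INR; lra | | exact I].
intros x Hx; rewrite S_INR in Hx.
change (Cmod (frac_ker n (s + h) x - frac_ker n s x - h * frac_dker n s x)
        <= B * Rpower (INR n) (- 1 - Re s / 2)).
replace (frac_ker n (s + h) x - frac_ker n s x - h * frac_dker n s x)%C
  with (frac_ker n s x * (Cexp (- h * RtoC (ln x)) - 1 - (- h * RtoC (ln x))))%C.
2:{ unfold frac_dker, frac_ker.
    replace (- (s + h) - 1)%C with ((- s - 1) + - h)%C by ring.
    rewrite RCpow_plus; unfold RCpow at 3; ring. }
assert (Hl := ln_ge_0 x ltac:(lra)).
assert (Hc : Cmod (- h * RtoC (ln x)) = Cmod h * ln x)
  by (rewrite Cmod_mult, Cmod_opp, Cmod_R, Rabs_pos_eq by exact Hl; reflexivity).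
rewrite Cmod_mult.
apply Rle_trans with
  (Rpower x (- 1 - Re s) * (B * (Rpower x (Re s / 4) * Rpower x (Re s / 4)))).
- apply Rmult_le_compat;
    [apply Cmod_ge_0 | apply Cmod_ge_0 | apply frac_ker_le; lra | ].
  eapply Rle_trans; [apply Cexp_bound2 | ]; rewrite Hc.
  rewrite <- (Rmult_assoc B); apply Rmult_le_compat.
  + apply pow_le, Rmult_le_pos; [apply Cmod_ge_0 | exact Hl].
  + apply Rlt_le, exp_pos.
  + rewrite Rpow_mult_distr; unfold B; rewrite Rmult_assoc.
    apply Rmult_le_compat_l; [apply pow_le, Cmod_ge_0 | ].
    assert (H8 := ln_le_Rpower x (Re s / 8) ltac:(lra)).
    apply Rle_trans with ((Rpower x (Re s / 8) / (Re s / 8)) ^ 2).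
    * apply pow_incr; lra.
    * right; replace (Re s / 4) with (Re s / 8 + Re s / 8) by field.
      rewrite Rpower_plus; field; lra.
  + unfold Rpower; apply exp_mono; apply Rmult_le_compat_r; [exact Hl | exact Hh].
- rewrite (Rmult_comm (Rpower x (- 1 - Re s))), Rmult_assoc, <- !Rpower_plus.
  apply Rmult_le_compat_l; [exact HB | ].
  replace (Re s / 4 + Re s / 4 + (- 1 - Re s)) with (- 1 - Re s / 2) by field.
  apply Rpower_anti; lra.
Qed.

Lemma zeta_seq_lim (s l : C) : s <> 1 ->
  is_series (V := C_NormedModule) (fun k => frac_int (S k) s) l ->
  filterlim (zeta_seq s) eventually
    (locally (T := C_UniformSpace) (s / (s - 1) - s * l)%C).
Proof.
intros Hs Hl.
assert (H : filterlim (fun M => zeta_seq s (S (S M))) eventually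
    (locally (T := C_UniformSpace) (s / (s - 1) - s * l)%C)).
{ eapply filterlim_ext.
  { intros M; symmetry; apply zeta_seq_sum, Hs. }
  apply (filterlim_comp_2 (G := locally (T := C_NormedModule) (s / (s - 1))%C)
           (H := locally (T := C_NormedModule) (- (s * l))%C)
           (fun _ => s / (s - 1))%C
           (fun M => - (s * sum_n (G := C_AbelianMonoid)
                              (fun k => frac_int (S k) s) M))%C Cplus).
  - apply filterlim_const.
  - apply (filterlim_comp _ _ _
      (fun M => (s * sum_n (G := C_AbelianMonoid)
                              (fun k => frac_int (S k) s) M)%C) Copp
      _ (locally (T := C_NormedModule) (s * l)%C)).
    + apply (filterlim_comp _ _ _
        (sum_n (G := C_AbelianMonoid) (fun k => frac_int (S k) s)) (Cmult s)
        _ (locally (T := C_NormedModule) l)).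
      * exact Hl.
      * apply (filterlim_scal_r (V := C_NormedModule) s l).
    + apply (filterlim_opp (V := C_NormedModule)).
  - apply (filterlim_plus (V := C_NormedModule)). }
intros P HP; destruct (H P HP) as [N HN]; exists (S (S N)).
intros [ | [ | n]] Hn; try lia; apply HN; lia.
Qed.

Lemma filterlim_C_pair (u : nat -> C) (l : C) :
  filterlim u eventually (locally (T := C_UniformSpace) l) ->
  is_lim_seq (fun n => Re (u n)) (Re l) /\ is_lim_seq (fun n => Im (u n)) (Im l).
Proof.
intros H; split; intros P [e He].
- apply (H (fun z => P (Re z))); exists e; intros z [Hz _]; apply He, Hz.
- apply (H (fun z => P (Im z))); exists e; intros z [_ Hz]; apply He, Hz.
Qed.

Lemma zeta_lim (s l : C) :
  filterlim (zeta_seq s) eventually (locally (T := C_UniformSpace) l) ->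
  zeta s = l.
Proof.
intros H; apply filterlim_C_pair in H; destruct H as [H1 H2].
unfold zeta; apply C_ext.
- change (real (Lim_seq (fun n => Re (zeta_seq s n))) = Re l).
  rewrite (is_lim_seq_unique _ _ H1); reflexivity.
- change (real (Lim_seq (fun n => Im (zeta_seq s n))) = Im l).
  rewrite (is_lim_seq_unique _ _ H2); reflexivity.
Qed.

Lemma ex_series_frac (s : C) : 0 < Re s ->
  ex_series (V := C_NormedModule) (fun k => frac_int (S k) s).
Proof.
intros Hs; apply (ex_series_le (V := C_CompleteNormedModule) _
  (fun k => Rpower (INR (S k)) (- 1 - Re s))).
- intros n; apply frac_int_le; [lia | exact Hs].
- apply p_series, Hs.
Qed.

Lemma zeta_frac (s : C) : 0 < Re s -> s <> 1 ->
  exists l : C,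
    is_series (V := C_NormedModule) (fun k => frac_int (S k) s) l /\
    zeta s = (s / (s - 1) - s * l)%C.
Proof.
intros Hs H1; destruct (ex_series_frac s Hs) as [l Hl].
exists l; split; [exact Hl | ].
apply zeta_lim, zeta_seq_lim; assumption.
Qed.

Lemma zeta_cvg (s : C) : 0 < Re s -> s <> 1 ->
  filterlim (zeta_seq s) eventually (locally (T := C_UniformSpace) (zeta s)).
Proof.
intros Hs H1; destruct (zeta_frac s Hs H1) as [l [Hl ->]].
apply zeta_seq_lim; assumption.
Qed.

Lemma Rpower_lim0 (e : R) : 0 < e ->
  is_lim_seq (fun N => Rpower (INR (S N)) (- e)) 0.
Proof.
intros He; unfold Rpower.
apply (is_lim_comp_seq exp (fun N => - e * ln (INR (S N))) m_infty 0).
- apply is_lim_exp_m.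
- exists 0%nat; intros n _; discriminate.
- replace m_infty with (Rbar_mult (- e) p_infty).
  + apply is_lim_seq_scal_l.
    apply (is_lim_comp_seq ln (fun N => INR (S N)) p_infty p_infty).
    * apply is_lim_ln_p.
    * exists 0%nat; intros n _; discriminate.
    * apply (is_lim_seq_incr_1 INR), is_lim_seq_INR.
  + apply is_Rbar_mult_unique, is_Rbar_mult_sym, is_Rbar_mult_p_infty_neg.
    simpl; lra.
Qed.

Lemma zeta_dirichlet (s : C) : 1 < Re s ->
  is_series (V := C_NormedModule) (fun k => RCpow (INR (S k)) (- s)) (zeta s).
Proof.
intros Hs.
assert (H1 : s <> 1) by (intros ->; simpl in Hs; lra).
assert (H1' : (1 - s)%C <> 0).
{ intros E; apply H1; rewrite <- (Cplus_0_l s), <- E; ring. }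
assert (Hz := zeta_cvg s ltac:(lra) H1).
assert (Hz' : filterlim (fun N => zeta_seq s (S N)) eventually
                (locally (T := C_UniformSpace) (zeta s))).
{ intros P HP; destruct (Hz P HP) as [N HN]; exists N.
  intros n Hn; apply HN; lia. }
assert (H0 : filterlim (fun N => RCpow (INR (S N)) (1 - s) / (1 - s))%C eventually
               (locally (T := C_NormedModule) (RtoC 0))).
{ apply (filterlim_locally_ball_norm (U := C_NormedModule)); intros eps.
  assert (L : is_lim_seq (fun N => Rpower (INR (S N)) (- (Re s - 1))
                                   * / Cmod (1 - s)) (0 * / Cmod (1 - s))).
  { apply (is_lim_seq_scal_r _ (/ Cmod (1 - s)) 0), Rpower_lim0; lra. }
  rewrite Rmult_0_l in L.
  apply is_lim_seq_spec in L; destruct (L eps) as [N HN]; exists N.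
  intros n Hn; specialize (HN n Hn).
  change (Cmod (RCpow (INR (S n)) (1 - s) / (1 - s) - 0) < eps).
  replace (RCpow (INR (S n)) (1 - s) / (1 - s) - 0)%C
    with (RCpow (INR (S n)) (1 - s) / (1 - s))%C by ring.
  rewrite Cmod_div, Cmod_RCpow by exact H1'.
  replace (Re (1 - s)) with (- (Re s - 1))
    by (destruct s; unfold Cminus, Cplus, Copp, RtoC, Re; simpl; ring).
  eapply Rle_lt_trans; [apply Rle_abs | ].
  rewrite Rminus_0_r in HN; exact HN. }
unfold is_series.
replace (zeta s) with (zeta s + 0)%C by ring.
apply (filterlim_ext
  (fun N => zeta_seq s (S N) + RCpow (INR (S N)) (1 - s) / (1 - s))%C).
2:{ apply (filterlim_comp_2 _ _ Cplus Hz' H0).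
    apply (filterlim_plus (V := C_NormedModule)). }
intros N; unfold zeta_seq.
rewrite <- (sum_n_m_S (G := C_AbelianMonoid) (fun n => RCpow (INR n) (- s)) 0 N).
change (sum_n (G := C_NormedModule) (fun n => RCpow (INR (S n)) (- s)) N)
  with (sum_n_m (G := C_AbelianMonoid) (fun n => RCpow (INR (S n)) (- s)) 0 N).
generalize (sum_n_m (G := C_AbelianMonoid) (fun n => RCpow (INR (S n)) (- s)) 0 N).
generalize (RCpow (INR (S N)) (1 - s) / (1 - s))%C.
intros w z; change (z - w + w = z)%C; ring.
Qed.

Lemma series_Cmod_le (a : nat -> C) (b : nat -> R) (l : C) (B : R) :
  is_series (V := C_NormedModule) a l -> is_series b B ->
  (forall k, Cmod (a k) <= b k) -> Cmod l <= B.
Proof.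
intros Ha Hb Hab.
apply (is_lim_seq_le (fun N => norm (sum_n (G := C_NormedModule) a N))
         (sum_n b) (Cmod l) B).
- intros N; eapply Rle_trans; [apply norm_sum_n_m | ].
  apply sum_n_m_le; exact Hab.
- apply (filterlim_comp _ _ _ _ norm _ _ _ Ha).
  apply (filterlim_norm (V := C_NormedModule)).
- exact Hb.
Qed.

Lemma is_derive_C_quad (f : C -> C) (s d : C) (delta B : R) :
  0 < delta ->
  (forall h : C, Cmod h < delta ->
     Cmod (f (s + h)%C - f s - h * d) <= B * Cmod h ^ 2) ->
  is_derive (K := C_AbsRing) (V := C_NormedModule) f s d.
Proof.
intros Hd HB; split.
- apply (is_linear_scal_l (K := C_AbsRing) (V := C_NormedModule)).
- intros x Hx eps.
  apply (is_filter_lim_locally_unique (V := AbsRing_NormedModule C_AbsRing)) in Hx.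
  subst x.
  apply (locally_le_locally_norm (V := AbsRing_NormedModule C_AbsRing)).
  assert (Hp : 0 < Rmin delta (eps / (Rabs B + 1))).
  { apply Rmin_pos; [exact Hd | ].
    apply Rdiv_lt_0_compat; [apply cond_pos | ].
    assert (H := Rabs_pos B); lra. }
  exists (mkposreal _ Hp); intros y Hy.
  change C in y.
  change (Cmod (y - s) < Rmin delta (eps / (Rabs B + 1))) in Hy.
  change (Cmod (f y - f s - (y - s) * d) <= eps * Cmod (y - s)).
  assert (H := HB (y - s)%C (Rlt_le_trans _ _ _ Hy (Rmin_l _ _))).
  replace (s + (y - s))%C with (y : C) in H by ring.
  eapply Rle_trans; [exact H | ].
  assert (H0 := Cmod_ge_0 (y - s)); assert (HB0 := Rle_abs B).
  assert (HB1 := Rabs_pos B).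
  apply Rlt_le in Hy.
  apply (Rle_trans _ _ (eps / (Rabs B + 1))) in Hy; [ | apply Rmin_r].
  replace (B * Cmod (y - s) ^ 2) with (B * Cmod (y - s) * Cmod (y - s)) by ring.
  apply Rmult_le_compat_r; [exact H0 | ].
  apply Rle_trans with ((Rabs B + 1) * Cmod (y - s)).
  + apply Rmult_le_compat_r; lra.
  + apply (Rmult_le_compat_l (Rabs B + 1)) in Hy; [ | lra].
    replace ((Rabs B + 1) * (eps / (Rabs B + 1))) with (pos eps) in Hy
      by (field; lra).
    exact Hy.
Qed.

Lemma zeta_holomorphic (s : C) : 0 < Re s -> s <> 1 ->
  ex_derive (K := C_AbsRing) (V := C_NormedModule) zeta s.
Proof.
intros Hs H1.
assert (Hw : (s - 1)%C <> 0).
{ intros E; apply H1; rewrite <- (Cplus_0_l 1), <- E; ring. }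
set (m := Cmod (s - 1)).
assert (Hm : 0 < m) by (apply Cmod_gt_0, Hw).
destruct (zeta_frac s Hs H1) as [g [Hg Ez]].
assert (Hp := p_series (Re s / 2) ltac:(lra)).
destruct Hp as [p Hp].
assert (Hd : ex_series (V := C_NormedModule) (fun k => frac_dint (S k) s)).
{ apply (ex_series_le (V := C_CompleteNormedModule) _
    (fun k => 2 / Re s * Rpower (INR (S k)) (- 1 - Re s / 2))).
  - intros n; apply frac_dint_le; [lia | exact Hs].
  - apply (ex_series_scal (V := R_NormedModule)); exists p; exact Hp. }
destruct Hd as [d Hd].
set (B := 64 / Re s ^ 2 * p).
set (delta := Rmin 1 (Rmin (Re s / 4) (m / 2))).
assert (Hdelta : 0 < delta) by (repeat apply Rmin_pos; lra).
exists (- / ((s - 1) * (s - 1)) - g - s * d)%C.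
apply (is_derive_C_quad _ _ _ delta (2 / m ^ 3 + Cmod s * B + (Cmod d + B))).
{ exact Hdelta. }
intros h Hh.
assert (Hh1 : Cmod h < 1) by (eapply Rlt_le_trans; [exact Hh | apply Rmin_l]).
assert (Hh2 : Cmod h < Rmin (Re s / 4) (m / 2))
  by (eapply Rlt_le_trans; [exact Hh | apply Rmin_r]).
assert (Hh3 : Cmod h < Re s / 4)
  by (eapply Rlt_le_trans; [exact Hh2 | apply Rmin_l]).
assert (Hh4 : Cmod h < m / 2)
  by (eapply Rlt_le_trans; [exact Hh2 | apply Rmin_r]).
assert (Hh0 := Cmod_ge_0 h).
assert (Hwh : m / 2 <= Cmod (s - 1 + h)).
{ assert (H := Cmod_triangle (s - 1 + h) (- h)).
  replace (s - 1 + h + - h)%C with (s - 1)%C in H by ring.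
  rewrite Cmod_opp in H; fold m in H; lra. }
assert (Hwh0 : (s - 1 + h)%C <> 0).
{ intros E; rewrite E, Cmod_0 in Hwh; lra. }
assert (Hs' : 0 < Re (s + h)).
{ rewrite re_plus; assert (H := re_le_Cmod h); apply Rabs_le_between in H; lra. }
assert (H1' : (s + h)%C <> 1).
{ intros E; apply Hwh0; replace (s - 1 + h)%C with ((s + h) - 1)%C by ring.
  rewrite E; ring. }
destruct (zeta_frac (s + h) Hs' H1') as [gh [Hgh Ezh]].
set (rem := (gh - g - h * d)%C).
assert (Hrem : Cmod rem <= Cmod h ^ 2 * B).
{ unfold B; rewrite <- Rmult_assoc.
  refine (series_Cmod_le
    (fun k => frac_int (S k) (s + h) - frac_int (S k) s - h * frac_dint (S k) s)%C
    (fun k => Cmod h ^ 2 * (64 / Re s ^ 2) * Rpower (INR (S k)) (- 1 - Re s / 2))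
    _ _ _ _ _).
  - apply (is_series_minus (V := C_NormedModule)).
    + apply (is_series_minus (V := C_NormedModule)); assumption.
    + apply (is_series_scal (V := C_NormedModule) h); exact Hd.
  - apply (is_series_scal (V := R_NormedModule)); exact Hp.
  - intros k; apply frac_rem_le; [lia | exact Hs | lra]. }
rewrite Ez, Ezh.
replace ((s + h) / (s + h - 1) - (s + h) * gh - (s / (s - 1) - s * g)
         - h * (- / ((s - 1) * (s - 1)) - g - s * d))%C
  with (h * h / ((s - 1) * (s - 1) * (s - 1 + h))
        + - (s * rem) + - (h * (h * d + rem)))%C.
2:{ unfold rem; field; repeat split; try assumption.
    replace (s + h - 1)%C with (s - 1 + h)%C by ring; exact Hwh0. }
eapply Rle_trans; [apply Cmod_triangle | ].
eapply Rle_trans; [apply Rplus_le_compat_r, Cmod_triangle | ].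
rewrite !Cmod_opp, Cmod_div, !Cmod_mult
  by (repeat apply Cmult_neq_0; assumption).
fold m.
replace ((2 / m ^ 3 + Cmod s * B + (Cmod d + B)) * Cmod h ^ 2) with
  (Cmod h * Cmod h * (2 / m ^ 3) + Cmod s * (Cmod h ^ 2 * B)
   + (Cmod h ^ 2 * Cmod d + Cmod h ^ 2 * B)) by ring.
apply Rplus_le_compat; [apply Rplus_le_compat | ].
- unfold Rdiv; apply Rmult_le_compat_l; [apply Rmult_le_pos; exact Hh0 | ].
  replace (2 * / m ^ 3) with (/ (m * m * (m / 2))) by (field; lra).
  apply Rinv_le_contravar.
  + repeat apply Rmult_lt_0_compat; lra.
  + apply Rmult_le_compat_l; [apply Rmult_le_pos; lra | exact Hwh].
- apply Rmult_le_compat_l; [apply Cmod_ge_0 | exact Hrem].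
- apply Rle_trans with (Cmod h * (Cmod h * Cmod d) + Cmod h * Cmod rem).
  + rewrite <- Rmult_plus_distr_l, <- (Cmod_mult h d).
    apply Rmult_le_compat_l; [exact Hh0 | apply Cmod_triangle].
  + apply Rplus_le_compat; [right; ring | ].
    assert (Hr0 := Cmod_ge_0 rem).
    apply Rle_trans with (1 * Cmod rem); [ | lra].
    apply Rmult_le_compat_r; lra.
Qed.

(* Main.v *)
(** The proof is the resonance method, carried out with real integrals only.

    On [0, Z] the real part of [zeta (sigma + i t)] is a sum of [k^(-sigma) cos (t log k)]
    over [k <= N], [N] of order [Z^2], minus an explicit polar term, up to a small error.
    Multiply by [|R t|^2], where [R] is a Dirichlet polynomial with nonnegative coefficients,
    and integrate against a weight on [[T^beta, T]] which is a combination of three Fejer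
    weights.  The weight at scale [T] contributes only nonnegative terms to the main sum, and
    among them those with [n = k m], [m] and [n] frequencies of [R].  The other two, of scale
    [T^beta], cost at most [T^(beta + o(1)) R(0)^2], which is negligible as long as [R] has at
    most [T^(1 - beta - o(1))] terms; this is where [1 - beta] comes from.

    The frequencies of [R] are the logarithms of the rational numbers [prod p^(m_p)] with
    [m_p] in {-1, 0, 1}, for the primes [p] with [b < kappa(p) <= eps / (sigma - 1/2)], where
    [kappa(p) = log (p / (log T log log T))].  The coefficient is the product of
    [c p^(-sigma) / kappa(p)] over the primes with [m_p <> 0], truncated to the states for
    which the sum of [kappa(p)] over these primes is at most about [(1 - beta) log T]; this
    bounds the number of terms.  Both exponents [1] and [-1] gain [p^(-2 sigma) / kappa(p)] at
    the same entropy cost, so that optimizing [c] gives the factor [sqrt 2], and Mertens'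
    estimate gives [sum p^(-2 sigma) / kappa(p) ~ |log (sigma - 1/2)|
    (log T log log T)^(1 - 2 sigma) / log log T]. *)

Require Import Defs.
From Stdlib Require Import Reals Lra Lia List Permutation ZArith.
From mathcomp Require ssreflect ssrfun ssrbool eqtype ssrnat seq div prime bigop binomial zify.
From Coquelicot Require Import Coquelicot.
Import ListNotations.
Open Scope R_scope.

(** * Sums over lists *)

(** The constant may depend on [sigma] only, while the resonance estimate loses an [eps] and works
    only close to 1/2. Two facts reconcile this. Since 1/log log T <= sigma - 1/2, closeness of
    [sigma] to 1/2 forces T to be large, so no threshold depending on [eps] remains. And for every
    [sigma] the maximum is at least 1/50, so some negative constant always works and the largest
    constant exists. The scale X = log T log log T comes from counting the terms of R: the sum of
    e^(-(1 + eps) kappa(p)) over the primes is of the order of X / log X, hence of log T, and the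
    cutoff b makes it a small multiple of log T. The same cutoff keeps the coefficients small and
    makes the error in Mertens' estimate relatively small on blocks of logarithmic length b.
    Logarithms of rational numbers can be arbitrarily close at the scale 1/T, so |R|^2 cannot be
    integrated term by term. Rounding the frequencies to multiples of pi/T restores orthogonality
    and costs a constant factor, which is harmless because the gain is exponential. *)

Definition lsum {A : Type} (F : A -> R) (l : list A) : R :=
  fold_right (fun x s => F x + s) 0 l.

Section ListSums.
Context {A B : Type}.
Implicit Types (F G : A -> R) (l : list A).

Lemma lsum_app F l1 l2 : lsum F (l1 ++ l2) = lsum F l1 + lsum F l2.
Proof. induction l1 as [ | x l1 IH]; simpl; [ | rewrite IH]; ring. Qed.

Lemma lsum_ext F G l : (forall x, In x l -> F x = G x) -> lsum F l = lsum G l.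
Proof.
induction l as [ | x l IH]; intros H; simpl; [reflexivity | ].
rewrite H, IH; [reflexivity | | left; reflexivity].
intros y Hy; apply H; right; exact Hy.
Qed.

Lemma lsum_le F G l : (forall x, In x l -> F x <= G x) -> lsum F l <= lsum G l.
Proof.
induction l as [ | x l IH]; intros H; simpl; [lra | ].
apply Rplus_le_compat; [apply H; left; reflexivity | ].
apply IH; intros y Hy; apply H; right; exact Hy.
Qed.

Lemma lsum_0 l : lsum (fun _ : A => 0) l = 0.
Proof. induction l as [ | x l IH]; simpl; [ | rewrite IH]; ring. Qed.

Lemma lsum_ge_0 F l : (forall x, In x l -> 0 <= F x) -> 0 <= lsum F l.
Proof. intros H; rewrite <- (lsum_0 l); apply lsum_le, H. Qed.

Lemma lsum_plus F G l : lsum (fun x => F x + G x) l = lsum F l + lsum G l.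
Proof. induction l as [ | x l IH]; simpl; [ | rewrite IH]; ring. Qed.

Lemma lsum_scal c F l : lsum (fun x => c * F x) l = c * lsum F l.
Proof. induction l as [ | x l IH]; simpl; [ | rewrite IH]; ring. Qed.

Lemma lsum_scal_r c F l : lsum (fun x => F x * c) l = lsum F l * c.
Proof. induction l as [ | x l IH]; simpl; [ | rewrite IH]; ring. Qed.

Lemma lsum_opp F l : lsum (fun x => - F x) l = - lsum F l.
Proof. induction l as [ | x l IH]; simpl; [ | rewrite IH]; ring. Qed.

Lemma lsum_const c l : lsum (fun _ : A => c) l = INR (length l) * c.
Proof.
induction l as [ | x l IH]; [simpl; ring | ].
change (length (x :: l)) with (S (length l)); rewrite S_INR; simpl.
rewrite IH; ring.
Qed.

Lemma lsum_Rabs F l : Rabs (lsum F l) <= lsum (fun x => Rabs (F x)) l.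
Proof.
induction l as [ | x l IH]; simpl; [rewrite Rabs_R0; lra | ].
eapply Rle_trans; [apply Rabs_triang | lra].
Qed.

Lemma lsum_map (h : B -> A) F (l : list B) :
  lsum F (map h l) = lsum (fun x => F (h x)) l.
Proof. induction l as [ | x l IH]; simpl; [ | rewrite IH]; reflexivity. Qed.

Lemma lsum_flat_map (h : B -> list A) F (l : list B) :
  lsum F (flat_map h l) = lsum (fun x => lsum F (h x)) l.
Proof.
induction l as [ | x l IH]; simpl; [ | rewrite lsum_app, IH]; reflexivity.
Qed.

Lemma lsum_filter (P : A -> bool) F l :
  lsum F (filter P l) = lsum (fun x => if P x then F x else 0) l.
Proof.
induction l as [ | x l IH]; simpl; [reflexivity | ].
destruct (P x); simpl; rewrite IH; ring.
Qed.

Lemma lsum_perm F l1 l2 : Permutation l1 l2 -> lsum F l1 = lsum F l2.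
Proof. induction 1; simpl; lra. Qed.

End ListSums.

Lemma lsum_swap {A B : Type} (F : A -> B -> R) (l : list A) (l' : list B) :
  lsum (fun x => lsum (F x) l') l = lsum (fun y => lsum (fun x => F x y) l) l'.
Proof.
induction l as [ | x l IH]; simpl.
- symmetry; apply lsum_0.
- rewrite IH, <- lsum_plus; reflexivity.
Qed.

Lemma lsum_mult {A B : Type} (F : A -> R) (G : B -> R) l l' :
  lsum F l * lsum G l' = lsum (fun x => lsum (fun y => F x * G y) l') l.
Proof.
rewrite <- lsum_scal_r; apply lsum_ext; intros x _; symmetry; apply lsum_scal.
Qed.

Lemma lsum_incl {A : Type} (F : A -> R) l l' :
  NoDup l -> incl l l' -> (forall x, In x l' -> 0 <= F x) ->
  lsum F l <= lsum F l'.
Proof.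
intros Hl; revert l'; induction Hl as [ | x l Hx Hl IH]; intros l' Hi HF.
- apply lsum_ge_0, HF.
- destruct (in_split x l') as [l1 [l2 ->]]; [apply Hi; left; reflexivity | ].
  rewrite lsum_app; simpl.
  assert (H : lsum F l <= lsum F (l1 ++ l2)).
  { apply IH.
    - intros y Hy; assert (H := Hi y (or_intror Hy)).
      rewrite in_app_iff in *; destruct H as [H | [-> | H]]; tauto.
    - intros y Hy; apply HF; rewrite in_app_iff in *; simpl; tauto. }
  rewrite lsum_app in H; lra.
Qed.

Lemma lsum_pick {A : Type} (dec : forall x y : A, {x = y} + {x <> y})
  (k : A) (c : R) l :
  NoDup l -> In k l -> lsum (fun x => if dec k x then c else 0) l = c.
Proof.
induction 1 as [ | x l Hx Hl IH]; intros Hk; [contradiction | ]; simpl.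
destruct (dec k x) as [<- | Hn].
- rewrite (lsum_ext _ (fun _ => 0)), lsum_0; [ring | ].
  intros y Hy; destruct (dec k y) as [<- | ]; [contradiction | reflexivity].
- rewrite IH; [ring | destruct Hk; congruence].
Qed.

Lemma lsum_fiber {A B : Type} (dec : forall x y : B, {x = y} + {x <> y})
  (key : A -> B) (F : A -> R) l (ks : list B) :
  NoDup ks -> (forall x, In x l -> In (key x) ks) ->
  lsum F l =
  lsum (fun k => lsum (fun x => if dec (key x) k then F x else 0) l) ks.
Proof.
intros Hk Hl; rewrite <- (lsum_swap (fun x k => if dec (key x) k then F x else 0)).
apply lsum_ext; intros x Hx; symmetry; apply lsum_pick; auto.
Qed.

Lemma lsum_CS {A : Type} (F G : A -> R) l :
  lsum (fun x => F x * G x) l <=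
  sqrt (lsum (fun x => F x ^ 2) l) * sqrt (lsum (fun x => G x ^ 2) l).
Proof.
set (a := lsum (fun x => F x ^ 2) l); set (b := lsum (fun x => G x ^ 2) l).
assert (Ha : 0 <= a) by (apply lsum_ge_0; intros; apply pow2_ge_0).
assert (Hb : 0 <= b) by (apply lsum_ge_0; intros; apply pow2_ge_0).
assert (Hq : forall t, 0 <= t ^ 2 * a - 2 * t * lsum (fun x => F x * G x) l + b).
{ intros t.
  replace (_ - _ + _) with (lsum (fun x => (t * F x - G x) ^ 2) l).
  - apply lsum_ge_0; intros; apply pow2_ge_0.
  - unfold a, b; rewrite <- !lsum_scal.
    unfold Rminus; rewrite <- lsum_opp, <- !lsum_plus.
    apply lsum_ext; intros; ring. }
set (c := lsum (fun x => F x * G x) l) in *.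
rewrite <- sqrt_mult by assumption.
destruct (Rle_dec c 0) as [Hc | Hc].
{ eapply Rle_trans; [exact Hc | apply sqrt_pos]. }
rewrite <- (sqrt_Rsqr c) by lra; apply sqrt_le_1_alt; unfold Rsqr.
destruct Ha as [Ha | Ha].
- assert (H := Hq (c / a)).
  replace ((c / a) ^ 2 * a - 2 * (c / a) * c + b) with ((a * b - c * c) / a) in H
    by (field; lra).
  apply (Rmult_le_compat_r a) in H; [ | lra].
  unfold Rdiv in H; rewrite Rmult_assoc, Rinv_l in H by lra; lra.
(* For a = 0 the quadratic is affine in t with slope -2c < 0, and this t makes it equal to -b -
   2. *)
- rewrite <- Ha in *; assert (H := Hq ((b + 1) / c)).
  replace (((b + 1) / c) ^ 2 * 0 - 2 * ((b + 1) / c) * c + b)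
    with (- b - 2) in H by (field; lra); lra.
Qed.

Lemma lsum_sqr_le {A : Type} (F : A -> R) l :
  lsum F l ^ 2 <= INR (length l) * lsum (fun x => F x ^ 2) l.
Proof.
assert (Hn := pos_INR (length l)).
assert (Ha : 0 <= lsum (fun x => F x ^ 2) l)
  by (apply lsum_ge_0; intros; apply pow2_ge_0).
assert (H := lsum_CS (fun _ => 1) (fun x => Rabs (F x)) l).
rewrite (lsum_ext (fun _ => 1 ^ 2) (fun _ => 1)) in H by (intros; ring).
rewrite (lsum_ext (fun x => Rabs (F x) ^ 2) (fun x => F x ^ 2)) in H
  by (intros; apply pow2_abs).
rewrite (lsum_ext (fun x => 1 * Rabs (F x)) (fun x => Rabs (F x))) in H
  by (intros; ring).
rewrite lsum_const, Rmult_1_r, <- sqrt_mult in H by assumption.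
rewrite <- pow2_abs; assert (H0 := lsum_Rabs F l).
assert (Rabs (lsum F l) <= sqrt (INR (length l) * lsum (fun x => F x ^ 2) l)) by lra.
rewrite <- (pow2_sqrt (INR (length l) * _)) by (apply Rmult_le_pos; assumption).
apply pow_incr; split; [apply Rabs_pos | assumption].
Qed.

(** * Mertens' estimate for the sum of log p / p *)

Definition primes_upto (n : nat) : list nat :=
  filter prime.prime (List.seq 1 n).

Module Mertens.
Import ssreflect ssrfun ssrbool eqtype ssrnat seq div prime bigop binomial zify.

Lemma in_primes_upto n p : List.In p (primes_upto n) <-> prime p /\ (p <= n)%N.
Proof.
rewrite /primes_upto filter_In in_seq; split.
- move=> [[H1 H2] pp]; split=> //; apply/leP; lia.
- move=> [pp /leP H]; split=> //; move: (prime_gt0 pp) => /leP; lia.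
Qed.

Lemma NoDup_primes_upto n : NoDup (primes_upto n).
Proof. apply: NoDup_filter; exact: seq_NoDup. Qed.

Lemma ln_nat_ge0 n : 0 <= ln (INR n).
Proof.
case: n => [|n]; first by rewrite /= /ln; case: Rlt_dec => // H; [exfalso; lra | lra].
have H : 1 <= INR n.+1 by rewrite S_INR; move: (pos_INR n); lra.
by rewrite -ln_1; apply: ln_le; lra.
Qed.

Lemma INR_gt0 n : (0 < n)%N -> 0 < INR n.
Proof. by move=> /ltP H; apply: lt_0_INR. Qed.

(** The index set depends on n and not on m, so that the same sum serves m and its cofactor when the
    smallest prime divisor is split off. *)
Lemma ln_factorization n m : (0 < m)%N -> (m <= n)%N ->
  ln (INR m) = lsum (fun p => INR (logn p m) * ln (INR p)) (primes_upto n).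
Proof.
elim: m {-2}m (leqnn m) => [|k IH] m; first by case: m.
move=> mk m0 mn; case: (ltnP 1 m) => m1; last first.
  have -> : m = 1%N by apply/eqP; rewrite eqn_leq m1 m0.
  rewrite (lsum_ext _ (fun _ => 0)); first by rewrite lsum_0 /= ln_1.
  by move=> p _; rewrite logn1 /= Rmult_0_l.
set q := pdiv m; have pq : prime q by apply: pdiv_prime.
have /dvdnP [c mE] : q %| m by apply: pdiv_dvd.
have c0 : (0 < c)%N by move: m0; rewrite mE muln_gt0 => /andP [].
have q0 := prime_gt0 pq.
have cm : (c < m)%N by rewrite mE ltn_Pmulr ?prime_gt1.
rewrite {1}mE -multE mult_INR ln_mult; try exact: INR_gt0.
rewrite (IH c) //; [|by rewrite -ltnS (leq_trans cm)|by rewrite ltnW ?(leq_trans cm)].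
have qn : List.In q (primes_upto n).
  apply/in_primes_upto; split=> //; apply: leq_trans mn; apply: dvdn_leq => //; exact: pdiv_dvd.
rewrite -[X in _ + X = _](lsum_pick PeanoNat.Nat.eq_dec q _ _ (NoDup_primes_upto n) qn).
rewrite -lsum_plus; apply: lsum_ext => p Hp.
rewrite mE lognM // (logn_prime p pq) plus_INR.
case: PeanoNat.Nat.eq_dec => [<-|H]; first by rewrite eqxx /=; lra.
have -> : (p == q) = false by apply/eqP => E; apply: H.
by rewrite /=; lra.
Qed.

Lemma ln_primes_dvd n m (l : list nat) : (0 < m)%N -> (m <= n)%N -> NoDup l ->
  (forall p, List.In p l -> prime p && (p %| m)) ->
  lsum (fun p => ln (INR p)) l <= ln (INR m).
Proof.
move=> m0 mn nl H; rewrite (ln_factorization n) //.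
apply: Rle_trans (_ : lsum (fun p => INR (logn p m) * ln (INR p)) l <= _).
  apply: lsum_le => p /H /andP [pp dv].
  have : (0 < logn p m)%N by rewrite logn_gt0 mem_primes pp m0.
  move=> /leP /le_INR /= H1; move: (ln_nat_ge0 p); nra.
apply: lsum_incl => //.
  move=> p /H /andP [pp dv]; apply/in_primes_upto; split=> //.
  by apply: leq_trans mn; apply: dvdn_leq.
by move=> p _; apply: Rmult_le_pos; [exact: pos_INR|exact: ln_nat_ge0].
Qed.

Lemma ln_le_sub1 x : 0 < x -> ln x <= x - 1.
Proof. by move=> x0; move: (exp_ineq1_le (ln x)); rewrite exp_ln //; lra. Qed.

Lemma ln2_lt1 : ln 2 <= 1.
Proof. by move: (ln_le_sub1 2); lra. Qed.

Lemma bin_le_pow2 n k : ('C(n, k) <= 2 ^ n)%N.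
Proof.
elim: n k => [|n IH] [|k]; rewrite ?bin0 ?expn_gt0 ?bin0n //.
by rewrite binS expnS mul2n -addnn leq_add.
Qed.

(** Chebyshev's argument: every prime in (m, 2m] divides the central binomial coefficient, which is
    at most 2^(2m). *)
Lemma theta_double m :
  lsum (fun p => ln (INR p)) (primes_upto m.*2) <=
  lsum (fun p => ln (INR p)) (primes_upto m) + INR m.*2.
Proof.
set F := fun p => ln (INR p).
have -> : lsum F (primes_upto m.*2) =
   lsum F (primes_upto m) + lsum F (List.filter prime (List.seq m.+1 m)).
  by rewrite -lsum_app /primes_upto -filter_app -(seq_app m m 1) -addnn plusE.
apply: Rplus_le_compat_l.
have b0 : (0 < 'C(m.*2, m))%N by rewrite bin_gt0 -addnn leq_addr.
apply: Rle_trans (ln_primes_dvd _ _ _ b0 (leqnn _) _ _) _.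
- by apply: NoDup_filter; exact: seq_NoDup.
- move=> p; rewrite filter_In in_seq => -[[H1 H2] pp]; rewrite pp /=.
  have /bin_fact E : (m <= m.*2)%N by rewrite -addnn leq_addr.
  have : p %| (m.*2)`!.
    rewrite dvdn_fact // prime_gt0 //=; apply/leP; rewrite -addnn -plusE; lia.
  rewrite -E !Euclid_dvdM // => /orP [//|].
  have nd j : (j <= m)%N -> p %| j`! = false.
    move=> jm; apply/negP => /(@dvdn_leq_log p p _ (fact_gt0 j)).
    rewrite logn_prime // eqxx logn_fact // big_nat_cond big1 // => i /andP [/andP [i1 _] _].
    apply: divn_small; apply: leq_ltn_trans jm _.
    apply: (@leq_trans p); first by apply/leP; lia.
    by have := leq_pexp2l (prime_gt0 pp) i1; rewrite expn1.
  rewrite !nd //; rewrite -addnn addnK //.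
- have : INR 'C(m.*2, m) <= 2 ^ m.*2.
    have := bin_le_pow2 m.*2 m => /leP /le_INR.
    suff -> : forall j, INR (2 ^ j)%N = 2 ^ j by [].
    by elim=> [|j IH] //; rewrite expnS -multE mult_INR IH.
  move=> H; apply: Rle_trans (ln_le _ _ (INR_gt0 _ b0) H) _.
  rewrite ln_pow; last lra.
  move: (pos_INR m.*2) ln2_lt1 => *; nra.
Qed.

Lemma theta_le n : lsum (fun p => ln (INR p)) (primes_upto n) <= 6 * INR n.
Proof.
elim: n {-2}n (leqnn n) => [|k IH] n.
  by rewrite leqn0 => /eqP -> /=; lra.
case: n => [|[|n]] nk; [by move=> /=; lra|by rewrite /= ; lra|].
(* Rounding the half up gives a doubled value that covers the argument x and is at most x + 1. The
   induction then needs 8m <= 4(x + 1) <= 6x, true for x >= 2; this fixes the constant 6. *)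
set m := uphalf n.+2.
have Hm : (n.+2 <= m.*2 <= n.+3)%N by rewrite /m; lia.
have mk : (m <= k)%N by rewrite /m; lia.
have {Hm} [Hm Hm3] : (n.+2 <= m.*2)%N /\ 2 * INR m <= INR n.+2 + 1.
  move: Hm => /andP [H1 H2]; split=> //.
  have : INR (m.*2) <= INR n.+3 by apply/le_INR/leP.
  by rewrite -muln2 -multE mult_INR [INR n.+3]S_INR /=; lra.
apply: Rle_trans (_ : lsum (fun p => ln (INR p)) (primes_upto m.*2) <= _).
  apply: lsum_incl; first exact: NoDup_primes_upto.
    by move=> p /in_primes_upto [pp H]; apply/in_primes_upto; split=> //; apply: leq_trans Hm.
  by move=> p _; exact: ln_nat_ge0.
apply: Rle_trans (theta_double m) _; have := IH _ mk.
rewrite -muln2 -multE mult_INR.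
have : 2 <= INR n.+2 by rewrite !S_INR; move: (pos_INR n); lra.
rewrite [INR 2]/=; lra.
Qed.

Lemma logn_fact_ge p n : prime p -> INR n / INR p - 1 <= INR (logn p n`!).
Proof.
move=> pp; have p0 := INR_gt0 _ (prime_gt0 pp).
have H : (n %/ p <= logn p n`!)%N.
  rewrite logn_fact //; case: n => [|n]; first by rewrite div0n.
  by rewrite big_ltn // expn1 leq_addr.
move: H => /leP /le_INR H; apply: Rle_trans H.
have : INR n <= (INR (n %/ p) + 1) * INR p.
  rewrite -S_INR -mult_INR; apply: le_INR; apply/leP; rewrite multE.
  by rewrite ltnW // ltn_ceil // prime_gt0.
move=> H; apply: (Rmult_le_reg_r (INR p)) => //.
rewrite Rmult_minus_distr_r /Rdiv Rmult_assoc Rinv_l; lra.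
Qed.

Lemma logn_fact_le p n : prime p -> INR (logn p n`!) <= INR n / (INR p - 1).
Proof.
move=> pp; have p1 : 1 < INR p by apply: (lt_INR 1); apply/ltP; exact: prime_gt1.
rewrite logn_fact //.
(* Legendre's sum is truncated at K and the exact tail of the geometric series is added, so that the
   induction on K closes. *)
suff H K : INR (\sum_(1 <= k < K.+1) n %/ p ^ k) + INR n / ((INR p - 1) * INR p ^ K)
    <= INR n / (INR p - 1).
  apply: Rle_trans (H n); suff : 0 <= INR n / ((INR p - 1) * INR p ^ n) by lra.
  apply: Rmult_le_pos; first exact: pos_INR.
  by apply/Rlt_le/Rinv_0_lt_compat/Rmult_lt_0_compat; [lra|apply: pow_lt; lra].
elim: K => [|K IH]; first by rewrite big_geq //= Rmult_1_r; lra.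
rewrite big_nat_recr //= plus_INR; apply: Rle_trans IH.
have pK : 0 < INR p ^ K by apply: pow_lt; lra.
have : INR (n %/ p ^ K.+1) <= INR n / (INR p * INR p ^ K).
  apply: (Rmult_le_reg_r (INR p * INR p ^ K)); first by apply: Rmult_lt_0_compat; lra.
  rewrite /Rdiv Rmult_assoc Rinv_l ?Rmult_1_r; last first.
    by apply: Rgt_not_eq; apply: Rmult_lt_0_compat; lra.
  have <- : INR (p ^ K.+1)%N = INR p * INR p ^ K.
    rewrite expnS -multE mult_INR; congr (_ * _).
    by elim: (K) => [|j IH] //; rewrite expnS -multE mult_INR IH.
  by rewrite -mult_INR; apply: le_INR; apply/leP; rewrite multE leq_trunc_div.
move=> H; suff -> : INR n / ((INR p - 1) * INR p ^ K) =
   INR n / (INR p * INR p ^ K) + INR n / ((INR p - 1) * (INR p * INR p ^ K)) by lra.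
by field; repeat split; lra.
Qed.

Lemma ln_fact_bounds n : (0 < n)%N ->
  INR n * ln (INR n) - INR n <= ln (INR n`!) <= INR n * ln (INR n).
Proof.
elim: n => [|[|n] IH] // _; first by rewrite /= ln_1; lra.
have {IH} := IH isT; set N := INR n.+1 => IH.
have N1 : 1 <= N by rewrite /N S_INR; move: (pos_INR n); lra.
rewrite factS -multE mult_INR ln_mult; [|exact: INR_gt0|by apply/INR_gt0/fact_gt0].
rewrite S_INR -/N.
have Hln : ln N <= ln (N + 1) by apply: ln_le; lra.
have H2 : N * (ln (N + 1) - ln N) <= 1.
  rewrite -ln_div; try lra.
  have := ln_le_sub1 ((N + 1) / N) ltac:(apply: Rdiv_lt_0_compat; lra).
  have -> : (N + 1) / N - 1 = / N by field; lra.
  move=> /(Rmult_le_compat_l N) H; move: (H ltac:(lra)); rewrite Rinv_r; lra.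
nra.
Qed.

(** The exponent of p in n! is at least n/p - 1. The terms -1 cost the Chebyshev sum of ln p, whose
    bound 6n is the source of the constant. *)
Lemma mertens_le n : (0 < n)%N ->
  lsum (fun p => ln (INR p) / INR p) (primes_upto n) <= ln (INR n) + 6.
Proof.
move=> n0; have N0 := INR_gt0 _ n0; have [_ H1] := ln_fact_bounds _ n0.
have H2 := theta_le n.
have : lsum (fun p => (INR n / INR p - 1) * ln (INR p)) (primes_upto n) <= ln (INR n`!).
  rewrite (ln_factorization (n`!) (n`!)) ?fact_gt0 //.
  apply: Rle_trans (lsum_le _ (fun p => INR (logn p n`!) * ln (INR p)) _ _) _.
    move=> p /in_primes_upto [pp _]; apply: Rmult_le_compat_r; first exact: ln_nat_ge0.
    exact: logn_fact_ge.
  apply: lsum_incl; first exact: NoDup_primes_upto.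
    move=> p /in_primes_upto [pp H]; apply/in_primes_upto; split=> //.
    by apply: leq_trans H _; apply: dvdn_leq; rewrite ?fact_gt0 // dvdn_fact // n0 leqnn.
  by move=> p _; apply: Rmult_le_pos; [exact: pos_INR|exact: ln_nat_ge0].
rewrite (lsum_ext _ (fun p => INR n * (ln (INR p) / INR p) + - ln (INR p))); last first.
  by move=> p _; rewrite /Rdiv; ring.
rewrite lsum_plus lsum_scal lsum_opp => H3.
apply: (Rmult_le_reg_l (INR n)) => //; lra.
Qed.

(** A telescoping majorant: -(ln x + 1)/x is a primitive of ln x / x^2, and the 2 in place of 1
    absorbs the discretization. *)
Lemma ln_gap_le x : 1 <= x ->
  ln (x + 1) / ((x + 1) * x) <= (ln x + 2) / x - (ln (x + 1) + 2) / (x + 1).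
Proof.
move=> x1; have H := ln_le_sub1 ((x + 1) / x) ltac:(apply: Rdiv_lt_0_compat; lra).
rewrite ln_div in H; try lra.
have {}H : (x + 1) * (ln (x + 1) - ln x) <= 2.
  apply: Rle_trans (Rmult_le_compat_l (x + 1) _ _ ltac:(lra) H) _.
  apply: (Rmult_le_reg_r x); first lra.
  have -> : (x + 1) * ((x + 1) / x - 1) * x = x + 1 by field; lra.
  lra.
have -> : (ln x + 2) / x - (ln (x + 1) + 2) / (x + 1) =
  (2 + (x + 1) * ln x - x * ln (x + 1)) / ((x + 1) * x) by field; lra.
apply: Rmult_le_compat_r; last lra.
apply/Rlt_le/Rinv_0_lt_compat; nra.
Qed.

Lemma sum_ln_sq n :
  lsum (fun m => ln (INR m) / (INR m * (INR m - 1))) (List.seq 2 n)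
    <= 2 - (ln (INR n.+1) + 2) / INR n.+1.
Proof.
elim: n => [|n IH]; first by rewrite /= ln_1; lra.
set G := (fun m => _) in IH *.
rewrite seq_S lsum_app -[lsum G [_]]/(G n.+2 + 0) {2}/G.
have x1 : 1 <= INR n.+1 by rewrite S_INR; move: (pos_INR n); lra.
have := ln_gap_le _ x1; rewrite -S_INR.
have -> : INR n.+1 + 1 - 1 = INR n.+1 by ring.
by rewrite (S_INR n.+1) => H; lra.
Qed.

(** The exponent of p in n! is at most n/(p - 1) = n/p + n/(p(p - 1)); weighted by ln p, the second
    part sums to at most 2n. *)
Lemma mertens_ge n : (0 < n)%N ->
  ln (INR n) - 6 <= lsum (fun p => ln (INR p) / INR p) (primes_upto n).
Proof.
move=> n0; have N0 := INR_gt0 _ n0; have [H1 _] := ln_fact_bounds _ n0.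
set F := fun p => ln (INR p) / INR p.
set G := fun m => ln (INR m) / (INR m * (INR m - 1)).
have H2 : ln (INR n`!) <= INR n * (lsum F (primes_upto n) + lsum G (primes_upto n)).
  rewrite (ln_factorization (n`!) (n`!)) ?fact_gt0 //.
  rewrite -lsum_plus -lsum_scal.
  apply: Rle_trans (_ : lsum (fun p => INR (logn p n`!) * ln (INR p)) (primes_upto n) <= _).
    rewrite /primes_upto !lsum_filter.
    have -> : List.seq 1 n`! = List.app (List.seq 1 n) (List.seq n.+1 (n`! - n)).
      rewrite -(seq_app n (n`! - n) 1); congr List.seq.
      have : (n <= n`!)%N by rewrite fact_geq.
      by move=> /subnKC {1}<-.
    rewrite lsum_app [X in _ + X](lsum_ext _ (fun _ => 0)) ?lsum_0; first lra.
    move=> p /in_seq [H _]; case: ifP => // pp.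
    rewrite logn_fact // big_nat_cond big1 /= ?Rmult_0_l // => i /andP [/andP [i1 _] _].
    apply: divn_small; apply: (@leq_trans p); first by apply/leP; lia.
    by have := leq_pexp2l (prime_gt0 pp) i1; rewrite expn1.
  apply: lsum_le => p /in_primes_upto [pp _].
  have p1 : 1 < INR p by apply: (lt_INR 1); apply/ltP; exact: prime_gt1.
  apply: Rle_trans (Rmult_le_compat_r _ _ _ (ln_nat_ge0 p) (logn_fact_le p n pp)) _.
  by apply: Req_le; rewrite /F /G; field; lra.
have H3 : lsum G (primes_upto n) <= 2.
  apply: Rle_trans (_ : lsum G (List.seq 2 n) <= _).
    apply: lsum_incl; first exact: NoDup_primes_upto.
      move=> p /in_primes_upto [pp /leP H]; apply/in_seq.
      by move: (prime_gt1 pp) => /ltP; lia.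
    move=> m /in_seq [Hm _]; apply: Rmult_le_pos; first exact: ln_nat_ge0.
    apply/Rlt_le/Rinv_0_lt_compat; have := le_INR _ _ Hm; rewrite [INR 2]/=; nra.
  apply: Rle_trans (sum_ln_sq n) _.
  suff : 0 <= (ln (INR n.+1) + 2) / INR n.+1 by lra.
  apply: Rmult_le_pos; first by have := ln_nat_ge0 n.+1; lra.
  by apply/Rlt_le/Rinv_0_lt_compat/INR_gt0.
apply: (Rmult_le_reg_l (INR n)) => //.
have : INR n * (lsum F (primes_upto n) + lsum G (primes_upto n)) <=
  INR n * (lsum F (primes_upto n) + 2) by apply: Rmult_le_compat_l; lra.
lra.
Qed.

Lemma pow_cofactor_inj p a b m m' : prime p -> (0 < m)%N -> (0 < m')%N ->
  ~~ (p %| m) -> ~~ (p %| m') -> (p ^ a * m)%N = (p ^ b * m')%N -> a = b /\ m = m'.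
Proof.
move=> pp m0 m'0 nm nm' E.
have pe c : (0 < p ^ c)%N by rewrite expn_gt0 prime_gt0.
have ab : a = b.
  have := congr1 (logn p) E; rewrite !lognM // !pfactorK //.
  have z k : ~~ (p %| k) -> logn p k = 0%N.
    by move=> nk; apply/eqP; rewrite -leqn0 leqNgt logn_gt0 mem_primes (negbTE nk) !andbF.
  by rewrite !z // !addn0.
split=> //; move: E; rewrite ab => /eqP; rewrite eqn_pmul2l //; exact: eqP.
Qed.

End Mertens.

(** * Primes in real intervals *)

Definition nat_floor (x : R) : nat := Z.to_nat (Int_part x).

Lemma nat_floor_spec (x : R) : 0 <= x -> INR (nat_floor x) <= x < INR (nat_floor x) + 1.
Proof.
intros Hx; destruct (base_Int_part x) as [H1 H2].
assert (H : (0 <= Int_part x)%Z).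
{ apply Zlt_succ_le, lt_IZR; rewrite succ_IZR; lra. }
unfold nat_floor; rewrite INR_IZR_INZ, Z2Nat.id by exact H; lra.
Qed.

Definition primes_in (x y : R) : list nat :=
  filter (fun p => if Rlt_dec x (INR p) then true else false)
    (primes_upto (nat_floor y)).

Lemma in_primes_in (x y : R) (p : nat) : 0 <= y ->
  In p (primes_in x y) <-> prime.prime p = true /\ x < INR p <= y.
Proof.
intros Hy; unfold primes_in; rewrite filter_In, Mertens.in_primes_upto.
assert (Hf := nat_floor_spec y Hy).
assert (Hp : is_true (ssrnat.leq p (nat_floor y)) <-> INR p <= y).
{ split; intros H.
  - apply (ssrbool.elimT ssrnat.leP), le_INR in H; lra.
  - apply (ssrbool.introT ssrnat.leP), INR_le.
    destruct (le_lt_dec p (nat_floor y)) as [H' | H']; [apply le_INR, H' | ].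
    apply (le_INR (S _)) in H'; rewrite S_INR in H'; lra. }
rewrite Hp; destruct (Rlt_dec x (INR p)); intuition congruence.
Qed.

Lemma NoDup_primes_in (x y : R) : NoDup (primes_in x y).
Proof. apply NoDup_filter, Mertens.NoDup_primes_upto. Qed.

Lemma primes_in_split (F : nat -> R) (x y z : R) : 0 <= y -> x <= y <= z ->
  lsum F (primes_in x z) = lsum F (primes_in x y) + lsum F (primes_in y z).
Proof.
intros Hy Hxz; rewrite <- lsum_app; apply lsum_perm, NoDup_Permutation.
- apply NoDup_primes_in.
- apply NoDup_app; try apply NoDup_primes_in.
  intros p; rewrite !in_primes_in by lra; lra.
- intros p; rewrite in_app_iff, !in_primes_in by lra.
  destruct (Rle_dec (INR p) y); intuition lra.
Qed.

Lemma mertens_upto (y : R) : 1 <= y ->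
  ln y - 7 <= lsum (fun p => ln (INR p) / INR p) (primes_in 0 y) <= ln y + 6.
Proof.
intros Hy; assert (Hf := nat_floor_spec y ltac:(lra)).
assert (H0 : (0 < nat_floor y)%nat) by (apply INR_lt; simpl; lra).
assert (E : primes_in 0 y = primes_upto (nat_floor y)).
{ unfold primes_in; generalize (nat_floor y) as n; intros n.
  apply forallb_filter_id, forallb_forall; intros p Hp; apply Mertens.in_primes_upto in Hp; destruct Hp as [Hp _].
  apply prime.prime_gt0, (ssrbool.elimT ssrnat.ltP), lt_0_INR in Hp.
  destruct (Rlt_dec 0 (INR p)); [reflexivity | contradiction]. }
rewrite E; apply (ssrbool.introT ssrnat.ltP) in H0.
assert (H1 := Mertens.mertens_le _ H0); assert (H2 := Mertens.mertens_ge _ H0).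
apply (ssrbool.elimT ssrnat.ltP), lt_0_INR in H0.
assert (Hn : 1 <= INR (nat_floor y)).
{ apply (le_INR 1), INR_lt; simpl; lra. }
assert (H3 : ln (INR (nat_floor y)) <= ln y) by (apply ln_le; lra).
assert (H4 : ln y <= ln 2 + ln (INR (nat_floor y))).
{ rewrite <- ln_mult by lra; apply ln_le; lra. }
assert (H5 := Mertens.ln2_lt1); lra.
Qed.

(** The error is absolute, so the estimate is sharp only on intervals of large logarithmic length.
    This is why the primes are later grouped into blocks of length b with 13 <= eps b. *)
Lemma mertens_interval (x y : R) : 1 <= x <= y ->
  ln y - ln x - 13 <= lsum (fun p => ln (INR p) / INR p) (primes_in x y)
    <= ln y - ln x + 13.
Proof.
intros H; assert (H1 := mertens_upto x ltac:(lra)).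
assert (H2 := mertens_upto y ltac:(lra)).
rewrite (primes_in_split _ 0 x y) in H2 by lra; lra.
Qed.

(** * Product measures on words *)

Definition lprod {A : Type} (F : A -> R) (l : list A) : R :=
  fold_right (fun x r => F x * r) 1 l.

Lemma lprod_ge_0 {A : Type} (F : A -> R) l :
  (forall x, In x l -> 0 <= F x) -> 0 <= lprod F l.
Proof.
induction l as [ | x l IH]; intros H; simpl; [lra | ].
apply Rmult_le_pos; [apply H; left; reflexivity | ].
apply IH; intros y Hy; apply H; right; exact Hy.
Qed.

Lemma lprod_mult {A : Type} (F G : A -> R) l :
  lprod (fun x => F x * G x) l = lprod F l * lprod G l.
Proof. induction l as [ | x l IH]; simpl; [ | rewrite IH]; ring. Qed.

Lemma lprod_ext {A : Type} (F G : A -> R) l :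
  (forall x, In x l -> F x = G x) -> lprod F l = lprod G l.
Proof.
induction l as [ | x l IH]; intros H; simpl; [reflexivity | ].
rewrite H, IH; [reflexivity | | left; reflexivity].
intros y Hy; apply H; right; exact Hy.
Qed.

Lemma lprod_le {A : Type} (F G : A -> R) l :
  (forall x, In x l -> 0 <= F x <= G x) -> lprod F l <= lprod G l.
Proof.
induction l as [ | x l IH]; intros H; simpl; [lra | ].
assert (Hl : forall y, In y l -> 0 <= F y <= G y) by (intros; apply H; right; assumption).
apply Rmult_le_compat; [apply H; left; reflexivity | | apply H; left; reflexivity | auto].
apply lprod_ge_0; intros y Hy; apply Hl, Hy.
Qed.

Lemma exp_lsum {A : Type} (F : A -> R) l :
  exp (lsum F l) = lprod (fun x => exp (F x)) l.
Proof.
induction l as [ | x l IH]; simpl; [apply exp_0 | rewrite exp_plus, IH; reflexivity].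
Qed.

(** Each letter is stored with its index, so that product weights and additive statistics are
    [lprod] and [lsum] over the word itself. *)
Fixpoint words {P L : Type} (ps : list P) (al : list L) : list (list (P * L)) :=
  match ps with
  | [] => [[]]
  | p :: ps => flat_map (fun l => map (cons (p, l)) (words ps al)) al
  end.

Section Words.
Context {P L : Type} (al : list L).

Lemma in_words (ps : list P) c :
  In c (words ps al) <-> map fst c = ps /\ forall x, In x c -> In (snd x) al.
Proof.
revert c; induction ps as [ | p ps IH]; intros c; simpl.
- split.
  + intros [<- | []]; split; [reflexivity | intros x []].
  + intros [H _]; left; destruct c; [reflexivity | discriminate].
- rewrite in_flat_map; split.
  + intros [l [Hl Hc]]; apply in_map_iff in Hc; destruct Hc as [c' [<- Hc']].
    apply IH in Hc'; destruct Hc' as [<- Hc']; split; [reflexivity | ].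
    intros x [<- | Hx]; [exact Hl | apply Hc', Hx].
  + intros [H1 H2]; destruct c as [ | [p' l] c]; [discriminate | ].
    simpl in H1; injection H1 as -> H1.
    exists l; split; [apply (H2 (p, l)); left; reflexivity | ].
    apply in_map, IH; split; [exact H1 | ].
    intros x Hx; apply H2; right; exact Hx.
Qed.

Lemma NoDup_words (ps : list P) : NoDup al -> NoDup (words ps al).
Proof.
intros Hal; induction ps as [ | p ps IH]; simpl.
- constructor; [intros [] | constructor].
- revert IH; generalize (words ps al) as w; intros w IH.
  induction Hal as [ | l al' Hl Hal' IHal]; simpl; [constructor | ].
  apply NoDup_app.
  + apply FinFun.Injective_map_NoDup; [ | exact IH].
    intros x y H; injection H; auto.
  + exact IHal.
  + intros c Hc Hc'; apply in_map_iff in Hc; destruct Hc as [c1 [<- _]].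
    apply in_flat_map in Hc'; destruct Hc' as [l' [Hl' Hc']].
    apply in_map_iff in Hc'; destruct Hc' as [c2 [E _]].
    injection E as -> _; contradiction.
Qed.

Lemma lsum_words_cons (F : list (P * L) -> R) p ps :
  lsum F (words (p :: ps) al) =
  lsum (fun l => lsum (fun c => F ((p, l) :: c)) (words ps al)) al.
Proof.
simpl; rewrite lsum_flat_map; apply lsum_ext; intros l _; apply lsum_map.
Qed.

Variable wt : P * L -> R.

Lemma lsum_words_lprod ps :
  lsum (lprod wt) (words ps al) =
  lprod (fun p => lsum (fun l => wt (p, l)) al) ps.
Proof.
induction ps as [ | p ps IH]; [simpl; ring | ].
rewrite lsum_words_cons; simpl lprod; rewrite <- IH, lsum_mult.
apply lsum_ext; intros l _; apply lsum_ext; reflexivity.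
Qed.

Hypothesis wt_ge_0 : forall x, 0 <= wt x.

Let tau p := lsum (fun l => wt (p, l)) al.

Lemma lprod_wt_ge_0 c : 0 <= lprod wt c.
Proof. apply lprod_ge_0; auto. Qed.

Lemma words_total_ge_0 ps : 0 <= lsum (lprod wt) (words ps al).
Proof. apply lsum_ge_0; intros; apply lprod_wt_ge_0. Qed.

(** The weight is not normalized. Divided by its total mass it is a product probability measure,
    [tau p] is the mass of one factor, and the bound is linearity of expectation. *)
Lemma words_mean (g : P * L -> R) (b : P -> R) ps :
  (forall p, In p ps -> lsum (fun l => wt (p, l) * g (p, l)) al <= b p * tau p) ->
  lsum (fun c => lprod wt c * lsum g c) (words ps al) <=
  lsum b ps * lsum (lprod wt) (words ps al).
Proof.
induction ps as [ | p ps IH]; intros H.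
{ simpl; lra. }
rewrite !lsum_words_cons.
set (Z0 := lsum (lprod wt) (words ps al)) in *.
set (Z1 := lsum (fun c => lprod wt c * lsum g c) (words ps al)) in *.
assert (HZ0 : 0 <= Z0) by apply words_total_ge_0.
assert (HZ1 : Z1 <= lsum b ps * Z0) by (apply IH; intros; apply H; right; assumption).
assert (Hp := H p (or_introl eq_refl)).
assert (Ht : 0 <= tau p) by (apply lsum_ge_0; intros; apply wt_ge_0).
rewrite (lsum_ext _ (fun l => wt (p, l) * g (p, l) * Z0 + wt (p, l) * Z1)).
2:{ intros l _; unfold Z0, Z1; rewrite <- !lsum_scal, <- lsum_plus.
    apply lsum_ext; intros c _; simpl; ring. }
rewrite (lsum_ext (fun l => lsum _ _) (fun l => wt (p, l) * Z0)).
2:{ intros l _; unfold Z0; rewrite <- lsum_scal; reflexivity. }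
rewrite lsum_plus, !lsum_scal_r; fold (tau p); simpl lsum.
change (lsum (fun l => wt (p, l)) al) with (tau p).
apply Rle_trans with (b p * tau p * Z0 + tau p * (lsum b ps * Z0)); [ | right; ring].
apply Rplus_le_compat; [apply Rmult_le_compat_r; assumption | ].
apply Rmult_le_compat_l; assumption.
Qed.

Lemma words_mean_abs (g : P * L -> R) (b : P -> R) ps :
  (forall p, In p ps ->
     Rabs (lsum (fun l => wt (p, l) * g (p, l)) al) <= b p * tau p) ->
  Rabs (lsum (fun c => lprod wt c * lsum g c) (words ps al)) <=
  lsum b ps * lsum (lprod wt) (words ps al).
Proof.
intros H; apply Rabs_le; split.
- assert (H1 := words_mean (fun x => - g x) b ps).
  rewrite (lsum_ext _ (fun c => - (lprod wt c * lsum g c))), lsum_opp in H1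
    by (intros; rewrite lsum_opp; ring).
  enough (- lsum (fun c => lprod wt c * lsum g c) (words ps al) <=
          lsum b ps * lsum (lprod wt) (words ps al)) by lra.
  apply H1; intros p Hp; assert (H2 := H p Hp).
  rewrite (lsum_ext _ (fun l => - (wt (p, l) * g (p, l)))), lsum_opp
    by (intros; ring).
  apply Rabs_le_between in H2; lra.
- apply words_mean; intros p Hp; eapply Rle_trans; [apply Rle_abs | auto].
Qed.

(** By independence the cross terms factor into products of means, so only the squares of single
    letters and the square of the summed means remain. *)
Lemma words_second_moment (g : P * L -> R) (s b : P -> R) ps :
  (forall p, In p ps -> lsum (fun l => wt (p, l) * g (p, l) ^ 2) al <= s p * tau p) ->
  (forall p, In p ps ->
     Rabs (lsum (fun l => wt (p, l) * g (p, l)) al) <= b p * tau p) ->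
  (forall p, In p ps -> 0 <= b p) ->
  lsum (fun c => lprod wt c * lsum g c ^ 2) (words ps al) <=
  (lsum s ps + lsum b ps ^ 2) * lsum (lprod wt) (words ps al).
Proof.
induction ps as [ | p ps IH]; intros Hs Hb Hb0.
{ simpl; lra. }
assert (HZ1 : Rabs (lsum (fun c => lprod wt c * lsum g c) (words ps al)) <=
  lsum b ps * lsum (lprod wt) (words ps al))
  by (apply words_mean_abs; intros; apply Hb; right; assumption).
assert (HZ2 : lsum (fun c => lprod wt c * lsum g c ^ 2) (words ps al) <=
  (lsum s ps + lsum b ps ^ 2) * lsum (lprod wt) (words ps al))
  by (apply IH; intros; [apply Hs | apply Hb | apply Hb0]; right; assumption).
rewrite !lsum_words_cons.
set (Z0 := lsum (lprod wt) (words ps al)) in *.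
set (Z1 := lsum (fun c => lprod wt c * lsum g c) (words ps al)) in *.
set (Z2 := lsum (fun c => lprod wt c * lsum g c ^ 2) (words ps al)) in *.
assert (HZ0 : 0 <= Z0) by apply words_total_ge_0.
assert (Hsp := Hs p (or_introl eq_refl)).
assert (Hbp := Hb p (or_introl eq_refl)).
assert (HB0 : 0 <= lsum b ps)
  by (apply lsum_ge_0; intros; apply Hb0; right; assumption).
assert (Ht : 0 <= tau p) by (apply lsum_ge_0; intros; apply wt_ge_0).
rewrite (lsum_ext _ (fun l => wt (p, l) * g (p, l) ^ 2 * Z0
   + wt (p, l) * g (p, l) * (2 * Z1) + wt (p, l) * Z2)).
2:{ intros l _; unfold Z0, Z1, Z2; rewrite <- !lsum_scal, <- !lsum_plus.
    apply lsum_ext; intros c _; simpl; ring. }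
rewrite (lsum_ext (fun l => lsum _ _) (fun l => wt (p, l) * Z0)).
2:{ intros l _; unfold Z0; rewrite <- lsum_scal; reflexivity. }
rewrite !lsum_plus, !lsum_scal_r.
change (lsum s (p :: ps)) with (s p + lsum s ps).
change (lsum b (p :: ps)) with (b p + lsum b ps).
change (lsum (fun l => wt (p, l)) al) with (tau p).
set (A1 := lsum (fun l => wt (p, l) * g (p, l)) al) in *.
set (A2 := lsum (fun l => wt (p, l) * g (p, l) ^ 2) al) in *.
set (Bs := lsum b ps) in *; set (Ss := lsum s ps) in *.
assert (H1 : A1 * (2 * Z1) <= 2 * (b p * tau p * (Bs * Z0))).
{ eapply Rle_trans; [apply Rle_abs | ].
  rewrite !Rabs_mult, (Rabs_pos_eq 2) by lra.
  assert (Rabs A1 * Rabs Z1 <= b p * tau p * (Bs * Z0))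
    by (apply Rmult_le_compat; try apply Rabs_pos; assumption); lra. }
assert (H2 : A2 * Z0 <= s p * tau p * Z0) by (apply Rmult_le_compat_r; assumption).
assert (H3 : tau p * Z2 <= tau p * ((Ss + Bs ^ 2) * Z0))
  by (apply Rmult_le_compat_l; assumption).
assert (H4 : 0 <= b p ^ 2 * (tau p * Z0))
  by (apply Rmult_le_pos; [apply pow2_ge_0 | apply Rmult_le_pos; assumption]).
replace ((s p + Ss + (b p + Bs) ^ 2) * (tau p * Z0)) with
  (s p * tau p * Z0 + 2 * (b p * tau p * (Bs * Z0))
   + tau p * ((Ss + Bs ^ 2) * Z0) + b p ^ 2 * (tau p * Z0)) by ring.
lra.
Qed.

End Words.

(** * Pairs of rational numbers with an integer quotient *)

Definition letter : Type := (Z * Z)%type.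

(* A letter is a pair (m_p, n_p) of exponents with m_p <= n_p.  A word of letters stands for two
   rational numbers [src] = prod p^(m_p) and [tgt] = prod p^(n_p) whose ratio is the integer [quot]. *)
Definition letters : list letter :=
  [(0, 0); (1, 1); (-1, -1); (-1, 0); (0, 1); (-1, 1)]%Z.

Definition states : list Z := [0; 1; -1]%Z.

Definition gap (l : letter) : nat := Z.to_nat (snd l - fst l).

Definition quot (c : list (nat * letter)) : nat :=
  fold_right (fun x n => (fst x ^ gap (snd x) * n)%nat) 1%nat c.

Definition src (c : list (nat * letter)) : list (nat * Z) :=
  map (fun x => (fst x, fst (snd x))) c.

Definition tgt (c : list (nat * letter)) : list (nat * Z) :=
  map (fun x => (fst x, snd (snd x))) c.

Lemma letters_gap l : In l letters -> (snd l = fst l + Z.of_nat (gap l))%Z.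
Proof.
intros Hl; unfold letters in Hl; simpl in Hl.
repeat (destruct Hl as [<- | Hl]; [reflexivity | ]); contradiction.
Qed.

Lemma map_letters_in (g : letter -> Z) ps c :
  (forall l, In l letters -> In (g l) states) -> In c (words ps letters) ->
  In (map (fun x : nat * letter => (fst x, g (snd x))) c) (words ps states).
Proof.
intros Hg; rewrite !in_words; intros [H1 H2]; split.
- rewrite <- H1, map_map; reflexivity.
- intros x Hx; apply in_map_iff in Hx; destruct Hx as [y [<- Hy]]; apply Hg, H2, Hy.
Qed.

Lemma src_in ps c : In c (words ps letters) -> In (src c) (words ps states).
Proof. apply (map_letters_in fst); intros l Hl; simpl in *; intuition (subst; auto). Qed.

Lemma tgt_in ps c : In c (words ps letters) -> In (tgt c) (words ps states).
Proof. apply (map_letters_in snd); intros l Hl; simpl in *; intuition (subst; auto). Qed.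

Module QuotPrimes.
Import ssreflect ssrfun ssrbool eqtype ssrnat seq div prime.

Lemma powE a b : PeanoNat.Nat.pow a b = (a ^ b)%N.
Proof. by elim: b => [|b IH] //=; rewrite expnS IH multE. Qed.

Lemma quot_gt0 c : (forall x, List.In x c -> prime x.1) -> (0 < quot c)%N.
Proof.
elim: c => [|x c IH] // H; rewrite /= multE powE muln_gt0 expn_gt0.
have px : prime x.1 by apply: H; left.
by rewrite prime_gt0 //=; apply: IH => y Hy; apply: H; right.
Qed.

Lemma quot_ndvd p c : prime p -> (forall x, List.In x c -> prime x.1 /\ x.1 <> p) ->
  ~~ (p %| quot c).
Proof.
move=> pp; elim: c => [|x c IH] H; first by rewrite /= dvdn1; case: eqP pp => // ->.
rewrite /= multE powE Euclid_dvdM // negb_or; apply/andP; split; last first.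
  by apply: IH => y Hy; apply: H; right.
have [px nx] := H x (or_introl erefl).
by rewrite Euclid_dvdX // dvdn_prime2 //; apply/negP => /andP [/eqP E _]; apply: nx.
Qed.

(** The p-adic valuation of the quotient recovers the gap of the letter at p, and a gap together
    with one end determines the letter. *)
Lemma quot_inj ps c c' : NoDup ps -> (forall p, List.In p ps -> prime p) ->
  List.In c (words ps letters) -> List.In c' (words ps letters) ->
  quot c = quot c' -> src c = src c' \/ tgt c = tgt c' -> c = c'.
Proof.
move=> nd; elim: nd c c' => {ps} [|p ps np nd IH] c c' pr.
  by rewrite !in_words => -[/map_eq_nil -> _] [/map_eq_nil -> _].
rewrite !in_words.
case: c => [|[q l] c] [] // [-> Hc] Hl; case: c' => [|[q' l'] c'] [] // [-> Hc'] Hl'.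
have prt d : List.map fst d = ps -> forall x : nat * letter, List.In x d -> prime x.1 /\ x.1 <> p.
  move=> Hd x Hx; have Hx1 : List.In x.1 ps by rewrite -Hd; exact: List.in_map.
  by split=> [|E]; [apply: pr; right|apply: np; rewrite -E].
have p1 := prt _ Hc; have p1' := prt _ Hc'.
have pp : prime p by apply: pr; left.
rewrite /= !multE !powE => E.
have [||||g E'] := Mertens.pow_cofactor_inj p _ _ _ _ pp _ _ _ _ E.
- by apply: quot_gt0 => x /p1 [].
- by apply: quot_gt0 => x /p1' [].
- exact: quot_ndvd.
- exact: quot_ndvd.
have Ll := letters_gap l (Hl (p, l) (or_introl erefl)).
have Ll' := letters_gap l' (Hl' (p, l') (or_introl erefl)).
move=> H.
have -> : l = l'.
  move: Ll Ll' H; rewrite -g; move: (gap l) => d; clear.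
  by case: l l' => [m n] [m' n'] /= -> -> [[-> _]|[E _]] //; have -> : m = m' by lia.
congr cons; apply: IH => //.
- by move=> q0 Hq; apply: pr; right.
- by apply/in_words; split=> // x Hx; apply: Hl; right.
- by apply/in_words; split=> // x Hx; apply: Hl'; right.
by case: H => [[_ H]|[_ H]]; [left|right].
Qed.

End QuotPrimes.

(** * Partial sums of the Dirichlet series *)

(** The comparison of a decreasing power with its integral, obtained without integration from 1/(n +
    1) <= ln (n + 1) - ln n and 1 + x <= e^x. *)
Lemma Rpower_telescope (n e : R) : 1 <= n -> 0 < e ->
  Rpower (n + 1) (- 1 - e) <= (Rpower n (- e) - Rpower (n + 1) (- e)) / e.
Proof.
intros Hn He; set (x := n + 1).
assert (Hl : / x <= ln x - ln n).
{ assert (H := exp_ineq1_le (ln n - ln x)).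
  unfold Rminus in H; rewrite exp_plus, exp_Ropp, !exp_ln in H by (unfold x; lra).
  replace (n * / x) with (1 - / x) in H by (unfold x; field; lra); lra. }
replace (Rpower n (- e)) with (Rpower x (- e) * exp (e * (ln x - ln n)))
  by (unfold Rpower; rewrite <- exp_plus; f_equal; ring).
replace (Rpower x (- 1 - e)) with (Rpower x (- e) * / x).
2:{ replace (- 1 - e) with (- e + - (1)) by ring; rewrite Rpower_plus.
    rewrite (Rpower_Ropp x 1), Rpower_1 by (unfold x; lra); reflexivity. }
assert (H := exp_ineq1_le (e * (ln x - ln n))).
assert (Hp : 0 < Rpower x (- e)) by apply exp_pos.
apply (Rmult_le_reg_l e); [exact He | ].
replace (e * ((Rpower x (- e) * exp (e * (ln x - ln n)) - Rpower x (- e)) / e))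
  with (Rpower x (- e) * (exp (e * (ln x - ln n)) - 1)) by (field; lra).
replace (e * (Rpower x (- e) * / x)) with (Rpower x (- e) * (e * / x)) by ring.
apply Rmult_le_compat_l; [lra | ].
apply Rle_trans with (e * (ln x - ln n)); [ | lra].
apply Rmult_le_compat_l; lra.
Qed.

Lemma zeta_seq_cauchy (s : C) (N m : nat) : (1 <= N)%nat -> 0 < Re s -> s <> 1 ->
  Cmod (zeta_seq s (S N + m) - zeta_seq s (S N)) <=
  Cmod s * ((Rpower (INR N) (- Re s) - Rpower (INR (N + m)) (- Re s)) / Re s).
Proof.
intros HN Hs H1; induction m as [ | m IH].
- rewrite !Nat.add_0_r; replace (_ - _)%C with (RtoC 0) by ring.
  rewrite Cmod_0; unfold Rminus, Rdiv; rewrite Rplus_opp_r; lra.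
- rewrite !Nat.add_succ_r, zeta_seq_S by (lia || assumption).
  replace (zeta_seq s (S N + m) - s * frac_int (S N + m) s - zeta_seq s (S N))%C
    with ((zeta_seq s (S N + m) - zeta_seq s (S N)) + - (s * frac_int (S N + m) s))%C
    by ring.
  eapply Rle_trans; [apply Cmod_triangle | rewrite Cmod_opp, Cmod_mult].
  assert (H2 := frac_int_le (S N + m) s ltac:(lia) Hs).
  assert (H3 : 1 <= INR (N + m)) by (apply (le_INR 1); lia).
  assert (H4 := Rpower_telescope (INR (N + m)) (Re s) H3 Hs).
  change (S N + m)%nat with (S (N + m)) in *; rewrite S_INR in H2 |- *.
  assert (H5 := Cmod_ge_0 s).
  assert (Cmod s * Cmod (frac_int (S (N + m)) s) <= Cmod s *
    ((Rpower (INR (N + m)) (- Re s) - Rpower (INR (N + m) + 1) (- Re s)) / Re s))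
    by (apply Rmult_le_compat_l; lra).
  unfold Rdiv in *; lra.
Qed.

Definition dsum (sigma : R) (N : nat) (t : R) : R :=
  lsum (fun k => Rpower (INR k) (- sigma) * cos (t * ln (INR k))) (seq 1 N).

(** The real part of [e^((a - i t) lambda) / (a - i t)]. *)
Definition pole (a lambda t : R) : R :=
  exp (a * lambda) * (a * cos (t * lambda) + t * sin (t * lambda)) / (a ^ 2 + t ^ 2).

Definition zeta_re (sigma t : R) : R := Re (zeta (sigma + Ci * t)%C).

Lemma re_sum_n_m (u : nat -> C) (n m : nat) :
  Re (sum_n_m (G := C_AbelianMonoid) u n m) =
  sum_n_m (fun k => Re (u k)) n m.
Proof.
revert n; induction m as [ | m IH]; intros n.
- destruct n; [rewrite !sum_n_n | rewrite !sum_n_m_zero by lia]; reflexivity.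
- destruct (le_lt_dec n (S m)) as [H | H].
  + rewrite !sum_n_Sm by exact H; rewrite <- IH; reflexivity.
  + rewrite !sum_n_m_zero by exact H; reflexivity.
Qed.

Lemma sum_n_m_lsum (u : nat -> R) (N : nat) :
  sum_n_m u 1 N = lsum u (seq 1 N).
Proof.
induction N as [ | N IH].
- rewrite sum_n_m_zero by lia; reflexivity.
- rewrite sum_n_Sm by lia; rewrite IH, seq_S, lsum_app; simpl.
  change plus with Rplus; ring.
Qed.

Lemma re_zeta_seq (sigma t : R) (N : nat) : sigma < 1 ->
  Re (zeta_seq (sigma + Ci * t)%C N) =
  dsum sigma N t - pole (1 - sigma) (ln (INR N)) t.
Proof.
intros Hs; unfold zeta_seq.
assert (Hre : forall z w : C, Re (z - w) = Re z - Re w) by reflexivity.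
rewrite Hre; f_equal.
- rewrite re_sum_n_m, sum_n_m_lsum; apply lsum_ext; intros k _.
  rewrite RCpow_pair; simpl; unfold Rpower.
  replace (- (sigma + (0 * t - 1 * 0))) with (- sigma) by ring.
  replace (- (0 + (0 * 0 + 1 * t)) * ln (INR k)) with (- (t * ln (INR k))) by ring.
  rewrite cos_neg; reflexivity.
- rewrite RCpow_pair.
  replace (1 - (sigma + Ci * t))%C with ((1 - sigma, - t) : C)
    by (apply C_ext; simpl; ring).
  unfold pole; set (L := ln (INR N)); simpl Re; simpl Im.
  replace (- t * L) with (- (t * L)) by ring; rewrite cos_neg, sin_neg.
  unfold Cdiv, Cinv, Cmult, Re; simpl.
  assert (0 < (1 - sigma) ^ 2 + t ^ 2) by nra.
  field; nra.
Qed.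

Lemma zeta_re_approx (sigma t : R) (N : nat) :
  1 / 2 <= sigma < 1 -> (1 <= N)%nat ->
  Rabs (zeta_re sigma t - (dsum sigma (S N) t - pole (1 - sigma) (ln (INR (S N))) t))
  <= 2 * (1 + Rabs t) / sqrt (INR N).
Proof.
intros Hs HN; set (s := (sigma + Ci * t)%C).
assert (Rs : Re s = sigma) by (unfold s; simpl; ring).
assert (H1 : s <> 1).
{ intros E; apply (f_equal Re) in E; rewrite Rs in E; simpl in E; lra. }
assert (HN1 : 1 <= INR N) by (apply (le_INR 1); exact HN).
rewrite <- re_zeta_seq by lra; fold s.
assert (Hc := zeta_cvg s ltac:(lra) H1).
apply filterlim_C_pair in Hc; destruct Hc as [Hc _].
apply (is_lim_seq_incr_n _ (S N)) in Hc.
assert (Hd : is_lim_seq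
  (fun n => Rabs (Re (zeta_seq s (n + S N)) - Re (zeta_seq s (S N))))
  (Rabs (zeta_re sigma t - Re (zeta_seq s (S N))))).
{ apply (is_lim_seq_abs _ (Finite (zeta_re sigma t - Re (zeta_seq s (S N))))).
  apply is_lim_seq_minus'; [exact Hc | apply is_lim_seq_const]. }
assert (Hb := is_lim_seq_const (2 * (1 + Rabs t) / sqrt (INR N))).
refine (is_lim_seq_le _ _ _ _ _ Hd Hb); intros n.
rewrite Nat.add_comm.
apply Rle_trans with (Cmod (zeta_seq s (S N + n) - zeta_seq s (S N))).
{ apply (re_le_Cmod (zeta_seq s (S N + n) - zeta_seq s (S N))%C). }
eapply Rle_trans; [apply zeta_seq_cauchy; (assumption || lra) | ].
rewrite Rs.
assert (HP := exp_pos (- sigma * ln (INR (N + n)))).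
fold (Rpower (INR (N + n)) (- sigma)) in HP.
assert (HQ : Rpower (INR N) (- sigma) <= / sqrt (INR N)).
{ rewrite <- Rpower_sqrt by lra; rewrite <- Rpower_Ropp.
  apply Rle_Rpower; lra. }
assert (HQ0 : 0 < / sqrt (INR N)) by (apply Rinv_0_lt_compat, sqrt_lt_R0; lra).
assert (HC : Cmod s <= 1 + Rabs t).
{ eapply Rle_trans; [apply Cmod_triangle | ].
  rewrite Cmod_mult, !Cmod_R, Rabs_pos_eq by lra.
  replace (Cmod Ci) with 1; [lra | ].
  unfold Cmod, Ci; simpl; rewrite Rmult_0_l, Rplus_0_l, !Rmult_1_l, sqrt_1; reflexivity. }
(* The factor 2 bounds 1 / sigma, and 1 + |t| bounds |s|. *)
replace (2 * (1 + Rabs t) / sqrt (INR N)) with ((1 + Rabs t) * (2 * / sqrt (INR N)))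
  by (field; apply Rgt_not_eq, sqrt_lt_R0; lra).
assert (Hc0 := Cmod_ge_0 s).
apply Rle_trans with (Cmod s * (2 * / sqrt (INR N))).
- apply Rmult_le_compat_l; [exact Hc0 | ].
  apply (Rmult_le_reg_r sigma); [lra | ].
  unfold Rdiv; rewrite Rmult_assoc, Rinv_l by lra; nra.
- apply Rmult_le_compat_r; lra.
Qed.

(** * Fejer kernels and the polar term *)

Definition fejer (Z v : R) : R := RInt (fun t => (1 - t / Z) * cos (t * v)) 0 Z.

Lemma fejer_neq0 (Z v : R) : 0 < Z -> v <> 0 ->
  fejer Z v = (1 - cos (Z * v)) / (Z * v ^ 2).
Proof.
intros HZ Hv; apply is_RInt_unique.
replace ((1 - cos (Z * v)) / (Z * v ^ 2)) with
  (minus ((1 - Z / Z) * (sin (Z * v) / v) - cos (Z * v) / (Z * v ^ 2))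
         ((1 - 0 / Z) * (sin (0 * v) / v) - cos (0 * v) / (Z * v ^ 2))).
- apply (is_RInt_derive (fun t => (1 - t / Z) * (sin (t * v) / v) - cos (t * v) / (Z * v ^ 2))).
  + intros t _; auto_derive; [repeat split; auto; nra | field; lra].
  + intros t _; apply (ex_derive_continuous (V := R_NormedModule)); auto_derive; lra.
- unfold minus, plus, opp; simpl; rewrite Rmult_0_l, sin_0, cos_0; field; lra.
Qed.

Lemma fejer_0 (Z : R) : 0 < Z -> fejer Z 0 = Z / 2.
Proof.
intros HZ; apply is_RInt_unique.
replace (Z / 2) with (minus (Z - Z ^ 2 / (2 * Z)) (0 - 0 ^ 2 / (2 * Z))).
- apply (is_RInt_derive (fun t => t - t ^ 2 / (2 * Z))).
  + intros t _; auto_derive; [lra | rewrite Rmult_0_r, cos_0; field; lra].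
  + intros t _; apply (ex_derive_continuous (V := R_NormedModule)); auto_derive; lra.
- unfold minus, plus, opp; simpl; field; lra.
Qed.

Lemma one_sub_cos (x : R) : 1 - cos x = 2 * sin (x / 2) ^ 2.
Proof.
replace x with (2 * (x / 2)) at 1 by field; rewrite cos_2a_sin; ring.
Qed.

Lemma sin_sq_le (x : R) : 0 <= x -> sin x ^ 2 <= x ^ 2.
Proof.
intros [H | <-]; [ | rewrite sin_0; lra].
rewrite <- (pow2_abs (sin x)); apply pow_incr; split; [apply Rabs_pos | apply Rabs_le].
split; [ | apply Rlt_le, sin_lt_x, H].
destruct (Rle_dec x PI) as [H1 | H1].
- assert (0 <= sin x) by (apply sin_ge_0; lra); lra.
- assert (H2 := SIN_bound x); assert (H3 := PI2_1); lra.
Qed.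

Lemma one_sub_cos_le (x : R) : 1 - cos x <= x ^ 2 / 2.
Proof.
rewrite one_sub_cos; enough (sin (x / 2) ^ 2 <= (x / 2) ^ 2) by lra.
destruct (Rle_dec 0 (x / 2)) as [H | H]; [apply sin_sq_le, H | ].
assert (H1 := sin_sq_le (- (x / 2)) ltac:(lra)); rewrite sin_neg in H1.
replace (sin (x / 2) ^ 2) with ((- sin (x / 2)) ^ 2) by ring; lra.
Qed.

Lemma fejer_ge_0 (Z v : R) : 0 < Z -> 0 <= fejer Z v.
Proof.
intros HZ; destruct (Req_dec v 0) as [-> | Hv]; [rewrite fejer_0; lra | ].
rewrite fejer_neq0 by assumption; apply Rmult_le_pos.
- assert (H := COS_bound (Z * v)); lra.
- apply Rlt_le, Rinv_0_lt_compat, Rmult_lt_0_compat; [lra | apply pow2_gt_0, Hv].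
Qed.

Lemma fejer_opp (Z v : R) : fejer Z (- v) = fejer Z v.
Proof.
apply RInt_ext; intros t _; f_equal.
rewrite <- cos_neg; f_equal; ring.
Qed.

(** The Lorentzian has the primitive 2 atan (Z v / 2) in v, so its integral over any interval is
    bounded independently of Z. *)
Lemma fejer_le_lorentz (Z v : R) : 0 < Z -> fejer Z v <= Z / (1 + (Z * v / 2) ^ 2).
Proof.
intros HZ; destruct (Req_dec v 0) as [-> | Hv].
{ rewrite fejer_0 by exact HZ; replace (Z * 0 / 2) with 0 by field.
  rewrite pow_ne_zero, Rplus_0_r by lia; lra. }
rewrite fejer_neq0 by assumption.
assert (H1 := one_sub_cos_le (Z * v)); assert (H2 := COS_bound (Z * v)).
assert (Hy : 0 < (Z * v) ^ 2) by (apply pow2_gt_0; nra).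
set (y2 := (Z * v) ^ 2) in *; set (c := cos (Z * v)) in *.
replace ((1 - c) / (Z * v ^ 2)) with (Z * ((1 - c) / y2)) by (unfold y2; field; lra).
replace ((Z * v / 2) ^ 2) with (y2 / 4) by (unfold y2; field).
unfold Rdiv at 2; apply Rmult_le_compat_l; [lra | ].
apply (Rmult_le_reg_r (y2 * (1 + y2 / 4))); [nra | ].
replace ((1 - c) / y2 * (y2 * (1 + y2 / 4))) with ((1 - c) * (1 + y2 / 4)) by (field; lra).
replace (/ (1 + y2 / 4) * (y2 * (1 + y2 / 4))) with y2 by (field; lra).
nra.
Qed.

Lemma fejer_le_half (Z v : R) : 0 < Z -> fejer Z v <= Z / 2.
Proof.
intros HZ; destruct (Req_dec v 0) as [-> | Hv]; [rewrite fejer_0; lra | ].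
rewrite fejer_neq0 by assumption.
assert (H1 := one_sub_cos_le (Z * v)).
assert (Hy : 0 < Z * v ^ 2) by (assert (0 < v ^ 2) by (apply pow2_gt_0; lra); nra).
apply Rle_div_l; [exact Hy | nra].
Qed.

Lemma fejer_far (Z v : R) : 0 < Z -> 1 <= Rabs v -> fejer Z v <= 2 / Z.
Proof.
intros HZ Hv.
assert (Hv0 : v <> 0) by (intros ->; rewrite Rabs_R0 in Hv; lra).
rewrite fejer_neq0 by assumption.
assert (H2 := COS_bound (Z * v)).
assert (Hy : 1 <= v ^ 2) by (rewrite <- pow2_abs; nra).
apply Rmult_le_compat; [lra | | lra | ].
- apply Rlt_le, Rinv_0_lt_compat; nra.
- apply Rinv_le_contravar; [lra | nra].
Qed.

(** The range |v| <= pi/Z is the error made by rounding frequencies to cells. With y = Z |v| / 2 <=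
    2 the cubic Taylor bound gives sin y >= y/3, whence the constant 18. *)
Lemma fejer_near (Z v : R) : 0 < Z -> Z * Rabs v <= PI -> Z / 18 <= fejer Z v.
Proof.
intros HZ Hv; destruct (Req_dec v 0) as [-> | Hv0]; [rewrite fejer_0; lra | ].
assert (E : fejer Z v = fejer Z (Rabs v)).
{ unfold Rabs; destruct (Rcase_abs v); [rewrite fejer_opp | ]; reflexivity. }
rewrite E; assert (Hp := Rabs_pos_lt v Hv0).
set (w := Rabs v) in *; rewrite fejer_neq0, one_sub_cos by lra.
set (y := Z * w / 2); assert (Hy : 0 < y) by (unfold y; nra).
assert (H4 := PI_4); assert (HPI := PI2_1).
assert (Hy2 : y <= 2) by (unfold y; lra).
assert (Hs : y / 3 <= sin y).
{ destruct (sin_bound y 0) as [H _]; [lra | unfold y; lra | ].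
  unfold sin_approx, sum_f_R0, sin_term in H; simpl in H.
  replace (1 * (y * 1 / 1) + -1 * 1 * (y * (y * (y * 1)) / (1 + 1 + 1 + 1 + 1 + 1)))
    with (y - y * (y * y) / 6) in H by field.
  nra. }
assert (Hsq : (y / 3) ^ 2 <= sin y ^ 2) by (apply pow_incr; lra).
assert (Hw : 0 < Z * w ^ 2) by (apply Rmult_lt_0_compat; [lra | apply pow2_gt_0; lra]).
apply (Rmult_le_reg_r (Z * w ^ 2)); [exact Hw | ].
replace (2 * sin y ^ 2 / (Z * w ^ 2) * (Z * w ^ 2)) with (2 * sin y ^ 2) by (field; lra).
replace (Z / 18 * (Z * w ^ 2)) with (2 * (y / 3) ^ 2) by (unfold y; field).
lra.
Qed.

Lemma cos_mult (x y : R) : cos x * cos y = (cos (x - y) + cos (x + y)) / 2.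
Proof. rewrite cos_plus, cos_minus; field. Qed.

Lemma ex_RInt_cont (f : R -> R) (a b : R) : (forall t, continuous f t) -> ex_RInt f a b.
Proof. intros H; apply (ex_RInt_continuous (V := R_CompleteNormedModule)); auto. Qed.

Lemma cont_ex_derive (f : R -> R) (t : R) : ex_derive f t -> continuous f t.
Proof. apply (ex_derive_continuous (V := R_NormedModule)). Qed.

Lemma RInt_fejer_cos (Z mu v : R) : 0 < Z ->
  RInt (fun t => (1 - t / Z) * (cos (t * mu) * cos (t * v))) 0 Z =
  (fejer Z (v - mu) + fejer Z (v + mu)) / 2.
Proof.
intros HZ.
assert (C : forall w, ex_RInt (fun t => (1 - t / Z) * cos (t * w)) 0 Z).
{ intros w; apply ex_RInt_cont; intros t; apply cont_ex_derive; auto_derive; auto. }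
unfold fejer.
change ((?x + ?y) / 2) with ((plus x y) * / 2).
rewrite <- RInt_plus by apply C.
rewrite Rmult_comm; change (/ 2 * ?x) with (scal (/ 2) x).
rewrite <- RInt_scal by (apply ex_RInt_plus; apply C).
apply RInt_ext; intros t _; unfold scal, plus; simpl; unfold mult; simpl.
rewrite (Rmult_comm (cos _)), cos_mult.
replace (t * v - t * mu) with (t * (v - mu)) by ring.
replace (t * v + t * mu) with (t * (v + mu)) by ring; field; lra.
Qed.

Lemma is_derive_increment (f g f' g' : R -> R) (a b : R) : a <= b ->
  (forall x, a <= x <= b -> is_derive f x (f' x)) ->
  (forall x, a <= x <= b -> is_derive g x (g' x)) ->
  (forall x, a <= x <= b -> f' x <= g' x) ->
  f b - f a <= g b - g a.
Proof.
intros Hab Hf Hg Hle.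
assert (D : forall x, a <= x <= b -> is_derive (fun x => g x - f x) x (g' x - f' x)).
{ intros x Hx; apply (is_derive_minus (V := R_NormedModule)); auto. }
destruct (MVT_gen (fun x => g x - f x) a b (fun x => g' x - f' x)) as [c [Hc E]].
- rewrite Rmin_left, Rmax_right by lra; intros x Hx; apply D; lra.
- rewrite Rmin_left, Rmax_right by lra; intros x Hx.
  apply continuity_pt_filterlim, (cont_ex_derive (fun x => g x - f x)).
  eexists; apply D, Hx.
- rewrite Rmin_left, Rmax_right in Hc by lra.
  assert (H := Hle c Hc); nra.
Qed.

Definition pole_int (a Z mu lambda : R) : R :=
  RInt (fun t => (1 - t / Z) * (cos (t * mu) * pole a lambda t)) 0 Z.

(* Differentiating in [lambda] removes the denominator, which turns the
   bound for [pole_int] into one for an integral of Fejer kernels. *)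
Lemma is_derive_pole_int (a Z mu lambda : R) : 0 < a -> 0 < Z ->
  is_derive (pole_int a Z mu) lambda
    (exp (a * lambda) * ((fejer Z (lambda - mu) + fejer Z (lambda + mu)) / 2)).
Proof.
intros Ha HZ.
assert (Hd : forall t l,
  is_derive (fun l => (1 - t / Z) * (cos (t * mu) * pole a l t)) l
    ((1 - t / Z) * (cos (t * mu) * (exp (a * l) * cos (t * l))))).
{ intros t l; unfold pole; assert (0 < a ^ 2 + t ^ 2) by nra.
  auto_derive; [nra | field; nra]. }
rewrite <- RInt_fejer_cos by exact HZ.
replace (exp (a * lambda) *
   RInt (fun t => (1 - t / Z) * (cos (t * mu) * cos (t * lambda))) 0 Z)
  with (RInt (fun t => Derive (fun l => (1 - t / Z) * (cos (t * mu) * pole a l t)) lambda) 0 Z).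
- apply (is_derive_RInt_param (fun l t => (1 - t / Z) * (cos (t * mu) * pole a l t))).
  + apply filter_forall; intros l t _; eexists; apply Hd.
  + intros t _.
    apply (continuity_2d_pt_ext
      (fun u v => (1 - v / Z) * (cos (v * mu) * (exp (a * u) * cos (v * u))))).
    { intros u v; symmetry; apply is_derive_unique, Hd. }
    assert (C1 : forall h : R -> R, continuity_pt h t ->
              continuity_2d_pt (fun _ v => h v) lambda t).
    { intros h Hh; apply (continuity_1d_2d_pt_comp h (fun _ v => v)); [exact Hh | ].
      apply continuity_2d_pt_id2. }
    apply continuity_2d_pt_mult; [apply C1; reg; lra | ].
    apply continuity_2d_pt_mult; [apply (C1 (fun v => cos (v * mu))); reg | ].
    apply continuity_2d_pt_mult.
    * apply (continuity_1d_2d_pt_comp (fun u => exp (a * u)) (fun u _ => u)); [reg | ].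
      apply continuity_2d_pt_id1.
    * apply (continuity_1d_2d_pt_comp cos (fun u v => v * u)); [reg | ].
      apply continuity_2d_pt_mult; [apply continuity_2d_pt_id2 | apply continuity_2d_pt_id1].
  + apply filter_forall; intros l; apply ex_RInt_cont; intros t.
    apply cont_ex_derive; unfold pole; assert (0 < a ^ 2 + t ^ 2) by nra.
    auto_derive; nra.
- change (exp (a * lambda) * ?x) with (scal (exp (a * lambda)) x).
  rewrite <- RInt_scal.
  + apply RInt_ext; intros t _; etransitivity; [apply (is_derive_unique _ _ _ (Hd t lambda)) | ].
    unfold scal; simpl; unfold mult; simpl; ring.
  + apply ex_RInt_cont; intros t; apply cont_ex_derive; auto_derive; auto.
Qed.

(** At [lambda = 0] the polar term is a / (a^2 + t^2), whose integral stays below pi/2 as a tends to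
    0. This keeps the bounds uniform up to sigma = 1. *)
Lemma pole_int_0 (a Z mu : R) : 0 < a -> 0 < Z -> Rabs (pole_int a Z mu 0) <= 2.
Proof.
intros Ha HZ; unfold pole_int.
assert (Hp : forall t, 0 < a ^ 2 + t ^ 2) by (intros t; nra).
assert (I : is_RInt (fun t => a / (a ^ 2 + t ^ 2)) 0 Z (atan (Z / a))).
{ replace (atan (Z / a)) with (minus (atan (Z / a)) (atan (0 / a))).
  - apply (is_RInt_derive (fun t => atan (t / a))).
    + intros t _; auto_derive; [lra | ].
      field; split; [nra | lra].
    + intros t _; apply cont_ex_derive; auto_derive; nra.
  - unfold Rdiv; rewrite Rmult_0_l, atan_0; unfold minus, plus, opp; simpl; ring. }
assert (H4 := PI_4); assert (Hat := atan_bound (Z / a)).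
apply Rle_trans with (RInt (fun t => a / (a ^ 2 + t ^ 2)) 0 Z).
- eapply Rle_trans; [apply abs_RInt_le; [lra | ] | ].
  + apply ex_RInt_cont; intros t.
    apply cont_ex_derive; unfold pole; auto_derive; nra.
  + apply RInt_le; [lra | | eexists; exact I | ].
    * apply ex_RInt_cont; intros t.
      apply continuous_comp; [ | apply continuous_Rabs].
      apply cont_ex_derive; unfold pole; auto_derive; nra.
    * intros t Ht; unfold pole.
      replace (exp (a * 0) * (a * cos (t * 0) + t * sin (t * 0)) / (a ^ 2 + t ^ 2))
        with (a / (a ^ 2 + t ^ 2))
        by (rewrite !Rmult_0_r, cos_0, sin_0, exp_0; assert (H := Hp t); field; lra).
      assert (H0 : 0 < a / (a ^ 2 + t ^ 2)) by (apply Rdiv_lt_0_compat; [lra | apply Hp]).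
      rewrite !Rabs_mult, (Rabs_pos_eq (a / _)) by lra.
      assert (H1 : Rabs (1 - t / Z) <= 1).
      { assert (0 <= t / Z <= 1); [ | apply Rabs_le; lra].
        split; [apply Rmult_le_pos; [lra | apply Rlt_le, Rinv_0_lt_compat, HZ] | ].
        apply Rle_div_l; [exact HZ | lra]. }
      assert (H2 : Rabs (cos (t * mu)) <= 1) by (apply Rabs_le, COS_bound).
      assert (H3 : Rabs (1 - t / Z) * Rabs (cos (t * mu)) <= 1 * 1)
        by (apply Rmult_le_compat; auto using Rabs_pos).
      rewrite <- Rmult_assoc; apply (Rmult_le_compat_r (a / (a ^ 2 + t ^ 2))) in H3; lra.
- rewrite (is_RInt_unique _ _ _ _ I); lra.
Qed.

(** The derivative in [lambda] is e^(a v) times Fejer kernels centred at mu and -mu. Up to distance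
    1 beyond a centre the exponential is at most e^(m + 1) and the Lorentzian has bounded integral;
    further out the kernel is at most 2/Z and e^(a v) <= e^(v/2) is integrated. For e^lambda of
    order Z^2 the last term is bounded. *)
Lemma pole_int_le (a Z mu m lambda : R) :
  0 < a <= 1 / 2 -> 0 < Z -> Rabs mu <= m -> 0 <= lambda ->
  Rabs (pole_int a Z mu lambda) <= 2 + 8 * exp (m + 1) + 4 / Z * exp (lambda / 2).
Proof.
intros Ha HZ Hm Hl.
set (u := fun mu v => exp (m + 1) * (2 * atan (Z * (v - mu) / 2)) + 4 / Z * exp (v / 2)).
set (u' := fun mu v => exp (m + 1) * (Z / (1 + (Z * (v - mu) / 2) ^ 2)) + 2 / Z * exp (v / 2)).
assert (Hu : forall mu v, is_derive (u mu) v (u' mu v)).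
{ intros nu v; unfold u, u'; auto_derive; [lra | ].
  assert (0 <= (Z * (v - nu) / 2) ^ 2) by apply pow2_ge_0.
  change (v * / 2) with (v / 2); field; repeat split; try lra; nra. }
assert (HZ2 : 0 < 2 / Z) by (apply Rdiv_lt_0_compat; lra).
assert (Hb : forall nu v, Rabs nu <= m -> 0 <= v ->
          exp (a * v) * fejer Z (v - nu) <= u' nu v).
{ intros nu v Hn Hv; unfold u'; apply Rabs_le_between in Hn.
  assert (H0 := fejer_ge_0 Z (v - nu) HZ).
  destruct (Rle_dec (v - nu) 1) as [H | H].
  - apply Rle_trans with (exp (m + 1) * (Z / (1 + (Z * (v - nu) / 2) ^ 2))).
    + apply Rmult_le_compat; [apply Rlt_le, exp_pos | exact H0 | | apply fejer_le_lorentz, HZ].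
      apply exp_mono; nra.
    + assert (0 < 2 / Z * exp (v / 2)) by (apply Rmult_lt_0_compat; [lra | apply exp_pos]); lra.
  - apply Rle_trans with (2 / Z * exp (v / 2)).
    + rewrite Rmult_comm; apply Rmult_le_compat; [exact H0 | apply Rlt_le, exp_pos | | ].
      * apply fejer_far; [exact HZ | rewrite Rabs_pos_eq; lra].
      * apply exp_mono; nra.
    + assert (0 < exp (m + 1) * (Z / (1 + (Z * (v - nu) / 2) ^ 2))); [ | lra].
      apply Rmult_lt_0_compat; [apply exp_pos | apply Rdiv_lt_0_compat; [lra | ]].
      assert (0 <= (Z * (v - nu) / 2) ^ 2) by apply pow2_ge_0; lra. }
assert (Hm' : Rabs (- mu) <= m) by (rewrite Rabs_Ropp; exact Hm).
set (U := fun v => (u mu v + u (- mu) v) / 2).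
set (U' := fun v => (u' mu v + u' (- mu) v) / 2).
assert (HU : forall v, is_derive U v (U' v)).
{ intros v; unfold U, U'.
  apply (is_derive_ext (fun v => / 2 * (u mu v + u (- mu) v))).
  { intros w; change (/ 2 * (u mu w + u (- mu) w) = (u mu w + u (- mu) w) / 2); field. }
  replace ((u' mu v + u' (- mu) v) / 2) with (/ 2 * (u' mu v + u' (- mu) v)) by field.
  apply (is_derive_scal (fun v => u mu v + u (- mu) v)).
  apply (is_derive_plus (V := R_NormedModule)); apply Hu. }
set (Q' := fun v => exp (a * v) * ((fejer Z (v - mu) + fejer Z (v + mu)) / 2)).
assert (HQ : forall v, is_derive (pole_int a Z mu) v (Q' v))
  by (intros v; apply is_derive_pole_int; lra).
assert (HQ0 : forall v, 0 <= Q' v).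
{ intros v; unfold Q'; apply Rmult_le_pos; [apply Rlt_le, exp_pos | ].
  assert (H1 := fejer_ge_0 Z (v - mu) HZ); assert (H2 := fejer_ge_0 Z (v + mu) HZ); lra. }
assert (HQU : forall v, 0 <= v -> Q' v <= U' v).
{ intros v Hv; unfold Q', U'.
  assert (H1 := Hb mu v Hm Hv); assert (H2 := Hb (- mu) v Hm' Hv).
  replace (v - - mu) with (v + mu) in H2 by ring; lra. }
assert (H1 : pole_int a Z mu lambda - pole_int a Z mu 0 <= U lambda - U 0).
{ apply (is_derive_increment _ _ Q' U'); [lra | auto | auto | intros; apply HQU; lra]. }
assert (H2 : 0 - 0 <= pole_int a Z mu lambda - pole_int a Z mu 0).
{ apply (is_derive_increment (fun _ => 0) _ (fun _ => 0) Q'); [lra | | auto | auto].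
  intros x _; apply (is_derive_const (V := R_NormedModule)). }
assert (H3 := pole_int_0 a Z mu ltac:(lra) HZ).
assert (H4 : U lambda - U 0 <= 8 * exp (m + 1) + 4 / Z * exp (lambda / 2)).
{ unfold U, u; assert (HPI := PI_4); assert (HE := exp_pos (m + 1)).
  assert (A1 := atan_bound (Z * (lambda - mu) / 2)).
  assert (A2 := atan_bound (Z * (lambda - - mu) / 2)).
  assert (A3 := atan_bound (Z * (0 - mu) / 2)).
  assert (A4 := atan_bound (Z * (0 - - mu) / 2)).
  assert (E0 : 0 < 4 / Z * exp (0 / 2))
    by (apply Rmult_lt_0_compat; [lra | apply exp_pos]).
  set (a1 := atan (Z * (lambda - mu) / 2)) in *.
  set (a2 := atan (Z * (lambda - - mu) / 2)) in *.
  set (a3 := atan (Z * (0 - mu) / 2)) in *.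
  set (a4 := atan (Z * (0 - - mu) / 2)) in *.
  assert (exp (m + 1) * (a1 + a2 - a3 - a4) <= exp (m + 1) * 8)
    by (apply Rmult_le_compat_l; lra).
  lra. }
apply Rabs_le_between in H3; apply Rabs_le; lra.
Qed.

(** * Weighted means of zeta against a cosine polynomial *)

Lemma continuous_zeta_line (sigma t : R) : 0 < sigma < 1 ->
  continuous (fun u : R => Re (zeta (sigma + Ci * u)%C)) t /\
  continuous (fun u : R => Im (zeta (sigma + Ci * u)%C)) t.
Proof.
intros Hs; set (s := (sigma + Ci * t)%C).
assert (Rs : Re s = sigma) by (unfold s; simpl; ring).
assert (H1 : s <> 1).
{ intros E; apply (f_equal Re) in E; rewrite Rs in E; simpl in E; lra. }
assert (H := zeta_holomorphic s ltac:(lra) H1).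
apply (ex_derive_continuous (K := C_AbsRing) (V := C_NormedModule)) in H.
assert (Hb : forall (d : posreal) (u : R), ball t d u ->
   ball (M := AbsRing_UniformSpace C_AbsRing) s d (sigma + Ci * u)%C).
{ intros d u Hu; change (Cmod ((sigma + Ci * u) - s) < d).
  replace ((sigma + Ci * u) - s)%C with (Ci * RtoC (u - t))%C
    by (unfold s; rewrite RtoC_minus; ring).
  rewrite Cmod_mult, Cmod_R.
  replace (Cmod Ci) with 1; [rewrite Rmult_1_l; exact Hu | ].
  unfold Cmod, Ci; simpl; rewrite Rmult_0_l, Rplus_0_l, !Rmult_1_l, sqrt_1; reflexivity. }
split; apply filterlim_locally; intros eps;
  destruct (proj1 (filterlim_locally _ _) H eps) as [d Hd]; exists d; intros u Hu.
- destruct (Hd _ (Hb d u Hu)) as [H2 _]; fold s; revert H2.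
  generalize (zeta s) (zeta (sigma + Ci * u)%C); intros z w H2; exact H2.
- destruct (Hd _ (Hb d u Hu)) as [_ H2]; fold s; revert H2.
  generalize (zeta s) (zeta (sigma + Ci * u)%C); intros z w H2; exact H2.
Qed.

Lemma continuous_zeta_re (sigma t : R) : 0 < sigma < 1 -> continuous (zeta_re sigma) t.
Proof. intros Hs; unfold zeta_re; exact (proj1 (continuous_zeta_line sigma t Hs)). Qed.

Lemma is_RInt_lsum {A : Type} (f : A -> R -> R) (v : A -> R) l a b :
  (forall x, In x l -> is_RInt (f x) a b (v x)) ->
  is_RInt (fun t => lsum (fun x => f x t) l) a b (lsum v l).
Proof.
induction l as [ | x l IH]; intros H; simpl.
- assert (K := is_RInt_const a b 0).
  change (is_RInt (fun _ => 0) a b ((b - a) * 0)) in K.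
  rewrite Rmult_0_r in K; exact K.
- apply (is_RInt_plus (V := R_NormedModule)); [apply H; left; reflexivity | ].
  apply IH; intros y Hy; apply H; right; exact Hy.
Qed.

Lemma continuous_lsum {A : Type} (f : A -> R -> R) l t :
  (forall x, continuous (f x) t) -> continuous (fun t => lsum (fun x => f x t) l) t.
Proof.
intros H; induction l as [ | x l IH]; simpl; [apply continuous_const | ].
apply (continuous_plus (V := R_NormedModule)); auto.
Qed.

Lemma sum_inv_sqrt (N : nat) :
  lsum (fun k => / sqrt (INR k)) (seq 1 N) <= 2 * sqrt (INR N).
Proof.
induction N as [ | N IH]; [simpl; rewrite sqrt_0; lra | ].
rewrite seq_S, lsum_app.
change (lsum _ [_]) with (/ sqrt (INR (S N)) + 0).
rewrite S_INR; set (x := INR N) in *.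
assert (Hx : 0 <= x) by apply pos_INR.
assert (H2 := sqrt_lt_R0 (x + 1) ltac:(lra)).
assert (E1 := sqrt_sqrt x Hx); assert (E2 := sqrt_sqrt (x + 1) ltac:(lra)).
set (u := sqrt x) in *; set (w := sqrt (x + 1)) in *.
assert (/ w <= 2 * (w - u)); [ | lra].
apply (Rmult_le_reg_r w); [exact H2 | rewrite Rinv_l by lra].
nra.
Qed.

Lemma count_le (x : R) (N : nat) : 0 <= x ->
  lsum (fun k => if Rle_dec (INR k) x then 1 else 0) (seq 1 N) <= x.
Proof.
intros Hx.
assert (HN : forall n, lsum (fun k => if Rle_dec (INR k) x then 1 else 0) (seq 1 n) <= INR n).
{ intros n; eapply Rle_trans; [apply (lsum_le _ (fun _ => 1)) | ].
  - intros k _; destruct (Rle_dec (INR k) x); lra.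
  - rewrite lsum_const, length_seq; lra. }
induction N as [ | N IH]; [exact Hx | ].
assert (H := HN (S N)); rewrite seq_S, lsum_app in *.
change (lsum _ [_]) with ((if Rle_dec (INR (S N)) x then 1 else 0) + 0) in *.
destruct (Rle_dec (INR (S N)) x); lra.
Qed.

Definition fejer_sum (sigma Z mu : R) (N : nat) : R :=
  lsum (fun k => Rpower (INR k) (- sigma) * fejer Z (ln (INR k) - mu)) (seq 1 N).

Lemma fejer_sum_ge_0 (sigma Z mu : R) (N : nat) : 0 < Z -> 0 <= fejer_sum sigma Z mu N.
Proof.
intros HZ; apply lsum_ge_0; intros k _.
apply Rmult_le_pos; [apply Rlt_le, exp_pos | apply fejer_ge_0, HZ].
Qed.

(** The at most e^(m + 1) integers k <= e^(m + 1) take the trivial bound Z/2; for all others ln k is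
    at distance at least 1 from mu. *)
Lemma fejer_sum_le (sigma Z mu m : R) (N : nat) :
  1 / 2 <= sigma -> 0 < Z -> Rabs mu <= m ->
  fejer_sum sigma Z mu N <= exp (m + 1) * Z / 2 + 4 / Z * sqrt (INR N).
Proof.
intros Hs HZ Hm.
apply Rle_trans with (lsum (fun k => (if Rle_dec (INR k) (exp (m + 1)) then 1 else 0) * (Z / 2)
   + / sqrt (INR k) * (2 / Z)) (seq 1 N)).
- apply lsum_le; intros k Hk; apply in_seq in Hk.
  assert (Hk1 : 1 <= INR k) by (apply (le_INR 1); lia).
  assert (HP : 0 < Rpower (INR k) (- sigma) <= / sqrt (INR k)).
  { split; [apply exp_pos | ].
    rewrite <- Rpower_sqrt by lra; rewrite <- Rpower_Ropp; apply Rle_Rpower; lra. }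
  assert (HP1 : / sqrt (INR k) <= 1).
  { rewrite <- Rinv_1; apply Rinv_le_contravar; [lra | ].
    rewrite <- sqrt_1; apply sqrt_le_1_alt, Hk1. }
  assert (H0 := fejer_ge_0 Z (ln (INR k) - mu) HZ).
  assert (H2 : 0 < 2 / Z) by (apply Rdiv_lt_0_compat; lra).
  destruct (Rle_dec (INR k) (exp (m + 1))) as [H | H].
  + assert (H1 := fejer_le_half Z (ln (INR k) - mu) HZ).
    apply Rle_trans with (1 * (Z / 2)); [apply Rmult_le_compat; lra | ].
    assert (0 < / sqrt (INR k) * (2 / Z)) by (apply Rmult_lt_0_compat; lra); lra.
  + apply Rnot_le_lt in H; rewrite Rmult_0_l, Rplus_0_l.
    apply Rmult_le_compat; [lra | lra | lra | ].
    apply fejer_far; [exact HZ | ].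
    apply ln_increasing in H; [ | apply exp_pos]; rewrite ln_exp in H.
    apply Rabs_le_between in Hm; rewrite Rabs_pos_eq; lra.
- rewrite lsum_plus, !lsum_scal_r.
  assert (H1 := count_le (exp (m + 1)) N (Rlt_le _ _ (exp_pos _))).
  assert (H2 := sum_inv_sqrt N).
  assert (H3 : 0 < 2 / Z) by (apply Rdiv_lt_0_compat; lra).
  apply (Rmult_le_compat_r (Z / 2)) in H1; [ | lra].
  apply (Rmult_le_compat_r (2 / Z)) in H2; [ | lra].
  unfold Rdiv in *; lra.
Qed.

Definition cos_sum (modes : list (R * R)) (t : R) : R :=
  lsum (fun x => fst x * cos (t * snd x)) modes.

Lemma continuous_cos_sum modes t : continuous (cos_sum modes) t.
Proof.
apply continuous_lsum; intros x; apply cont_ex_derive; auto_derive; auto.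
Qed.

Definition mean_zeta (sigma Z : R) (modes : list (R * R)) : R :=
  RInt (fun t => (1 - t / Z) * (cos_sum modes t * zeta_re sigma t)) 0 Z.

Definition mode_term (sigma Z mu : R) (N : nat) : R :=
  (fejer_sum sigma Z mu N + fejer_sum sigma Z (- mu) N) / 2
  - pole_int (1 - sigma) Z mu (ln (INR N)).

Lemma is_RInt_modes (sigma Z : R) (N : nat) modes : sigma < 1 -> 0 < Z ->
  is_RInt (fun t => (1 - t / Z) *
      (cos_sum modes t * (dsum sigma N t - pole (1 - sigma) (ln (INR N)) t))) 0 Z
    (lsum (fun x => fst x * mode_term sigma Z (snd x) N) modes).
Proof.
intros Hs HZ.
eapply is_RInt_ext.
2: apply (is_RInt_lsum (fun x t => fst x *
  (lsum (fun k => Rpower (INR k) (- sigma) *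
      ((1 - t / Z) * (cos (t * snd x) * cos (t * ln (INR k))))) (seq 1 N)
   - (1 - t / Z) * (cos (t * snd x) * pole (1 - sigma) (ln (INR N)) t)))).
- intros t _; unfold cos_sum; rewrite <- lsum_scal_r, <- lsum_scal.
  apply lsum_ext; intros x _; unfold dsum.
  rewrite (lsum_ext _ (fun k => (1 - t / Z) * cos (t * snd x) *
    (Rpower (INR k) (- sigma) * cos (t * ln (INR k))))) by (intros; ring).
  rewrite lsum_scal; ring.
- intros x _; apply (is_RInt_scal (V := R_NormedModule)).
  apply (is_RInt_minus (V := R_NormedModule)).
  + unfold fejer_sum; rewrite <- lsum_plus; unfold Rdiv; rewrite <- lsum_scal_r.
    rewrite (lsum_ext _ (fun k => Rpower (INR k) (- sigma) *
      RInt (fun t => (1 - t / Z) * (cos (t * snd x) * cos (t * ln (INR k)))) 0 Z)).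
    * apply (is_RInt_lsum (fun k t => Rpower (INR k) (- sigma) *
        ((1 - t / Z) * (cos (t * snd x) * cos (t * ln (INR k)))))).
      intros k _; apply (is_RInt_scal (V := R_NormedModule)).
      apply (RInt_correct (V := R_CompleteNormedModule)), ex_RInt_cont.
      intros t; apply cont_ex_derive; auto_derive; auto.
    * intros k _; rewrite RInt_fejer_cos by exact HZ.
      replace (ln (INR k) - - snd x) with (ln (INR k) + snd x) by ring; field.
  + apply (RInt_correct (V := R_CompleteNormedModule)), ex_RInt_cont.
    intros t; apply cont_ex_derive; unfold pole.
    assert (0 < (1 - sigma) ^ 2 + t ^ 2) by nra; auto_derive; nra.
Qed.

Lemma weight_bounds (Z t : R) : 0 < Z -> 0 <= t <= Z -> 0 <= 1 - t / Z <= 1.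
Proof.
intros HZ Ht; assert (0 <= t / Z <= 1); [ | lra].
split; [apply Rmult_le_pos; [lra | apply Rlt_le, Rinv_0_lt_compat, HZ] | ].
apply Rle_div_l; [exact HZ | lra].
Qed.

Lemma mean_zeta_approx (sigma Z : R) (N : nat) modes :
  1 / 2 <= sigma < 1 -> 1 <= Z -> 4000000 * Z ^ 2 <= INR N ->
  (forall t, 0 <= cos_sum modes t) ->
  Rabs (mean_zeta sigma Z modes
        - lsum (fun x => fst x * mode_term sigma Z (snd x) (S N)) modes)
  <= / 500 * RInt (cos_sum modes) 0 Z.
Proof.
intros Hs HZ HN HW.
assert (I := is_RInt_modes sigma Z (S N) modes ltac:(lra) ltac:(lra)).
assert (C1 : forall t, continuous (fun t => (1 - t / Z) * (cos_sum modes t * zeta_re sigma t)) t).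
{ intros t; apply (continuous_mult (K := R_AbsRing)); [apply cont_ex_derive; auto_derive; auto | ].
  apply (continuous_mult (K := R_AbsRing));
    [apply continuous_cos_sum | apply continuous_zeta_re; lra]. }
rewrite <- (is_RInt_unique _ _ _ _ I).
assert (I1 := RInt_correct _ _ _
  (ex_RInt_cont _ 0 Z C1)).
assert (I2 := is_RInt_minus _ _ _ _ _ _ I1 I).
assert (I3 : is_RInt (fun t => / 500 * cos_sum modes t) 0 Z
               (/ 500 * RInt (cos_sum modes) 0 Z)).
{ apply (is_RInt_scal (V := R_NormedModule)), (RInt_correct (V := R_CompleteNormedModule)).
  apply ex_RInt_cont, continuous_cos_sum. }
rewrite (is_RInt_unique _ _ _ _ I).
change (norm (minus (mean_zeta sigma Z modes)
   (lsum (fun x => fst x * mode_term sigma Z (snd x) (S N)) modes))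
   <= / 500 * RInt (cos_sum modes) 0 Z).
refine (norm_RInt_le _ _ 0 Z _ _ _ _ I2 I3); [lra | ].
intros t Ht.
change (Rabs ((1 - t / Z) * (cos_sum modes t * zeta_re sigma t) -
  (1 - t / Z) * (cos_sum modes t * (dsum sigma (S N) t - pole (1 - sigma) (ln (INR (S N))) t)))
  <= / 500 * cos_sum modes t).
rewrite <- !Rmult_minus_distr_l.
assert (HZ2 : 1 <= Z ^ 2) by nra.
assert (HN1 : (1 <= N)%nat) by (apply INR_le; simpl; lra).
assert (Hz := zeta_re_approx sigma t N Hs HN1).
assert (Hw := weight_bounds Z t ltac:(lra) Ht).
(* For t <= Z and Z >= 1 the approximation error 2 (1 + t) / sqrt N is then at most 4Z / (2000 Z) =
   1/500. *)
assert (Hq : 2000 * Z <= sqrt (INR N)).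
{ rewrite <- (sqrt_pow2 (2000 * Z)) by lra; apply sqrt_le_1_alt.
  replace ((2000 * Z) ^ 2) with (4000000 * Z ^ 2) by ring; exact HN. }
assert (He : 2 * (1 + Rabs t) / sqrt (INR N) <= / 500).
{ rewrite Rabs_pos_eq by lra.
  apply Rle_div_l; lra. }
rewrite !Rabs_mult, (Rabs_pos_eq (1 - t / Z)), (Rabs_pos_eq (cos_sum modes t)) by (auto; lra).
assert (H0 := HW t); set (W := cos_sum modes t) in *.
set (e := Rabs (zeta_re sigma t - _)) in *.
assert (He0 : 0 <= e) by apply Rabs_pos.
assert (H5 : W * e <= W * / 500) by (apply Rmult_le_compat_l; lra).
assert (H6 : 0 <= W * e) by (apply Rmult_le_pos; assumption).
nra.
Qed.

(** The length of the sum is bounded below for the approximation of zeta on [0, Z], and above for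
    the polar term, which grows like sqrt N / Z. *)
Lemma ex_scale_nat (Z : R) : 1 <= Z ->
  exists N, 4000000 * Z ^ 2 <= INR N /\ sqrt (INR (S N)) <= 3000 * Z.
Proof.
intros HZ; assert (HZ2 : 1 <= Z ^ 2) by nra.
destruct (nfloor_ex (4000000 * Z ^ 2)) as [n Hn]; [lra | ].
exists (S n); rewrite !S_INR; split; [lra | ].
rewrite <- (sqrt_pow2 (3000 * Z)) by lra; apply sqrt_le_1_alt.
replace ((3000 * Z) ^ 2) with (9000000 * Z ^ 2) by ring; lra.
Qed.

Lemma pole_term_le (sigma Z mu m : R) (N : nat) :
  1 / 2 <= sigma < 1 -> 1 <= Z -> 0 <= m -> Rabs mu <= m ->
  (1 <= N)%nat -> sqrt (INR N) <= 3000 * Z ->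
  Rabs (pole_int (1 - sigma) Z mu (ln (INR N))) <= 12010 * exp (m + 1).
Proof.
intros Hs HZ Hm0 Hm HN HN3.
assert (HN1 : 1 <= INR N) by (apply (le_INR 1); exact HN).
assert (H := pole_int_le (1 - sigma) Z mu m (ln (INR N)) ltac:(lra) ltac:(lra) Hm
               (ln_ge_0 _ HN1)).
replace (exp (ln (INR N) / 2)) with (sqrt (INR N)) in H.
2:{ rewrite <- Rpower_sqrt by lra; unfold Rpower; f_equal; field. }
assert (HE : 1 <= exp (m + 1)) by (assert (HE0 := exp_ineq1_le (m + 1)); lra).
assert (H4 : 4 / Z * sqrt (INR N) <= 12000).
{ apply (Rmult_le_reg_l Z); [lra | ].
  replace (Z * (4 / Z * sqrt (INR N))) with (4 * sqrt (INR N)) by (field; lra); lra. }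
lra.
Qed.

Lemma mode_term_abs (sigma Z mu m : R) (N : nat) :
  1 / 2 <= sigma < 1 -> 1 <= Z -> 0 <= m -> Rabs mu <= m ->
  (1 <= N)%nat -> sqrt (INR N) <= 3000 * Z ->
  Rabs (mode_term sigma Z mu N) <= 25000 * (exp (m + 1) * Z).
Proof.
intros Hs HZ Hm0 Hm HN HN3.
assert (Hp := pole_term_le sigma Z mu m N Hs HZ Hm0 Hm HN HN3).
assert (Hm' : Rabs (- mu) <= m) by (rewrite Rabs_Ropp; exact Hm).
assert (H1 := fejer_sum_le sigma Z mu m N ltac:(lra) ltac:(lra) Hm).
assert (H2 := fejer_sum_le sigma Z (- mu) m N ltac:(lra) ltac:(lra) Hm').
assert (H3 := fejer_sum_ge_0 sigma Z mu N ltac:(lra)).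
assert (H4 := fejer_sum_ge_0 sigma Z (- mu) N ltac:(lra)).
assert (HE : 1 <= exp (m + 1)) by (assert (HE0 := exp_ineq1_le (m + 1)); lra).
assert (H5 : 4 / Z * sqrt (INR N) <= 12000).
{ apply (Rmult_le_reg_l Z); [lra | ].
  replace (Z * (4 / Z * sqrt (INR N))) with (4 * sqrt (INR N)) by (field; lra); lra. }
assert (HEZ : exp (m + 1) <= exp (m + 1) * Z) by nra.
unfold mode_term; apply Rabs_le_between in Hp; apply Rabs_le.
unfold Rdiv in H1, H2; rewrite Rmult_assoc in H1, H2; lra.
Qed.

(** For the scales Y and 2Y: no cancellation is used, so every mode costs its amplitude times Z e^(m
    + 1). *)
Lemma mean_zeta_abs (sigma Z m : R) (modes : list (R * R)) :
  1 / 2 <= sigma < 1 -> 1 <= Z -> 0 <= m ->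
  (forall x, In x modes -> 0 <= fst x /\ Rabs (snd x) <= m) ->
  (forall t, 0 <= cos_sum modes t) ->
  Rabs (mean_zeta sigma Z modes) <= 25001 * (exp (m + 1) * Z) * lsum fst modes.
Proof.
intros Hs HZ Hm0 Hm HW.
destruct (ex_scale_nat Z HZ) as [N [HN HN3]].
assert (H := mean_zeta_approx sigma Z N modes Hs HZ HN HW).
assert (HE : 1 <= exp (m + 1)) by (assert (HE0 := exp_ineq1_le (m + 1)); lra).
assert (HQ : 0 <= lsum fst modes) by (apply lsum_ge_0; intros x Hx; apply Hm, Hx).
assert (H1 : RInt (cos_sum modes) 0 Z <= Z * lsum fst modes).
{ replace (Z * lsum fst modes) with (RInt (fun _ => lsum fst modes) 0 Z)
    by (rewrite RInt_const; unfold scal; simpl; unfold mult; simpl; ring).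
  apply RInt_le; [lra | apply ex_RInt_cont, continuous_cos_sum | apply ex_RInt_const | ].
  intros t _; apply lsum_le; intros x Hx; destruct (Hm x Hx) as [H0 _].
  assert (H2 := COS_bound (t * snd x)); nra. }
assert (H2 : Rabs (lsum (fun x => fst x * mode_term sigma Z (snd x) (S N)) modes)
             <= 25000 * (exp (m + 1) * Z) * lsum fst modes).
{ eapply Rle_trans; [apply lsum_Rabs | ].
  rewrite <- lsum_scal; apply lsum_le; intros x Hx; destruct (Hm x Hx) as [H0 H2].
  rewrite Rabs_mult, (Rabs_pos_eq (fst x)), Rmult_comm by exact H0.
  apply Rmult_le_compat_r; [exact H0 | ].
  apply mode_term_abs; auto; lia. }
assert (H3 : Z * lsum fst modes <= exp (m + 1) * Z * lsum fst modes).
{ apply Rmult_le_compat_r; [exact HQ | nra]. }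
assert (H4 : 0 <= Z * lsum fst modes) by (apply Rmult_le_pos; lra).
apply Rabs_le_between in H; apply Rabs_le_between in H2; apply Rabs_le.
lra.
Qed.

(** For the scale T: positivity of the Fejer kernel allows the sum centred at -mu to be dropped, and
    the polar term has no factor Z. *)
Lemma mean_zeta_ge (sigma Z m : R) (modes : list (R * R)) :
  1 / 2 <= sigma < 1 -> 1 <= Z -> 0 <= m ->
  (forall x, In x modes -> 0 <= fst x /\ Rabs (snd x) <= m) ->
  (forall t, 0 <= cos_sum modes t) ->
  exists N, 4000000 * Z ^ 2 <= INR N /\
  lsum (fun x => fst x * (fejer_sum sigma Z (snd x) N / 2)) modes
  - 12010 * exp (m + 1) * lsum fst modes - / 500 * RInt (cos_sum modes) 0 Z
  <= mean_zeta sigma Z modes.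
Proof.
intros Hs HZ Hm0 Hm HW.
destruct (ex_scale_nat Z HZ) as [N [HN HN3]].
exists (S N); split; [rewrite S_INR; lra | ].
assert (H := mean_zeta_approx sigma Z N modes Hs HZ HN HW).
assert (H1 : lsum (fun x => fst x * (fejer_sum sigma Z (snd x) (S N) / 2)) modes
   + - (12010 * exp (m + 1) * lsum fst modes) <=
   lsum (fun x => fst x * mode_term sigma Z (snd x) (S N)) modes).
{ rewrite <- lsum_scal, <- lsum_opp, <- lsum_plus; apply lsum_le.
  intros x Hx; destruct (Hm x Hx) as [H0 H2].
  assert (Hp := pole_term_le sigma Z (snd x) m (S N) Hs HZ Hm0 H2 ltac:(lia) HN3).
  assert (H4 := fejer_sum_ge_0 sigma Z (- snd x) (S N) ltac:(lra)).
  apply Rabs_le_between in Hp; unfold mode_term.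
  rewrite (Rmult_comm _ (fst x)), <- Ropp_mult_distr_r_reverse, <- Rmult_plus_distr_l.
  apply Rmult_le_compat_l; [exact H0 | lra]. }
apply Rabs_le_between in H; lra.
Qed.

(* The combination of three Fejer weights on the left is the piecewise linear
   weight which vanishes on [0, Y] and agrees with [1 - t / T] on [2Y, T]. *)
Lemma window_max (sigma Y T U : R) (modes : list (R * R)) :
  0 < sigma < 1 -> 0 < Y -> 2 * Y <= T -> 0 <= U ->
  (forall t, 0 <= cos_sum modes t) ->
  (forall t, Y <= t <= T -> zeta_re sigma t <= U) ->
  mean_zeta sigma T modes
  - 2 * (1 - Y / T) * mean_zeta sigma (2 * Y) modes
  + (1 - 2 * Y / T) * mean_zeta sigma Y modes
  <= U * RInt (cos_sum modes) 0 T.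
Proof.
intros Hs HY HT HU HW Hz.
set (h := fun t => cos_sum modes t * zeta_re sigma t).
set (G := fun Z t => (1 - t / Z) * h t).
assert (Ch : forall t, continuous h t).
{ intros t; apply (continuous_mult (K := R_AbsRing));
    [apply continuous_cos_sum | apply continuous_zeta_re, Hs]. }
assert (CG : forall Z t, continuous (G Z) t).
{ intros Z t; apply (continuous_mult (K := R_AbsRing)); [ | apply Ch].
  apply cont_ex_derive; auto_derive; auto. }
assert (EG : forall Z a b, ex_RInt (G Z) a b) by (intros; apply ex_RInt_cont, CG).
assert (IG := fun Z a b => RInt_correct _ _ _ (EG Z a b)).
assert (EW : forall a b, ex_RInt (cos_sum modes) a b)
  by (intros; apply ex_RInt_cont, continuous_cos_sum).
assert (IW := fun a b => is_RInt_scal _ _ _ U _ (RInt_correct _ _ _ (EW a b))).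
(* Because U is nonnegative, a weight between 0 and 1 can be replaced by 1 after [zeta_re] has been
   bounded by U. *)
assert (Hp : forall w t, 0 <= w <= 1 -> Y <= t <= T -> w * h t <= U * cos_sum modes t).
{ intros w t Hw Ht; unfold h; assert (H1 := HW t); assert (H2 := Hz t Ht).
  assert (0 <= cos_sum modes t * U) by (apply Rmult_le_pos; lra).
  apply Rle_trans with (w * (cos_sum modes t * U)); [ | nra].
  apply Rmult_le_compat_l; [lra | apply Rmult_le_compat_l; lra]. }
assert (Ch3 : forall f a b c, (forall x y, ex_RInt f x y) ->
          RInt f a c = RInt f a b + RInt f b c).
{ intros f a b c Hf; symmetry; apply (RInt_Chasles (V := R_CompleteNormedModule)); auto. }
change (RInt (G T) 0 T - 2 * (1 - Y / T) * RInt (G (2 * Y)) 0 (2 * Y)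
  + (1 - 2 * Y / T) * RInt (G Y) 0 Y <= U * RInt (cos_sum modes) 0 T).
rewrite (Ch3 (G T) 0 Y T), (Ch3 (G T) Y (2 * Y) T) by apply EG.
rewrite (Ch3 (G (2 * Y)) 0 Y (2 * Y)) by apply EG.
rewrite (Ch3 (cos_sum modes) 0 Y T), (Ch3 (cos_sum modes) Y (2 * Y) T) by apply EW.
assert (H0 : RInt (G T) 0 Y - 2 * (1 - Y / T) * RInt (G (2 * Y)) 0 Y
  + (1 - 2 * Y / T) * RInt (G Y) 0 Y = 0).
{ assert (I1 := IG T 0 Y); assert (I2 := IG (2 * Y) 0 Y); assert (I3 := IG Y 0 Y).
  apply (is_RInt_scal _ _ _ (2 * (1 - Y / T))) in I2.
  apply (is_RInt_scal _ _ _ (1 - 2 * Y / T)) in I3.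
  assert (I := is_RInt_plus _ _ _ _ _ _
                 (is_RInt_minus _ _ _ _ _ _ I1 I2) I3).
  apply is_RInt_unique in I.
  etransitivity; [symmetry; exact I | ].
  rewrite (RInt_ext _ (fun _ => 0)).
  - rewrite RInt_const; unfold scal; simpl; unfold mult; simpl; ring.
  - intros t _; change (G T t - 2 * (1 - Y / T) * G (2 * Y) t + (1 - 2 * Y / T) * G Y t = 0).
    unfold G; field; lra. }
assert (H1 : RInt (G T) Y (2 * Y) - 2 * (1 - Y / T) * RInt (G (2 * Y)) Y (2 * Y)
   <= U * RInt (cos_sum modes) Y (2 * Y)).
{ assert (I1 := IG T Y (2 * Y)); assert (I2 := IG (2 * Y) Y (2 * Y)).
  apply (is_RInt_scal _ _ _ (2 * (1 - Y / T))) in I2.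
  assert (I := is_RInt_minus _ _ _ _ _ _ I1 I2).
  refine (is_RInt_le _ _ Y (2 * Y) _ _ _ I (IW Y (2 * Y)) _); [lra | ].
  intros t Ht.
  change (G T t - 2 * (1 - Y / T) * G (2 * Y) t <= U * cos_sum modes t).
  assert (E : G T t - 2 * (1 - Y / T) * G (2 * Y) t =
     ((1 - t / T) - 2 * (1 - Y / T) * (1 - t / (2 * Y))) * h t)
    by (unfold G; ring).
  rewrite E; set (w := (1 - t / T) - 2 * (1 - Y / T) * (1 - t / (2 * Y))).
  apply Hp; [ | lra].
  assert (Hw1 := weight_bounds T t ltac:(lra) ltac:(lra)).
  assert (Hw2 := weight_bounds (2 * Y) t ltac:(lra) ltac:(lra)).
  assert (Hw3 := weight_bounds T Y ltac:(lra) ltac:(lra)).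
  split; [ | unfold w; nra].
  assert (Ew : w = (t - Y) / Y - (2 * t - 2 * Y) / T) by (unfold w; field; lra).
  assert ((2 * t - 2 * Y) / T <= (t - Y) / Y); [ | lra].
  apply (Rmult_le_reg_r (T * Y)); [nra | ].
  replace ((2 * t - 2 * Y) / T * (T * Y)) with ((2 * t - 2 * Y) * Y) by (field; lra).
  replace ((t - Y) / Y * (T * Y)) with ((t - Y) * T) by (field; lra).
  nra. }
assert (H2 : RInt (G T) (2 * Y) T <= U * RInt (cos_sum modes) (2 * Y) T).
{ refine (is_RInt_le _ _ (2 * Y) T _ _ _ (IG T (2 * Y) T) (IW (2 * Y) T) _); [lra | ].
  intros t Ht; apply Hp; [apply weight_bounds | ]; lra. }
assert (H3 : 0 <= RInt (cos_sum modes) 0 Y)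
  by (apply RInt_ge_0; [lra | apply EW | auto]).
assert (H4 : 0 <= U * RInt (cos_sum modes) 0 Y) by (apply Rmult_le_pos; assumption).
set (a := 2 * (1 - Y / T)) in *; set (b := 1 - 2 * Y / T) in *.
rewrite !Rmult_plus_distr_l; lra.
Qed.

(** * The resonance inequality *)

Lemma lsum_list_prod {A B : Type} (F : A * B -> R) (l : list A) (l' : list B) :
  lsum F (list_prod l l') = lsum (fun x => lsum (fun y => F (x, y)) l') l.
Proof.
induction l as [ | x l IH]; simpl; [reflexivity | ].
rewrite lsum_app, IH, lsum_map; reflexivity.
Qed.

Lemma NoDup_list_prod {A B : Type} (l : list A) (l' : list B) :
  NoDup l -> NoDup l' -> NoDup (list_prod l l').
Proof.
intros H Hl; induction H as [ | i I Hi HI IH]; simpl; [constructor | ].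
apply NoDup_app; [ | exact IH | ].
- apply FinFun.Injective_map_NoDup; [intros x y Hxy; congruence | exact Hl].
- intros x Hx Hx'; apply in_map_iff in Hx; destruct Hx as [y [<- _]].
  apply in_prod_iff in Hx'; tauto.
Qed.

(** Only cosines occur, so the spacing pi/T suffices on [0, T], half of what exponentials would
    require. *)
Lemma RInt_cos_harmonic (T : R) (i j : Z) : 0 < T ->
  is_RInt (fun t => cos (t * ((IZR i - IZR j) * (PI / T)))) 0 T
    (if Z.eq_dec i j then T else 0).
Proof.
intros HT; destruct (Z.eq_dec i j) as [<- | Hij].
- apply (is_RInt_ext (fun _ => 1)).
  { intros t _; symmetry; replace (t * ((IZR i - IZR i) * (PI / T))) with 0 by ring.
    apply cos_0. }
  assert (K := is_RInt_const 0 T 1).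
  change (is_RInt (fun _ => 1) 0 T ((T - 0) * 1)) in K.
  replace ((T - 0) * 1) with T in K by ring; exact K.
- set (w := (IZR i - IZR j) * (PI / T)).
  assert (Hw : w <> 0).
  { unfold w; apply Rmult_integral_contrapositive_currified.
    - rewrite <- minus_IZR; apply IZR_neq; lia.
    - assert (H := PI_RGT_0); apply Rgt_not_eq, Rdiv_lt_0_compat; lra. }
  assert (Hs : sin (T * w) = 0).
  { apply sin_eq_0_1; exists (i - j)%Z; unfold w; rewrite minus_IZR; field; lra. }
  replace 0 with (minus (sin (T * w) / w) (sin (0 * w) / w)) at 2.
  + apply (is_RInt_derive (fun t => sin (t * w) / w)).
    * intros t _; auto_derive; [lra | field; lra].
    * intros t _; apply cont_ex_derive; auto_derive; auto.
  + rewrite Hs, Rmult_0_l, sin_0; unfold minus, plus, opp; simpl; field; lra.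
Qed.

Section Resonance.
Context {S C : Type}.
Variables (M : list S) (f ell : S -> R) (T : R).
Hypothesis f_ge_0 : forall m, 0 <= f m.
Hypothesis T_gt_0 : 0 < T.

(* One frequency per cell of length [PI / T], weighted by the norm of [f] on the cell: this makes the
   frequencies orthogonal on [0, T], whatever the gaps between the values of [ell]. *)
Definition cell (m : S) : Z := Int_part (T * ell m / PI).

Lemma cell_spec m : IZR (cell m) * (PI / T) <= ell m < IZR (cell m) * (PI / T) + PI / T.
Proof.
destruct (base_Int_part (T * ell m / PI)) as [H1 H2]; fold (cell m) in H1, H2.
assert (HP := PI_RGT_0).
assert (Hc : 0 < PI / T) by (apply Rdiv_lt_0_compat; lra).
assert (E : ell m = T * ell m / PI * (PI / T)) by (field; lra).
split.
- rewrite E; apply Rmult_le_compat_r; lra.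
- rewrite E at 1; replace (IZR (cell m) * (PI / T) + PI / T)
    with ((IZR (cell m) + 1) * (PI / T)) by ring.
  apply Rmult_lt_compat_r; lra.
Qed.

Definition cells : list Z := nodup Z.eq_dec (map cell M).

Definition cell_norm (j : Z) : R :=
  sqrt (lsum (fun m => if Z.eq_dec (cell m) j then f m ^ 2 else 0) M).

Definition cell_modes : list (R * R) :=
  map (fun p => (cell_norm (fst p) * cell_norm (snd p),
                 (IZR (fst p) - IZR (snd p)) * (PI / T))) (list_prod cells cells).

Lemma cell_norm_sq j :
  cell_norm j ^ 2 = lsum (fun m => if Z.eq_dec (cell m) j then f m ^ 2 else 0) M.
Proof.
apply pow2_sqrt, lsum_ge_0; intros m _; destruct (Z.eq_dec (cell m) j);
  [apply pow2_ge_0 | lra].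
Qed.

Lemma in_cells m : In m M -> In (cell m) cells.
Proof. intros Hm; apply nodup_In, in_map, Hm. Qed.

Lemma sum_cell_norm_sq :
  lsum (fun j => cell_norm j ^ 2) cells = lsum (fun m => f m ^ 2) M.
Proof.
rewrite (lsum_fiber Z.eq_dec cell _ M cells).
- apply lsum_ext; intros j _; apply cell_norm_sq.
- apply NoDup_nodup.
- apply in_cells.
Qed.

Lemma cos_sum_cell_modes t :
  cos_sum cell_modes t =
  lsum (fun j => cell_norm j * cos (t * (IZR j * (PI / T)))) cells ^ 2 +
  lsum (fun j => cell_norm j * sin (t * (IZR j * (PI / T)))) cells ^ 2.
Proof.
unfold cos_sum, cell_modes; rewrite lsum_map, lsum_list_prod; simpl.
rewrite !Rmult_1_r, !lsum_mult, <- lsum_plus.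
apply lsum_ext; intros i _; rewrite <- lsum_plus; apply lsum_ext; intros j _.
replace (t * ((IZR i - IZR j) * (PI / T)))
  with (t * (IZR i * (PI / T)) - t * (IZR j * (PI / T))) by ring.
rewrite cos_minus; ring.
Qed.

Lemma cos_sum_cell_modes_ge_0 t : 0 <= cos_sum cell_modes t.
Proof.
rewrite cos_sum_cell_modes; apply Rplus_le_le_0_compat; apply pow2_ge_0.
Qed.

Lemma RInt_cell_modes :
  RInt (cos_sum cell_modes) 0 T = T * lsum (fun m => f m ^ 2) M.
Proof.
rewrite <- sum_cell_norm_sq; apply is_RInt_unique.
unfold cos_sum, cell_modes.
assert (K : is_RInt (fun t => lsum (fun p => cell_norm (fst p) * cell_norm (snd p) *
     cos (t * ((IZR (fst p) - IZR (snd p)) * (PI / T)))) (list_prod cells cells)) 0 T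
   (lsum (fun p => cell_norm (fst p) * cell_norm (snd p) *
      (if Z.eq_dec (fst p) (snd p) then T else 0)) (list_prod cells cells))).
{ apply (is_RInt_lsum (fun p t => cell_norm (fst p) * cell_norm (snd p) *
     cos (t * ((IZR (fst p) - IZR (snd p)) * (PI / T))))).
  intros p _; apply (is_RInt_scal (V := R_NormedModule)), RInt_cos_harmonic, T_gt_0. }
rewrite lsum_list_prod in K; simpl in K.
apply (is_RInt_ext (fun t => lsum (fun p => cell_norm (fst p) * cell_norm (snd p) *
     cos (t * ((IZR (fst p) - IZR (snd p)) * (PI / T)))) (list_prod cells cells))).
{ intros t _; rewrite lsum_map; reflexivity. }
replace (T * lsum (fun j => cell_norm j ^ 2) cells) with
  (lsum (fun x => lsum (fun y => cell_norm x * cell_norm y *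
      (if Z.eq_dec x y then T else 0)) cells) cells); [exact K | ].
rewrite <- lsum_scal; apply lsum_ext; intros i Hi.
rewrite (lsum_ext _ (fun j => if Z.eq_dec i j then T * cell_norm i ^ 2 else 0)).
- apply lsum_pick; [apply NoDup_nodup | exact Hi].
- intros j _; destruct (Z.eq_dec i j) as [<- | _]; ring.
Qed.

(** The total amplitude is the square of the sum of the cell norms, and there are at most as many
    cells as frequencies. This is where the number of terms of the resonator enters. *)
Lemma cell_modes_total :
  lsum fst cell_modes <= INR (length M) * lsum (fun m => f m ^ 2) M.
Proof.
replace (lsum fst cell_modes) with (lsum cell_norm cells ^ 2).
- eapply Rle_trans; [apply lsum_sqr_le | rewrite sum_cell_norm_sq].
  apply Rmult_le_compat_r; [apply lsum_ge_0; intros; apply pow2_ge_0 | ].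
  apply le_INR; rewrite <- (length_map cell M).
  apply NoDup_incl_length; [apply NoDup_nodup | intros j; apply nodup_In].
- unfold cell_modes; rewrite lsum_map, lsum_list_prod; simpl.
  rewrite Rmult_1_r, lsum_mult; reflexivity.
Qed.

Lemma cell_modes_bound (l0 : R) : 1 <= T ->
  (forall m, In m M -> Rabs (ell m) <= l0) ->
  forall x, In x cell_modes -> 0 <= fst x /\ Rabs (snd x) <= 2 * l0 + 4.
Proof.
intros HT Hl x Hx; apply in_map_iff in Hx; destruct Hx as [[i j] [<- Hij]].
apply in_prod_iff in Hij; destruct Hij as [Hi Hj]; simpl; split.
- apply Rmult_le_pos; apply sqrt_pos.
- unfold cells in *; rewrite nodup_In, in_map_iff in Hi, Hj.
  destruct Hi as [m [<- Hm]]; destruct Hj as [n [<- Hn]].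
  assert (H1 := cell_spec m); assert (H2 := cell_spec n).
  apply Hl, Rabs_le_between in Hm; apply Hl, Rabs_le_between in Hn.
  assert (HP := PI_4).
  assert (PI / T <= 4).
  { apply Rle_div_l; lra. }
  rewrite Rmult_minus_distr_r; apply Rabs_le; lra.
Qed.

Variables (E : list C) (src tgt : C -> S) (kk : C -> nat).
Hypothesis NoDup_E : NoDup E.
Hypothesis src_M : forall e, In e E -> In (src e) M.
Hypothesis tgt_M : forall e, In e E -> In (tgt e) M.
Hypothesis kk_pos : forall e, In e E -> (1 <= kk e)%nat.
Hypothesis kk_ell : forall e, In e E -> ln (INR (kk e)) = ell (tgt e) - ell (src e).
Hypothesis kk_src : forall e e', In e E -> In e' E -> kk e = kk e' ->
  src e = src e' -> e = e'.
Hypothesis kk_tgt : forall e e', In e E -> In e' E -> kk e = kk e' ->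
  tgt e = tgt e' -> e = e'.

Let key e := (cell (tgt e), cell (src e)).

Lemma ZZ_eq_dec (x y : Z * Z) : {x = y} + {x <> y}.
Proof. decide equality; apply Z.eq_dec. Qed.

(** Injectivity of g on E' turns the sum over edges into a sum over distinct frequencies of a single
    cell. *)
Lemma cell_CS (g : C -> S) (E' : list C) (j : Z) :
  NoDup E' -> (forall e, In e E' -> In (g e) M /\ cell (g e) = j) ->
  (forall e e', In e E' -> In e' E' -> g e = g e' -> e = e') ->
  sqrt (lsum (fun e => f (g e) ^ 2) E') <= cell_norm j.
Proof.
intros H1 H2 H3; apply sqrt_le_1_alt; rewrite <- lsum_map with (F := fun m => f m ^ 2).
rewrite (lsum_ext (fun m => f m ^ 2)
  (fun m => if Z.eq_dec (cell m) j then f m ^ 2 else 0) (map g E')).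
- apply lsum_incl.
  + apply NoDup_map_NoDup_ForallPairs; [ | exact H1].
    intros e e' He He'; apply H3; assumption.
  + intros m Hm; apply in_map_iff in Hm; destruct Hm as [e [<- He]]; apply H2, He.
  + intros m _; destruct (Z.eq_dec (cell m) j); [apply pow2_ge_0 | lra].
- intros m Hm; apply in_map_iff in Hm; destruct Hm as [e [<- He]].
  destruct (Z.eq_dec (cell (g e)) j) as [ | Hn]; [reflexivity | ].
  exfalso; apply Hn, H2, He.
Qed.

(** For fixed k an edge is determined by either of its ends, so Cauchy-Schwarz over the edges
    joining two given cells yields the product of the cell norms. Each end exceeds the left endpoint
    of its cell by less than pi/T, so the rounded difference is within pi/T of ln k and [fejer_near]
    applies. *)
Lemma fiber_le (k : nat) (p : Z * Z) :
  T / 18 * lsum (fun e => if ZZ_eq_dec (key e) p then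
      (if Nat.eq_dec (kk e) k then f (tgt e) * f (src e) else 0) else 0) E <=
  cell_norm (fst p) * cell_norm (snd p) *
    fejer T (ln (INR k) - (IZR (fst p) - IZR (snd p)) * (PI / T)).
Proof.
set (sel := fun e => if ZZ_eq_dec (key e) p then
              (if Nat.eq_dec (kk e) k then true else false) else false).
set (E' := filter sel E).
rewrite (lsum_ext _ (fun e => if sel e then f (tgt e) * f (src e) else 0)).
2:{ intros e _; unfold sel; destruct (ZZ_eq_dec (key e) p); [ | reflexivity].
    destruct (Nat.eq_dec (kk e) k); reflexivity. }
rewrite <- lsum_filter; fold E'.
assert (HE' : forall e, In e E' -> In e E /\ key e = p /\ kk e = k).
{ intros e He; apply filter_In in He; destruct He as [He Hs]; unfold sel in Hs.
  destruct (ZZ_eq_dec (key e) p); [ | discriminate].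
  destruct (Nat.eq_dec (kk e) k); [auto | discriminate]. }
assert (H0 : 0 <= cell_norm (fst p) * cell_norm (snd p))
  by (apply Rmult_le_pos; apply sqrt_pos).
assert (Hcs : lsum (fun e => f (tgt e) * f (src e)) E' <=
              cell_norm (fst p) * cell_norm (snd p)).
{ assert (ND : NoDup E') by (apply NoDup_filter, NoDup_E).
  eapply Rle_trans; [apply (lsum_CS (fun e => f (tgt e)) (fun e => f (src e))) | ].
  apply Rmult_le_compat; try apply sqrt_pos; apply cell_CS; try exact ND.
  - intros e He; destruct (HE' e He) as [He1 [<- _]]; split; [apply tgt_M, He1 | reflexivity].
  - intros e e' He He' Heq; destruct (HE' e He) as [H1 [_ H2]].
    destruct (HE' e' He') as [H3 [_ H4]]; apply kk_tgt; congruence.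
  - intros e He; destruct (HE' e He) as [He1 [<- _]]; split; [apply src_M, He1 | reflexivity].
  - intros e e' He He' Heq; destruct (HE' e He) as [H1 [_ H2]].
    destruct (HE' e' He') as [H3 [_ H4]]; apply kk_src; congruence. }
destruct E' as [ | e E''].
- simpl; rewrite Rmult_0_r; apply Rmult_le_pos; [exact H0 | apply fejer_ge_0, T_gt_0].
- destruct (HE' e (or_introl eq_refl)) as [He [Hk1 Hk2]].
  rewrite Rmult_comm; apply Rmult_le_compat.
  + apply lsum_ge_0; intros; apply Rmult_le_pos; apply f_ge_0.
  + lra.
  + exact Hcs.
  + apply fejer_near; [exact T_gt_0 | ].
    rewrite <- Hk1, <- Hk2, kk_ell by exact He; simpl.
    assert (H1 := cell_spec (tgt e)); assert (H2 := cell_spec (src e)).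
    rewrite Rmult_minus_distr_r.
    replace PI with (T * (PI / T)) at 3 by (field; lra).
    apply Rmult_le_compat_l; [lra | ]; apply Rabs_le; lra.
Qed.

Lemma resonance_main (sigma : R) (N : nat) :
  (forall e, In e E -> (kk e <= N)%nat) ->
  T / 18 * lsum (fun e => Rpower (INR (kk e)) (- sigma) * (f (tgt e) * f (src e))) E <=
  lsum (fun x => fst x * fejer_sum sigma T (snd x) N) cell_modes.
Proof.
intros HN; unfold fejer_sum.
rewrite (lsum_ext (fun x => fst x * _) (fun x => lsum (fun k => Rpower (INR k) (- sigma) *
  (fst x * fejer T (ln (INR k) - snd x))) (seq 1 N))).
2:{ intros x _; rewrite <- lsum_scal; apply lsum_ext; intros; ring. }
rewrite lsum_swap, (lsum_fiber Nat.eq_dec kk _ E (seq 1 N)).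
2: apply seq_NoDup.
2:{ intros e He; apply in_seq; assert (H1 := HN e He); assert (H2 := kk_pos e He); lia. }
rewrite <- lsum_scal; apply lsum_le; intros k _.
rewrite (lsum_ext _ (fun e => Rpower (INR k) (- sigma) *
  (if Nat.eq_dec (kk e) k then f (tgt e) * f (src e) else 0))).
2:{ intros e _; destruct (Nat.eq_dec (kk e) k) as [<- | ]; ring. }
rewrite !lsum_scal, <- Rmult_assoc, (Rmult_comm (T / 18)), Rmult_assoc.
apply Rmult_le_compat_l; [apply Rlt_le, exp_pos | ].
rewrite (lsum_fiber ZZ_eq_dec key _ E (list_prod cells cells)).
- unfold cell_modes; rewrite lsum_map, <- lsum_scal; apply lsum_le.
  intros p _; simpl; apply fiber_le.
- apply NoDup_list_prod; apply NoDup_nodup.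
- intros e He; apply in_prod; apply in_cells; auto.
Qed.

Theorem resonance (sigma Y l0 : R) :
  1 / 2 <= sigma < 1 -> 1 <= Y -> 2 * Y <= T -> 0 <= l0 ->
  (forall m, In m M -> Rabs (ell m) <= l0) ->
  (forall e, In e E -> INR (kk e) <= T) ->
  INR (length M) * exp (2 * l0) * Y * 100000000000 <= T ->
  0 < lsum (fun m => f m ^ 2) M ->
  lsum (fun m => f m ^ 2) M <=
    lsum (fun e => Rpower (INR (kk e)) (- sigma) * (f (tgt e) * f (src e))) E ->
  exists t, Y <= t <= T /\
    lsum (fun e => Rpower (INR (kk e)) (- sigma) * (f (tgt e) * f (src e))) E
    <= 50 * lsum (fun m => f m ^ 2) M * zeta_re sigma t.
Proof.
intros Hs HY HT Hl0 Hl Hk HM HS HSM.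
set (Sf := lsum (fun m => f m ^ 2) M) in *.
set (Main := lsum _ E) in *.
assert (Hmodes := cell_modes_bound l0 ltac:(lra) Hl).
assert (HW := cos_sum_cell_modes_ge_0).
assert (HQ := cell_modes_total); fold Sf in HQ.
set (Q := lsum fst cell_modes) in *.
set (X := exp (2 * l0 + 4 + 1)).
(* The extra 5 in the exponent is 4 for the rounding to cells and 1 for the distance beyond which
   the Fejer kernel is small; e <= 3 turns it into 3^5 = 243. *)
assert (HX : X <= 243 * exp (2 * l0)).
{ unfold X; replace (2 * l0 + 4 + 1) with (1 + (1 + (1 + (1 + (1 + 2 * l0))))) by ring.
  rewrite !exp_plus; assert (H3 := exp_le_3); assert (H1 := exp_pos 1).
  assert (H0 := exp_pos (2 * l0)).
  replace 243 with (3 * (3 * (3 * (3 * 3)))) by ring.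
  rewrite !Rmult_assoc.
  repeat (apply Rmult_le_compat; [lra | repeat apply Rmult_le_pos; lra | exact H3 | ]).
  lra. }
assert (HX1 : 1 <= X) by (unfold X; assert (H := exp_ineq1_le (2 * l0 + 4 + 1)); lra).
assert (HQ0 : 0 <= Q) by (apply lsum_ge_0; intros x Hx; apply Hmodes, Hx).
assert (HQX : Q * X * Y <= / 100000000 * (T * Sf)).
{ apply Rle_trans with (INR (length M) * Sf * (243 * exp (2 * l0)) * Y).
  - apply Rmult_le_compat_r; [lra | apply Rmult_le_compat; lra].
  - apply (Rmult_le_compat_r Sf) in HM; [ | lra].
    assert (0 <= INR (length M) * Sf * exp (2 * l0) * Y).
    { repeat apply Rmult_le_pos; try lra; apply pos_INR. }
    lra. }
assert (HQXY : Q * X <= Q * X * Y) by (assert (0 <= Q * X) by (apply Rmult_le_pos; lra); nra).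
destruct (mean_zeta_ge sigma T (2 * l0 + 4) cell_modes) as [N [HN JT]];
  [exact Hs | lra | lra | exact Hmodes | exact HW | ].
fold X in JT; fold Q in JT; rewrite RInt_cell_modes in JT; fold Sf in JT.
assert (J2 := mean_zeta_abs sigma (2 * Y) (2 * l0 + 4) cell_modes Hs ltac:(lra)
                ltac:(lra) Hmodes HW).
assert (J1 := mean_zeta_abs sigma Y (2 * l0 + 4) cell_modes Hs ltac:(lra)
                ltac:(lra) Hmodes HW).
fold X Q in J1, J2.
assert (HMain : T / 36 * Main <=
  lsum (fun x => fst x * (fejer_sum sigma T (snd x) N / 2)) cell_modes).
{ rewrite (lsum_ext _ (fun x => fst x * fejer_sum sigma T (snd x) N * / 2))
    by (intros; unfold Rdiv; ring).
  rewrite lsum_scal_r.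
  assert (H := resonance_main sigma N).
  replace (T / 36 * Main) with (T / 18 * Main * / 2) by field.
  apply Rmult_le_compat_r; [lra | ]; apply H.
  intros e He; apply INR_le.
  assert (H1 := Hk e He); nra. }
destruct (continuity_ab_maj (zeta_re sigma) Y T) as [t [Ht HtT]]; [lra | | ].
{ intros u _; apply continuity_pt_filterlim, continuous_zeta_re; lra. }
exists t; split; [exact HtT | ].
(* [window_max] asks for a nonnegative bound. The value 0 is excluded at the end, since it would
   give Main <= 0 although 0 < Sf <= Main. *)
set (U := Rmax 0 (zeta_re sigma t)).
assert (HU : forall u, Y <= u <= T -> zeta_re sigma u <= U).
{ intros u Hu; eapply Rle_trans; [apply Ht, Hu | apply Rmax_r]. }
assert (Hwin := window_max sigma Y T U cell_modes ltac:(lra) ltac:(lra) HT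
                  (Rmax_l _ _) HW HU).
rewrite RInt_cell_modes in Hwin; fold Sf in Hwin.
assert (Hw1 := weight_bounds T Y ltac:(lra) ltac:(lra)).
assert (Hw2 : 0 <= 1 - 2 * Y / T <= 1).
{ apply weight_bounds; lra. }
assert (K2 : 2 * (1 - Y / T) * mean_zeta sigma (2 * Y) cell_modes
             <= 2 * (25001 * (X * (2 * Y)) * Q)).
{ apply Rabs_le_between in J2.
  assert (0 <= 25001 * (X * (2 * Y)) * Q) by (repeat apply Rmult_le_pos; lra).
  nra. }
assert (K1 : - (25001 * (X * Y) * Q) <= (1 - 2 * Y / T) * mean_zeta sigma Y cell_modes).
{ apply Rabs_le_between in J1.
  assert (0 <= 25001 * (X * Y) * Q) by (repeat apply Rmult_le_pos; lra).
  nra. }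
assert (HTS : T * Sf <= T * Main) by (apply Rmult_le_compat_l; lra).
assert (HTS0 : 0 < T * Sf) by (apply Rmult_lt_0_compat; lra).
(* The factor 36 is the 18 of [fejer_near] times the 2 of the product formula for cosines. All
   errors together stay below 0.004 T Main, because Sf <= Main, and 1/36 - 0.004 > 1/50. *)
assert (Hfin : T * Main <= T * (50 * Sf * U)).
{ replace (T * (50 * Sf * U)) with (50 * (U * (T * Sf))) by ring.
  assert (E1 : 25001 * (X * (2 * Y)) * Q = 50002 * (Q * X * Y)) by ring.
  assert (E2 : 25001 * (X * Y) * Q = 25001 * (Q * X * Y)) by ring.
  rewrite E1 in K2; rewrite E2 in K1.
  clear J1 J2 Hw1 Hw2 HX HM.
  set (p2 := 2 * (1 - Y / T) * mean_zeta sigma (2 * Y) cell_modes) in *.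
  set (p1 := (1 - 2 * Y / T) * mean_zeta sigma Y cell_modes) in *.
  replace (12010 * X * Q) with (12010 * (Q * X)) in JT by ring.
  set (QX := Q * X) in *; set (QXY := QX * Y) in *.
  set (TS := T * Sf) in *; set (UTS := U * TS) in *.
  replace (T / 36 * Main) with (/ 36 * (T * Main)) in HMain by field.
  set (TM := T * Main) in *.
  lra. }
apply Rmult_le_reg_l in Hfin; [ | exact T_gt_0].
revert Hfin; unfold U; apply Rmax_case; intros Hfin; lra.
Qed.

End Resonance.

(** * The resonator *)

Definition Rleb (x y : R) : bool := if Rle_dec x y then true else false.

Lemma Rleb_true (x y : R) : Rleb x y = true <-> x <= y.
Proof. unfold Rleb; destruct (Rle_dec x y); split; congruence || lra. Qed.

Lemma one_plus_ge_exp (x : R) : 0 <= x -> exp (x / (1 + x)) <= 1 + x.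
Proof.
intros Hx; assert (H := exp_ineq1_le (- (x / (1 + x)))).
rewrite exp_Ropp in H; assert (H0 := exp_pos (x / (1 + x))).
set (e := exp (x / (1 + x))) in *.
apply (Rmult_le_reg_l (/ e)); [apply Rinv_0_lt_compat, H0 | ].
rewrite Rinv_l by lra.
replace (1 + - (x / (1 + x))) with (/ (1 + x)) in H by (field; lra).
apply (Rmult_le_compat_r (1 + x)) in H; [ | lra].
rewrite Rinv_l in H; lra.
Qed.

Section Resonator.
Variables (ps : list nat) (f cost : nat -> R) (sigma B m0 eps rho : R).

Let w p := Rpower (INR p) (- sigma).

Hypothesis NoDup_ps : NoDup ps.
Hypothesis prime_ps : forall p, In p ps -> prime.prime p = true.
Hypothesis sigma_range : 1 / 2 <= sigma < 1.
Hypothesis f_gt_0 : forall p, 0 < f p.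
Hypothesis f_le_1 : forall p, In p ps -> f p <= 1.
Hypothesis cost_ge_0 : forall p, 0 <= cost p.
Hypothesis cost_ln : forall p, In p ps -> cost p <= ln (INR p).
Hypothesis m0_gt_0 : 0 < m0.
Hypothesis B_gt_0 : 0 < B.
Hypothesis eps_gt_0 : 0 < eps.
Hypothesis small_sq : forall p, In p ps -> 2 * f p ^ 2 <= rho.
Hypothesis small_gain : forall p, In p ps -> 2 * (f p * w p) <= rho.
Hypothesis mean_cost :
  lsum (fun p => cost p * (2 * f p ^ 2 + 2 * (f p * w p)) + 4 * (f p * w p) * ln (INR p)) ps
  <= B * (1 - 2 * eps).
Hypothesis mean_quot : lsum (fun p => 4 * (f p * w p) * ln (INR p)) ps <= eps / 2 * m0.
Hypothesis mean_sq :
  lsum (fun p => (2 * f p ^ 2 + 2 * (f p * w p)) * ln (INR p) ^ 2) ps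
  + lsum (fun p => 2 * (f p * w p) * ln (INR p)) ps ^ 2 <= eps / 2 * m0 ^ 2.

Definition fst1 (p : nat) (z : Z) : R := if Z.eq_dec z 0 then 1 else f p.

Definition fstate (s : list (nat * Z)) : R := lprod (fun x => fst1 (fst x) (snd x)) s.

Definition ell (s : list (nat * Z)) : R := lsum (fun x => IZR (snd x) * ln (INR (fst x))) s.

Definition scost (s : list (nat * Z)) : R :=
  lsum (fun x => if Z.eq_dec (snd x) 0 then 0 else cost (fst x)) s.

Definition wt (x : nat * letter) : R :=
  fst1 (fst x) (fst (snd x)) * fst1 (fst x) (snd (snd x)) * w (fst x) ^ gap (snd x).

Definition lngap (x : nat * letter) : R := INR (gap (snd x)) * ln (INR (fst x)).

Definition resonator : list (list (nat * Z)) :=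
  filter (fun s => Rleb (scost s) B && Rleb (Rabs (ell s)) (2 * m0))%bool (words ps states).

(** Only the source and the quotient are constrained. As [cost p <= ln p], passing to the target
    raises the cost by at most the logarithm of the quotient, and the frequency by exactly that
    amount; so both ends lie in [resonator], whose frequency bound is [2 * m0] for this reason. *)
Definition edges : list (list (nat * letter)) :=
  filter (fun c => Rleb (scost (src c) + lsum lngap c) B && Rleb (lsum lngap c) m0
                   && Rleb (Rabs (ell (src c))) m0)%bool (words ps letters).

Lemma prime_ge_2 p : In p ps -> 2 <= INR p.
Proof.
intros Hp; apply prime_ps, prime.prime_gt1 in Hp.
apply (ssrbool.elimT ssrnat.ltP), le_INR in Hp; simpl in Hp; lra.
Qed.

Lemma ln_prime_ge_0 p : In p ps -> 0 <= ln (INR p).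
Proof. intros Hp; apply ln_ge_0; assert (H := prime_ge_2 p Hp); lra. Qed.

Lemma fst1_ge_0 p z : 0 <= fst1 p z.
Proof. unfold fst1; destruct (Z.eq_dec z 0); [lra | apply Rlt_le, f_gt_0]. Qed.

Lemma w_range p : In p ps -> 0 < w p <= 1.
Proof.
intros Hp; split; [apply exp_pos | ].
assert (H := prime_ge_2 p Hp).
apply Rle_trans with (Rpower (INR p) 0); [apply Rle_Rpower; lra | ].
rewrite Rpower_O; lra.
Qed.

Lemma wt_ge_0 x : 0 <= wt x.
Proof.
unfold wt; apply Rmult_le_pos; [apply Rmult_le_pos; apply fst1_ge_0 | ].
apply pow_le, Rlt_le, exp_pos.
Qed.

Lemma words_prime c : In c (words ps letters) -> forall x, In x c -> In (fst x) ps.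
Proof. rewrite in_words; intros [<- _] x Hx; apply in_map, Hx. Qed.

Lemma quot_pos c : In c (words ps letters) -> (1 <= quot c)%nat.
Proof.
intros Hc; apply (ssrbool.elimT ssrnat.ltP), QuotPrimes.quot_gt0.
intros x Hx; apply prime_ps, (words_prime c Hc), Hx.
Qed.

Lemma ln_quot c : In c (words ps letters) -> ln (INR (quot c)) = lsum lngap c.
Proof.
intros Hc; assert (Hp := words_prime c Hc); clear Hc.
induction c as [ | [p l] c IH]; [apply ln_1 | ].
assert (Hp0 : 0 < INR p)
  by (assert (H := prime_ge_2 p (Hp (p, l) (or_introl eq_refl))); lra).
simpl quot; rewrite mult_INR, pow_INR, ln_mult, ln_pow.
- rewrite IH; [reflexivity | intros x Hx; apply Hp; right; exact Hx].
- exact Hp0.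
- apply pow_lt, Hp0.
- apply lt_0_INR, (ssrbool.elimT ssrnat.ltP), QuotPrimes.quot_gt0.
  intros x Hx; apply prime_ps, Hp; right; exact Hx.
Qed.

Lemma lprod_wt c : In c (words ps letters) ->
  lprod wt c = Rpower (INR (quot c)) (- sigma) * (fstate (tgt c) * fstate (src c)).
Proof.
intros Hc; unfold Rpower; rewrite ln_quot by exact Hc.
clear Hc.
induction c as [ | [p l] c IH].
- simpl; rewrite Rmult_0_r, exp_0; unfold fstate; simpl; ring.
- simpl lprod; rewrite IH by (intros x Hx; apply Hp; right; exact Hx).
  simpl lsum; rewrite Rmult_plus_distr_l, exp_plus.
  unfold fstate; simpl; unfold wt at 1; simpl.
  replace (exp (- sigma * lngap (p, l))) with (w p ^ gap l); [ring | ].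
  unfold w, lngap; simpl; rewrite <- Rpower_pow by apply exp_pos.
  rewrite Rpower_mult; unfold Rpower; f_equal; ring.
Qed.

Lemma ell_tgt c : In c (words ps letters) ->
  ell (tgt c) - ell (src c) = lsum lngap c.
Proof.
intros Hc; apply in_words in Hc; destruct Hc as [_ Hc].
induction c as [ | [p l] c IH]; [unfold ell; simpl; ring | ].
unfold ell in *; simpl; rewrite <- IH by (intros x Hx; apply Hc; right; exact Hx).
unfold lngap; simpl.
assert (Hl := letters_gap l (Hc (p, l) (or_introl eq_refl))).
rewrite Hl, plus_IZR, <- INR_IZR_INZ; ring.
Qed.

Lemma scost_tgt c : In c (words ps letters) ->
  scost (tgt c) <= scost (src c) + lsum lngap c.
Proof.
intros Hc; assert (Hp := words_prime c Hc); apply in_words in Hc; destruct Hc as [_ Hc].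
induction c as [ | [p l] c IH]; [unfold scost; simpl; lra | ].
assert (IH' : scost (tgt c) <= scost (src c) + lsum lngap c).
{ apply IH; intros x Hx; [apply Hc | apply Hp]; right; exact Hx. }
unfold scost in *; simpl.
assert (Hpp := Hp (p, l) (or_introl eq_refl)); simpl in Hpp.
assert (Hl := Hc (p, l) (or_introl eq_refl)); simpl in Hl.
enough ((if Z.eq_dec (snd l) 0 then 0 else cost p) <=
  (if Z.eq_dec (fst l) 0 then 0 else cost p) + lngap (p, l)) by lra.
assert (H1 := cost_ln p Hpp); assert (H2 := cost_ge_0 p).
unfold lngap; destruct l as [z z']; simpl in *.
repeat (destruct Hl as [Hl | Hl]; [injection Hl as <- <-; simpl; lra | ]); contradiction.
Qed.

Lemma lsum_letters (F : letter -> R) :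
  lsum F letters = F (0, 0)%Z + F (1, 1)%Z + F (-1, -1)%Z + F (-1, 0)%Z + F (0, 1)%Z
    + F (-1, 1)%Z.
Proof. unfold letters; simpl; ring. Qed.

Let tau p := lsum (fun l => wt (p, l)) letters.

Lemma tau_eq p : tau p = 1 + 2 * f p ^ 2 + 2 * (f p * w p) + (f p * w p) ^ 2.
Proof. unfold tau; rewrite lsum_letters; unfold wt, fst1, gap; simpl; ring. Qed.

Lemma gain_range p : In p ps -> 0 <= (f p * w p) ^ 2 <= f p * w p.
Proof.
intros Hp; assert (H0 := f_gt_0 p); assert (H1 := f_le_1 p Hp); assert (H2 := w_range p Hp).
assert (0 <= f p * w p <= 1) by nra; nra.
Qed.

(** As [tau p >= 1], a bound for an unnormalized sum over letters also serves as a bound for the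
    mean. *)
Lemma le_scal_tau p x : In p ps -> 0 <= x -> x <= x * tau p.
Proof.
intros Hp Hx; rewrite tau_eq; assert (H := gain_range p Hp).
assert (0 <= f p ^ 2) by apply pow2_ge_0; nra.
Qed.

(* Markov's inequality for the three quantities which are truncated in [edges]. *)
Lemma edges_mass :
  eps * lsum (lprod wt) (words ps letters) <= lsum (lprod wt) edges.
Proof.
set (Tot := lsum (lprod wt) (words ps letters)).
assert (HT : 0 <= Tot) by apply words_total_ge_0, wt_ge_0.
set (g1 := fun x : nat * letter =>
  (if Z.eq_dec (fst (snd x)) 0 then 0 else cost (fst x)) + lngap x).
set (g3 := fun x : nat * letter => IZR (fst (snd x)) * ln (INR (fst x))).
assert (G1 : forall c, scost (src c) + lsum lngap c = lsum g1 c).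
{ intros c; unfold g1; rewrite lsum_plus; f_equal.
  unfold scost, src; rewrite lsum_map; reflexivity. }
assert (G3 : forall c, ell (src c) = lsum g3 c) by (intros c; unfold ell, src; rewrite lsum_map; reflexivity).
assert (M1 : lsum (fun c => lprod wt c * lsum g1 c) (words ps letters)
             <= B * (1 - 2 * eps) * Tot).
{ eapply Rle_trans; [apply (words_mean letters wt wt_ge_0 g1 (fun p =>
    cost p * (2 * f p ^ 2 + 2 * (f p * w p)) + 4 * (f p * w p) * ln (INR p))) | ].
  2: apply Rmult_le_compat_r; [exact HT | exact mean_cost].
  intros p Hp; assert (H1 := gain_range p Hp); assert (H2 := cost_ge_0 p);
    assert (H3 := ln_prime_ge_0 p Hp); assert (H4 := pow2_ge_0 (f p)).
    eapply Rle_trans; [ | apply le_scal_tau; [exact Hp | ]].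
  - rewrite lsum_letters; unfold g1, wt, fst1, gap, lngap; simpl.
    set (F := f p) in *; set (W := w p) in *; set (L := ln (INR p)) in *.
    assert (K1 : cost p * (F * W) ^ 2 <= cost p * (F * W)) by (apply Rmult_le_compat_l; lra).
    assert (K2 : L * (F * W) ^ 2 <= L * (F * W)) by (apply Rmult_le_compat_l; lra).
    nra.
  - assert (H8 := w_range p Hp); assert (H9 := f_gt_0 p);
    apply Rplus_le_le_0_compat; repeat apply Rmult_le_pos; lra. }
assert (M2 : lsum (fun c => lprod wt c * lsum lngap c) (words ps letters)
             <= eps / 2 * m0 * Tot).
{ eapply Rle_trans; [apply (words_mean letters wt wt_ge_0 lngap (fun p =>
    4 * (f p * w p) * ln (INR p))) | ].
  2: apply Rmult_le_compat_r; [exact HT | exact mean_quot].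
  intros p Hp; assert (H1 := gain_range p Hp); assert (H3 := ln_prime_ge_0 p Hp).
    eapply Rle_trans; [ | apply le_scal_tau; [exact Hp | ]].
  - rewrite lsum_letters; unfold wt, fst1, gap, lngap; simpl.
    set (F := f p) in *; set (W := w p) in *; set (L := ln (INR p)) in *.
    assert (K2 : L * (F * W) ^ 2 <= L * (F * W)) by (apply Rmult_le_compat_l; lra).
    nra.
  - assert (H8 := w_range p Hp); assert (H9 := f_gt_0 p);
    repeat apply Rmult_le_pos; lra. }
assert (M3 : lsum (fun c => lprod wt c * lsum g3 c ^ 2) (words ps letters)
             <= eps / 2 * m0 ^ 2 * Tot).
{ eapply Rle_trans; [apply (words_second_moment letters wt wt_ge_0 g3
    (fun p => (2 * f p ^ 2 + 2 * (f p * w p)) * ln (INR p) ^ 2)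
    (fun p => 2 * (f p * w p) * ln (INR p))) | ].
  4: apply Rmult_le_compat_r; [exact HT | exact mean_sq].
  - intros p Hp; assert (H1 := gain_range p Hp); assert (H3 := pow2_ge_0 (ln (INR p)));
      assert (H4 := pow2_ge_0 (f p)).
    eapply Rle_trans; [ | apply le_scal_tau; [exact Hp | ]].
    + rewrite lsum_letters; unfold g3, wt, fst1, gap; simpl.
      set (F := f p) in *; set (W := w p) in *; set (L := ln (INR p)) in *.
      assert (K2 : L ^ 2 * (F * W) ^ 2 <= L ^ 2 * (F * W)) by (apply Rmult_le_compat_l; lra).
      nra.
    + apply Rmult_le_pos; lra.
  - intros p Hp; assert (H1 := gain_range p Hp); assert (H3 := ln_prime_ge_0 p Hp).
    eapply Rle_trans; [ | apply le_scal_tau; [exact Hp | ]].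
    + rewrite lsum_letters; unfold g3, wt, fst1, gap; simpl.
      set (F := f p) in *; set (W := w p) in *; set (L := ln (INR p)) in *.
      assert (K2 : L * (F * W) ^ 2 <= L * (F * W)) by (apply Rmult_le_compat_l; lra).
      assert (K3 : 0 <= L * (F * W) ^ 2) by (apply Rmult_le_pos; lra).
      assert (K4 : 0 <= L * (F * W)) by (apply Rmult_le_pos; lra).
      apply Rabs_le; split; nra.
    + assert (H8 := w_range p Hp); assert (H9 := f_gt_0 p);
    repeat apply Rmult_le_pos; lra.
  - intros p Hp; assert (H3 := ln_prime_ge_0 p Hp).
    assert (H8 := w_range p Hp); assert (H9 := f_gt_0 p);
    repeat apply Rmult_le_pos; lra. }
(* The three exceptional proportions are at most 1 - 2 eps, eps/2 and eps/2. The frequency is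
   signed, which is why it is treated through its square. *)
assert (K : Tot - (1 - eps) * Tot <= lsum (lprod wt) edges); [ | lra].
apply Rle_trans with (Tot - lsum (fun c => lprod wt c *
  (/ B * lsum g1 c + / m0 * lsum lngap c + / m0 ^ 2 * lsum g3 c ^ 2)) (words ps letters)).
- rewrite (lsum_ext (fun c => lprod wt c * _) (fun c =>
    / B * (lprod wt c * lsum g1 c) + / m0 * (lprod wt c * lsum lngap c)
    + / m0 ^ 2 * (lprod wt c * lsum g3 c ^ 2))) by (intros; ring).
  rewrite !lsum_plus, !lsum_scal.
  apply (Rmult_le_compat_l (/ B)) in M1; [ | apply Rlt_le, Rinv_0_lt_compat, B_gt_0].
  apply (Rmult_le_compat_l (/ m0)) in M2; [ | apply Rlt_le, Rinv_0_lt_compat, m0_gt_0].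
  apply (Rmult_le_compat_l (/ m0 ^ 2)) in M3;
    [ | apply Rlt_le, Rinv_0_lt_compat, pow_lt, m0_gt_0].
  replace (/ B * (B * (1 - 2 * eps) * Tot)) with ((1 - 2 * eps) * Tot) in M1 by (field; lra).
  replace (/ m0 * (eps / 2 * m0 * Tot)) with (eps / 2 * Tot) in M2 by (field; lra).
  replace (/ m0 ^ 2 * (eps / 2 * m0 ^ 2 * Tot)) with (eps / 2 * Tot) in M3 by (field; lra).
  lra.
- unfold edges, Tot; rewrite lsum_filter.
  unfold Rminus; rewrite <- lsum_opp, <- lsum_plus; apply lsum_le; intros c Hc.
  assert (H0 := lprod_wt_ge_0 wt wt_ge_0 c).
  assert (Hg2 : 0 <= lsum lngap c).
  { rewrite <- ln_quot by exact Hc; apply ln_ge_0.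
    apply (le_INR 1), quot_pos, Hc. }
  assert (Hg1 : 0 <= lsum g1 c).
  { rewrite <- G1; apply Rplus_le_le_0_compat; [ | exact Hg2].
    apply lsum_ge_0; intros x _; destruct (Z.eq_dec (snd x) 0); [lra | apply cost_ge_0]. }
  assert (Hg3 := pow2_ge_0 (lsum g3 c)).
  assert (R1 : 0 <= / B * lsum g1 c)
    by (apply Rmult_le_pos; [apply Rlt_le, Rinv_0_lt_compat, B_gt_0 | exact Hg1]).
  assert (R2 : 0 <= / m0 * lsum lngap c)
    by (apply Rmult_le_pos; [apply Rlt_le, Rinv_0_lt_compat, m0_gt_0 | exact Hg2]).
  assert (R3 : 0 <= / m0 ^ 2 * lsum g3 c ^ 2)
    by (apply Rmult_le_pos; [apply Rlt_le, Rinv_0_lt_compat, pow_lt, m0_gt_0 | exact Hg3]).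
  set (S := / B * lsum g1 c + / m0 * lsum lngap c + / m0 ^ 2 * lsum g3 c ^ 2).
  assert (HS : 0 <= S) by (unfold S; lra).
  assert (HS1 : forall x y, 0 < y -> y < x -> 1 <= / y * x).
  { intros x y Hy Hxy; apply (Rmult_le_reg_l y); [exact Hy | ].
    rewrite <- Rmult_assoc, Rinv_r; lra. }
  rewrite G1, G3; unfold Rleb.
  destruct (Rle_dec (lsum g1 c) B) as [D1 | D1]; simpl.
  2:{ assert (H1 := HS1 _ _ B_gt_0 (Rnot_le_lt _ _ D1)); unfold S in *; nra. }
  destruct (Rle_dec (lsum lngap c) m0) as [D2 | D2]; simpl.
  2:{ assert (H1 := HS1 _ _ m0_gt_0 (Rnot_le_lt _ _ D2)); unfold S in *; nra. }
  destruct (Rle_dec (Rabs (lsum g3 c)) m0) as [D3 | D3].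
  + nra.
  + apply Rnot_le_lt in D3.
    assert (D4 : m0 ^ 2 < lsum g3 c ^ 2) by (rewrite <- (pow2_abs (lsum g3 c)); nra).
    assert (H1 := HS1 _ _ (pow_lt _ 2 m0_gt_0) D4); unfold S in *; nra.
Qed.

Lemma resonator_norm_le :
  lsum (fun s => fstate s ^ 2) resonator <= lprod (fun p => 1 + 2 * f p ^ 2) ps.
Proof.
apply Rle_trans with (lsum (fun s => fstate s ^ 2) (words ps states)).
- unfold resonator; rewrite lsum_filter; apply lsum_le; intros s _.
  assert (H := pow2_ge_0 (fstate s)); destruct (_ && _)%bool; lra.
- right; rewrite (lsum_ext _ (lprod (fun x => fst1 (fst x) (snd x) ^ 2))).
  + rewrite lsum_words_lprod; apply lprod_ext; intros p _.
    unfold states, fst1; simpl; ring.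
  + intros s _; unfold fstate; induction s as [ | x s IH]; simpl in *; [ring | ].
    rewrite <- IH; ring.
Qed.

(* Rankin's trick: each state of cost at most [B] has weight [exp (B - scost s) >= 1]. *)
Lemma resonator_card :
  INR (length resonator) <= exp (B + 2 * lsum (fun p => exp (- cost p)) ps).
Proof.
replace (INR (length resonator)) with (lsum (fun _ => 1) resonator)
  by (rewrite lsum_const; ring).
apply Rle_trans with (exp B * lsum (lprod (fun x : nat * Z =>
  exp (- (if Z.eq_dec (snd x) 0 then 0 else cost (fst x))))) (words ps states)).
- unfold resonator; rewrite lsum_filter, <- lsum_scal; apply lsum_le; intros s _.
  rewrite <- exp_lsum, <- exp_plus, lsum_opp.
  fold (scost s); unfold Rleb; destruct (Rle_dec (scost s) B) as [H | H]; simpl.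
  + assert (H1 := exp_ineq1_le (B + - scost s)).
    destruct (Rle_dec (Rabs (ell s)) (2 * m0)); lra.
  + apply Rlt_le, exp_pos.
- rewrite exp_plus; apply Rmult_le_compat_l; [apply Rlt_le, exp_pos | ].
  rewrite lsum_words_lprod, <- lsum_scal, exp_lsum; apply lprod_le; intros p _.
  unfold states; simpl; rewrite Ropp_0, exp_0.
  assert (H := exp_pos (- cost p)); assert (H1 := exp_ineq1_le (2 * exp (- cost p))).
  lra.
Qed.

(** The factor at p is at least 1 + 2f^2 + 2fw = (1 + 2f^2)(1 + x) with x = 2fw / (1 + 2f^2), and 1
    + x >= e^(x/(1 + x)). The two denominators 1 + 2f^2 and 1 + x are each at most 1 + rho. *)
Lemma edges_total_ge :
  exp (lsum (fun p => 2 * (f p * w p)) ps / (1 + rho) ^ 2)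
  * lprod (fun p => 1 + 2 * f p ^ 2) ps <= lsum (lprod wt) (words ps letters).
Proof.
rewrite lsum_words_lprod; unfold Rdiv; rewrite <- lsum_scal_r, exp_lsum, <- lprod_mult.
apply lprod_le; intros p Hp; fold (tau p); rewrite tau_eq.
assert (H1 := gain_range p Hp); assert (H4 := pow2_ge_0 (f p)).
assert (S1 := small_sq p Hp); assert (S2 := small_gain p Hp).
set (F := f p ^ 2) in *; set (u := f p * w p) in *.
split; [apply Rmult_le_pos; [apply Rlt_le, exp_pos | lra] | ].
set (x := 2 * u / (1 + 2 * F)).
assert (Hx0 : 0 <= x <= 2 * u).
{ unfold x; split; [apply Rmult_le_pos; [lra | apply Rlt_le, Rinv_0_lt_compat; lra] | ].
  apply Rle_div_l; [lra | nra]. }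
assert (Hx := one_plus_ge_exp x ltac:(lra)).
assert (Hle : 2 * u * / (1 + rho) ^ 2 <= x / (1 + x)).
{ apply (Rmult_le_reg_r ((1 + rho) ^ 2 * (1 + x) * (1 + 2 * F))).
  { repeat apply Rmult_lt_0_compat; try lra; apply pow_lt; lra. }
  replace (2 * u * / (1 + rho) ^ 2 * ((1 + rho) ^ 2 * (1 + x) * (1 + 2 * F)))
    with (2 * u * ((1 + x) * (1 + 2 * F))) by (field; lra).
  replace (x / (1 + x) * ((1 + rho) ^ 2 * (1 + x) * (1 + 2 * F)))
    with (2 * u * ((1 + rho) * (1 + rho)))
    by (unfold x; field; repeat split; try lra; unfold x in Hx0; lra).
  apply Rmult_le_compat_l; [lra | apply Rmult_le_compat; lra]. }
apply Rle_trans with ((1 + x) * (1 + 2 * F)).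
- apply Rmult_le_compat_r; [lra | ].
  eapply Rle_trans; [apply exp_mono, Hle | exact Hx].
- replace ((1 + x) * (1 + 2 * F)) with (1 + 2 * F + 2 * u) by (unfold x; field; lra).
  nra.
Qed.

Theorem resonator_bound (Y T : R) :
  1 <= Y -> 2 * Y <= T -> m0 <= ln T ->
  exp (B + 2 * lsum (fun p => exp (- cost p)) ps) * exp (4 * m0) * Y * 100000000000 <= T ->
  1 <= eps * exp (lsum (fun p => 2 * (f p * w p)) ps / (1 + rho) ^ 2) ->
  exists t, Y <= t <= T /\
    eps * exp (lsum (fun p => 2 * (f p * w p)) ps / (1 + rho) ^ 2) <= 50 * zeta_re sigma t.
Proof.
intros HY HT HmT Hcard Hgain.
set (gain := exp (lsum (fun p => 2 * (f p * w p)) ps / (1 + rho) ^ 2)) in *.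
set (Sf := lsum (fun s => fstate s ^ 2) resonator).
set (Main := lsum (fun e => Rpower (INR (quot e)) (- sigma) * (fstate (tgt e) * fstate (src e)))
               edges).
assert (HE : forall e, In e edges -> In e (words ps letters) /\
  scost (src e) + lsum lngap e <= B /\ lsum lngap e <= m0 /\ Rabs (ell (src e)) <= m0).
{ intros e He; apply filter_In in He; destruct He as [He1 He2].
  apply Bool.andb_true_iff in He2; destruct He2 as [He2 He4].
  apply Bool.andb_true_iff in He2; destruct He2 as [He2 He3].
  apply Rleb_true in He2, He3, He4; auto. }
assert (HM : forall e, In e edges -> In (src e) resonator /\ In (tgt e) resonator).
{ intros e He; destruct (HE e He) as [H1 [H2 [H3 H4]]].
  assert (H0 := ln_quot e H1).
  assert (H5 : 0 <= lsum lngap e)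
    by (rewrite <- H0; apply ln_ge_0, (le_INR 1), quot_pos, H1).
  assert (H6 := ell_tgt e H1); assert (H7 := scost_tgt e H1).
  apply Rabs_le_between in H4.
  split; apply filter_In; (split; [apply src_in, H1 || apply tgt_in, H1 | ]);
    apply Bool.andb_true_iff; split; apply Rleb_true; try apply Rabs_le; lra. }
assert (HSM : eps * gain * Sf <= Main).
{ apply Rle_trans with (lsum (lprod wt) edges).
  - eapply Rle_trans; [ | apply edges_mass].
    rewrite Rmult_assoc; apply Rmult_le_compat_l; [lra | ].
    eapply Rle_trans; [ | apply edges_total_ge].
    apply Rmult_le_compat_l; [apply Rlt_le, exp_pos | apply resonator_norm_le].
  - right; apply lsum_ext; intros e He; apply lprod_wt, HE, He. }
(* The state of the rational number 1 survives the truncation; it makes the norm [Sf] positive. *)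
assert (Hzero : In (map (fun p => (p, 0%Z)) ps) resonator).
{ assert (E1 : scost (map (fun p => (p, 0%Z)) ps) = 0)
    by (unfold scost; rewrite lsum_map; apply lsum_0).
  assert (E2 : ell (map (fun p => (p, 0%Z)) ps) = 0).
  { unfold ell; rewrite lsum_map; simpl.
    rewrite (lsum_ext _ (fun _ => 0)) by (intros; ring); apply lsum_0. }
  apply filter_In; split.
  - apply in_words; split; [rewrite map_map; apply map_id | ].
    intros x Hx; apply in_map_iff in Hx; destruct Hx as [p [<- _]]; left; reflexivity.
  - rewrite E1, E2, Rabs_R0; apply Bool.andb_true_iff; split; apply Rleb_true; lra. }
assert (HSf : 0 < Sf).
{ apply in_split in Hzero; destruct Hzero as [l1 [l2 E0]].
  unfold Sf; rewrite E0, lsum_app; simpl.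
  assert (E1 : fstate (map (fun p => (p, 0%Z)) ps) = 1).
  { unfold fstate; clear; induction ps as [ | p l IH]; simpl; [reflexivity | ].
    rewrite IH; unfold fst1; simpl; ring. }
  rewrite E1; assert (H1 := lsum_ge_0 (fun s => fstate s * (fstate s * 1)) l1).
  assert (H2 := lsum_ge_0 (fun s => fstate s * (fstate s * 1)) l2).
  assert (forall s, 0 <= fstate s * (fstate s * 1)).
  { intros s; assert (H := pow2_ge_0 (fstate s)); simpl in H; exact H. }
  assert (H1' := H1 (fun s _ => H s)); assert (H2' := H2 (fun s _ => H s)); lra. }
assert (Hres : exists t, Y <= t <= T /\ Main <= 50 * Sf * zeta_re sigma t).
{ apply (@resonance _ _ resonator fstate ell T) with (src := src) (tgt := tgt) (kk := quot)
    (E := edges) (l0 := 2 * m0).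
- intros s; apply lprod_ge_0; intros x _; apply fst1_ge_0.
- lra.
- apply NoDup_filter, NoDup_words; repeat constructor; simpl; intuition discriminate.
- apply HM.
- apply HM.
- intros e He; apply quot_pos, HE, He.
- intros e He; destruct (HE e He) as [H1 _].
  rewrite ln_quot, ell_tgt by exact H1; reflexivity.
- intros e e' He He' Hq Hs; apply (QuotPrimes.quot_inj ps); auto; apply HE; assumption.
- intros e e' He He' Hq Hs; apply (QuotPrimes.quot_inj ps); auto; apply HE; assumption.
- exact sigma_range.
- exact HY.
- exact HT.
- lra.
- intros s Hs; apply filter_In in Hs; destruct Hs as [_ Hs].
  apply Bool.andb_true_iff in Hs; destruct Hs as [_ Hs]; apply Rleb_true, Hs.
- intros e He; destruct (HE e He) as [H1 [_ [H3 _]]].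
  assert (Hq : 0 < INR (quot e)) by (apply lt_0_INR, quot_pos, H1).
  rewrite <- (exp_ln (INR (quot e))), <- (exp_ln T) by lra.
  apply exp_mono; rewrite ln_quot by exact H1; lra.
- replace (2 * (2 * m0)) with (4 * m0) by ring.
  eapply Rle_trans; [ | exact Hcard].
  repeat (apply Rmult_le_compat_r; [try apply Rlt_le, exp_pos; lra | ]).
  apply resonator_card.
- exact HSf.
- fold Sf Main; eapply Rle_trans; [ | exact HSM].
  rewrite <- (Rmult_1_l Sf) at 1; apply Rmult_le_compat_r; lra. }
destruct Hres as [t [Ht Hz]]; exists t; split; [exact Ht | ].
  apply (Rmult_le_reg_r Sf); [exact HSf | ].
  eapply Rle_trans; [exact HSM | ].
  replace (50 * zeta_re sigma t * Sf) with (50 * Sf * zeta_re sigma t) by ring; exact Hz.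
Qed.

End Resonator.

(** * Choice of the primes and of the weights *)

Section Blocks.
Variables (X b : R).
Hypothesis X_ge_1 : 1 <= X.
Hypothesis b_gt_0 : 0 < b.

Definition block_primes (J : nat) : list nat :=
  primes_in (X * exp b) (X * exp (INR J * b)).

Lemma in_scaled_primes (x y : R) p : 0 <= x ->
  In p (primes_in (X * exp x) (X * exp y)) ->
  prime.prime p = true /\ 1 <= INR p /\ x < ln (INR p / X) <= y.
Proof.
intros Hx Hp; apply in_primes_in in Hp.
2:{ apply Rmult_le_pos; [lra | apply Rlt_le, exp_pos]. }
destruct Hp as [Hp [H1 H2]]; split; [exact Hp | ].
assert (He : 1 <= exp x) by (assert (H := exp_ineq1_le x); lra).
assert (Hp1 : 1 <= INR p) by nra.
assert (HX : 0 < / X) by (apply Rinv_0_lt_compat; lra).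
assert (E : forall z, X * exp z / X = exp z) by (intros; field; lra).
split; [exact Hp1 | split].
- rewrite <- (ln_exp x), <- E; apply ln_increasing; [rewrite E; apply exp_pos | ].
  apply Rmult_lt_compat_r; assumption.
- rewrite <- (ln_exp y), <- E; apply ln_le; [apply Rdiv_lt_0_compat; lra | ].
  apply Rmult_le_compat_r; lra.
Qed.

Lemma in_block_primes (J : nat) p : In p (block_primes J) ->
  prime.prime p = true /\ 1 <= INR p /\ b < ln (INR p / X) <= INR J * b.
Proof. apply in_scaled_primes; lra. Qed.

Lemma block_primes_S (F : nat -> R) (J : nat) : (1 <= J)%nat ->
  lsum F (block_primes (S J)) = lsum F (block_primes J) +
    lsum F (primes_in (X * exp (INR J * b)) (X * exp (INR (S J) * b))).
Proof.
intros HJ; apply (le_INR 1) in HJ; simpl in HJ.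
apply primes_in_split.
- apply Rmult_le_pos; [lra | apply Rlt_le, exp_pos].
- rewrite S_INR; split; apply Rmult_le_compat_l; try lra; apply exp_mono; nra.
Qed.

Lemma block_primes_1 : block_primes 1 = [].
Proof.
unfold block_primes; simpl INR; rewrite Rmult_1_l.
destruct (primes_in _ _) as [ | p l] eqn:E; [reflexivity | exfalso].
assert (Hp : In p (primes_in (X * exp b) (X * exp b))) by (rewrite E; left; reflexivity).
apply in_primes_in in Hp; [lra | ].
apply Rmult_le_pos; [lra | apply Rlt_le, exp_pos].
Qed.

Lemma in_last_block (J : nat) p :
  In p (primes_in (X * exp (INR J * b)) (X * exp (INR (S J) * b))) ->
  1 <= INR p /\ INR J * b < ln (INR p / X) <= (INR J + 1) * b.
Proof.
rewrite S_INR; intros Hp; apply in_scaled_primes in Hp; [tauto | ].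
apply Rmult_le_pos; [apply pos_INR | lra].
Qed.

Lemma last_block_mass (J : nat) :
  b - 13 <= lsum (fun p => ln (INR p) / INR p)
    (primes_in (X * exp (INR J * b)) (X * exp (INR (S J) * b))) <= b + 13.
Proof.
assert (HJ := pos_INR J).
assert (He : 1 <= exp (INR J * b)).
{ assert (H := exp_ineq1_le (INR J * b)); assert (0 <= INR J * b) by (apply Rmult_le_pos; lra); lra. }
assert (H := mertens_interval (X * exp (INR J * b)) (X * exp (INR (S J) * b))).
rewrite !ln_mult, !ln_exp in H by (lra || apply exp_pos).
rewrite S_INR in *.
assert (H0 : 1 <= X * exp (INR J * b) <= X * exp ((INR J + 1) * b)).
{ split; [nra | apply Rmult_le_compat_l; [lra | apply exp_mono; nra]]. }
specialize (H H0); lra.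
Qed.

Lemma ln_mass_ge_0 (J : nat) p :
  In p (primes_in (X * exp (INR J * b)) (X * exp (INR (S J) * b))) ->
  0 <= ln (INR p) / INR p.
Proof.
intros Hp; apply in_last_block in Hp; destruct Hp as [H1 _].
apply Rmult_le_pos; [apply ln_ge_0, H1 | apply Rlt_le, Rinv_0_lt_compat; lra].
Qed.

(** The block from jb to (j + 1)b has mass at least (1 - eps) b and its denominators are at most (j
    + 1)b, so it contributes (1 - eps)/(j + 1). The resulting harmonic sum is the origin of the
    logarithm of sigma - 1/2. *)
Lemma weighted_mass_ge (eps : R) (J : nat) : 13 <= eps * b -> eps <= 1 -> (1 <= J)%nat ->
  (1 - eps) * (ln (INR J + 1) - ln 2) <=
  lsum (fun p => ln (INR p) / INR p / ln (INR p / X)) (block_primes J).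
Proof.
intros Hb Heps HJ; induction HJ as [ | J HJ IH].
- simpl INR; replace (1 + 1) with 2 by ring; rewrite block_primes_1; simpl; lra.
- rewrite block_primes_S by exact HJ.
  assert (HJ1 : 1 <= INR J) by (apply (le_INR 1) in HJ; exact HJ).
  assert (H1 : (1 - eps) / (INR J + 1) <= lsum (fun p => ln (INR p) / INR p / ln (INR p / X))
    (primes_in (X * exp (INR J * b)) (X * exp (INR (S J) * b)))).
  { apply Rle_trans with (lsum (fun p => ln (INR p) / INR p)
      (primes_in (X * exp (INR J * b)) (X * exp (INR (S J) * b))) * / ((INR J + 1) * b)).
    - destruct (last_block_mass J) as [H _].
      assert (Hp : 0 < (INR J + 1) * b) by (apply Rmult_lt_0_compat; lra).
      apply (Rmult_le_reg_r ((INR J + 1) * b)); [exact Hp | ].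
      rewrite Rmult_assoc, Rinv_l by lra.
      replace ((1 - eps) / (INR J + 1) * ((INR J + 1) * b)) with (b - eps * b) by (field; lra).
      lra.
    - rewrite <- lsum_scal_r; apply lsum_le; intros p Hp.
      apply Rmult_le_compat_l; [apply (ln_mass_ge_0 J), Hp | ].
      apply in_last_block in Hp; destruct Hp as [_ [H2 H3]].
      apply Rinv_le_contravar; [ | exact H3].
      assert (0 < INR J * b) by (apply Rmult_lt_0_compat; lra); lra. }
  assert (H2 : ln (INR J + 1 + 1) - ln (INR J + 1) <= / (INR J + 1)).
  { rewrite <- ln_div by lra.
    replace ((INR J + 1 + 1) / (INR J + 1)) with (1 + / (INR J + 1)) by (field; lra).
    assert (H := exp_ineq1_le (/ (INR J + 1))).
    assert (0 < / (INR J + 1)) by (apply Rinv_0_lt_compat; lra).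
    apply Rle_trans with (ln (exp (/ (INR J + 1)))); [apply ln_le; lra | rewrite ln_exp; lra]. }
  set (last := lsum _ (primes_in _ _)) in *.
  rewrite S_INR; apply (Rmult_le_compat_l (1 - eps)) in H2; [ | lra].
  unfold Rdiv in H1 at 1; lra.
Qed.

(** The block starting at jb contributes at most (b + 13) r^j with r = e^(-qb) <= 1/2, and the
    geometric series is at most 2r. *)
Lemma decay_mass_le (q : R) (J : nat) : 0 < q -> exp (- (q * b)) <= / 2 ->
  lsum (fun p => ln (INR p) / INR p * exp (- (q * ln (INR p / X)))) (block_primes J)
  <= 2 * (b + 13) * exp (- (q * b)).
Proof.
intros Hq Hqb; set (r := exp (- (q * b))) in *.
assert (Hr : 0 < r) by apply exp_pos.
assert (HrJ : forall J, exp (- (q * (INR J * b))) = r ^ J).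
{ intros n; induction n as [ | n IH]; [simpl; rewrite Rmult_0_l, Rmult_0_r, Ropp_0; apply exp_0 | ].
  rewrite S_INR; simpl; rewrite <- IH; unfold r; rewrite <- exp_plus; f_equal; ring. }
assert (K : (1 <= J)%nat ->
  lsum (fun p => ln (INR p) / INR p * exp (- (q * ln (INR p / X)))) (block_primes J)
  <= 2 * (b + 13) * (r - r ^ J)).
{ intros HJ; induction HJ as [ | J HJ IH].
  - rewrite block_primes_1; simpl; lra.
  - rewrite block_primes_S by exact HJ.
    assert (H1 : lsum (fun p => ln (INR p) / INR p * exp (- (q * ln (INR p / X))))
       (primes_in (X * exp (INR J * b)) (X * exp (INR (S J) * b))) <= (b + 13) * r ^ J).
    { eapply Rle_trans; [ | apply Rmult_le_compat_r;
        [apply pow_le; lra | apply (proj2 (last_block_mass J))]].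
      rewrite <- lsum_scal_r; apply lsum_le; intros p Hp.
      apply Rmult_le_compat_l; [apply (ln_mass_ge_0 J), Hp | ].
      rewrite <- HrJ; apply exp_mono.
      apply in_last_block in Hp; nra. }
    assert (H2 : r ^ S J <= r ^ J / 2).
    { simpl; assert (0 < r ^ J) by (apply pow_lt, Hr); nra. }
    assert (H3 : (b + 13) * r ^ J <= 2 * (b + 13) * (r ^ J - r ^ S J)) by nra.
    lra. }
assert (H0 : 0 < b + 13) by lra.
destruct J as [ | J].
- replace (block_primes 0) with (@nil nat).
  { simpl; apply Rmult_le_pos; lra. }
  symmetry; unfold block_primes; simpl INR; rewrite Rmult_0_l.
  destruct (primes_in _ _) as [ | p l] eqn:E; [reflexivity | exfalso].
  assert (Hp : In p (primes_in (X * exp b) (X * exp 0))) by (rewrite E; left; reflexivity).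
  rewrite exp_0 in Hp; apply in_primes_in in Hp; [ | lra].
  assert (H := exp_ineq1_le b); nra.
- eapply Rle_trans; [apply K; lia | ].
  assert (0 < r ^ S J) by (apply pow_lt, Hr); nra.
Qed.

End Blocks.

Lemma primes_in_inv_sqrt (x y : R) : 0 <= x <= y ->
  lsum (fun p => / sqrt (INR p)) (primes_in x y) <= 2 * sqrt y.
Proof.
intros Hxy; assert (Hf := nat_floor_spec y ltac:(lra)).
apply Rle_trans with (lsum (fun p => / sqrt (INR p)) (seq 1 (nat_floor y))).
- apply lsum_incl; [apply NoDup_primes_in | | ].
  + intros p Hp; apply filter_In in Hp; destruct Hp as [Hp _].
    apply filter_In in Hp; apply Hp.
  + intros p Hp; apply in_seq in Hp; apply Rlt_le, Rinv_0_lt_compat, sqrt_lt_R0, lt_0_INR; lia.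
- eapply Rle_trans; [apply sum_inv_sqrt | ].
  apply Rmult_le_compat_l; [lra | apply sqrt_le_1_alt; lra].
Qed.

(** * Optimal coefficients, budgets and the resulting gain *)

Section Choice.
Variables (eps b1 b theta D : R) (J : nat).

Let L := ln D.
Let X := D * L.
Let sigma := 1 / 2 + theta.
(** A unit in which error terms become powers: D = u^40 and L <= u^2, so that a quantity of size
    D^(1/2) up to such factors is visibly smaller than D. *)
Let u := Rpower D (/ 40).
Let w p := Rpower (INR p) (- sigma).
Let Xt := Rpower X (- (2 * theta)).

Hypothesis eps_range : 0 < eps <= 1 / 100.
Hypothesis b1_range : 0 < b1 < 1.
Hypothesis b_ge_13 : 13 <= eps * b.
Hypothesis b_decay : exp (- b) <= eps / 4.
Hypothesis b_decay_half : exp (- (eps * b)) <= / 2.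
Hypothesis b_decay_card : 2 * (b + 13) * exp (- (eps * b)) <= eps * b1 / 2.
Hypothesis theta_range : 0 < theta <= 1 / 100.
Hypothesis theta_L : 1 <= theta * L.
Hypothesis theta_b1 : 1 - eps <= Rpower b1 (2 * theta).
Hypothesis theta_ln : (ln (b / eps) + 2) / eps <= ln (/ theta).
Hypothesis J_range : INR J * b <= eps / theta < (INR J + 1) * b.
Hypothesis ln_L_le : ln L <= eps * L.
Hypothesis u_L : L <= u ^ 2.
Hypothesis u_large : 400 / (eps ^ 3 * b1 ^ 2) + 100000000000 / (eps * b1) <= u.

Lemma w_gt_0 p : 0 < w p.
Proof. apply exp_pos. Qed.

Lemma Xt_gt_0 : 0 < Xt.
Proof. apply exp_pos. Qed.

Lemma b_gt_0 : 0 < b.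
Proof. nra. Qed.

Lemma L_ge_100 : 100 <= L.
Proof. nra. Qed.

Lemma D_gt_0 : 0 < D.
Proof.
destruct (Rlt_dec 0 D) as [H | H]; [exact H | exfalso].
(* [ln] takes the value 0 outside the positive reals, so a large L already forces D > 0. *)
assert (HL := L_ge_100); unfold L, ln in HL.
destruct (Rlt_dec 0 D); [contradiction | lra].
Qed.

Lemma D_ge_1 : 1 <= D.
Proof.
destruct (Rle_dec 1 D) as [H | H]; [exact H | exfalso].
assert (HL := L_ge_100); assert (H0 := D_gt_0).
assert (ln D <= ln 1) by (apply ln_le; lra); rewrite ln_1 in *; unfold L in *; lra.
Qed.

Lemma X_ge_D : D <= X.
Proof. assert (H := L_ge_100); assert (H1 := D_ge_1); unfold X; nra. Qed.

Lemma X_ge_1 : 1 <= X.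
Proof. assert (H := X_ge_D); assert (H1 := D_ge_1); lra. Qed.

Lemma ln_X : ln X = L + ln L.
Proof.
unfold X; apply ln_mult; [apply D_gt_0 | assert (H := L_ge_100); lra].
Qed.

Lemma ln_L_ge_0 : 0 <= ln L.
Proof. apply ln_ge_0; assert (H := L_ge_100); lra. Qed.

(** Here sigma >= 1/2 + 1/log log T, in the form [1 <= theta * L], enters: the cutoff eps / theta is
    at most eps L, hence ln p differs from L by a factor 1 + O(eps) for all chosen primes. *)
Lemma Jb_le : INR J * b <= eps * L.
Proof.
destruct J_range as [H _]; eapply Rle_trans; [exact H | ].
apply Rle_div_l; [lra | nra].
Qed.

Lemma J_pos : (1 <= J)%nat.
Proof.
destruct (le_lt_dec 1 J) as [HJ | HJ]; [exact HJ | exfalso].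
destruct J_range as [_ H].
replace (INR J) with 0 in H by (replace J with 0%nat by lia; reflexivity).
assert (Ht : 0 < / theta) by (apply Rinv_0_lt_compat; lra).
assert (H1 : / theta <= b / eps).
{ apply (Rmult_le_reg_l eps); [lra | ].
  replace (eps * (b / eps)) with b by (field; lra); unfold Rdiv in H; lra. }
assert (H2 : ln (/ theta) <= ln (b / eps)) by (apply ln_le; assumption).
assert (H3 : ln (b / eps) + 2 <= eps * ln (/ theta)).
{ assert (T := theta_ln); apply (Rmult_le_compat_l eps) in T; [ | lra].
  replace (eps * ((ln (b / eps) + 2) / eps)) with (ln (b / eps) + 2) in T
    by (field; lra); exact T. }
assert (H4 : 0 <= ln (/ theta)).
{ apply ln_ge_0; apply (Rmult_le_reg_r theta); [lra | rewrite Rinv_l; lra]. }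
nra.
Qed.

Lemma ln_inv_theta : 2 * 100 <= ln (/ theta).
Proof.
assert (H : 0 <= ln (b / eps)).
{ apply ln_ge_0; apply Rle_div_r; [lra | nra]. }
eapply Rle_trans; [ | exact theta_ln].
apply (Rmult_le_reg_r eps); [lra | ].
replace ((ln (b / eps) + 2) / eps * eps) with (ln (b / eps) + 2) by (field; lra); lra.
Qed.

Let ps := block_primes X b J.

Lemma in_ps p : In p ps -> prime.prime p = true /\ X < INR p /\
  b < ln (INR p / X) <= INR J * b /\ ln (INR p) = ln X + ln (INR p / X).
Proof.
intros Hp; destruct (in_block_primes X b X_ge_1 b_gt_0 J p Hp) as [H1 [H2 [H3 H4]]].
assert (HX := X_ge_1).
assert (E : ln (INR p) = ln X + ln (INR p / X)).
{ rewrite ln_div by lra; ring. }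
repeat split; try assumption.
apply ln_lt_inv; lra.
Qed.

Lemma ln_p_bounds p : In p ps -> L <= ln (INR p) <= (1 + 2 * eps) * L.
Proof.
intros Hp; destruct (in_ps p Hp) as [_ [_ [[H1 H2] H3]]].
assert (H4 := ln_X); assert (H5 := Jb_le).
assert (H7 := ln_L_ge_0); lra.
Qed.

(** On [ps] the maximum is the logarithm. It makes [kappa] positive at every natural number, since
    positivity of the coefficients and costs is required for all p. *)
Definition kappa (p : nat) : R := Rmax b (ln (INR p / X)).

Lemma kappa_ps p : In p ps -> kappa p = ln (INR p / X).
Proof. intros Hp; apply Rmax_right; destruct (in_ps p Hp) as [_ [_ [H _]]]; lra. Qed.

Lemma kappa_ge p : b <= kappa p.
Proof. apply Rmax_l. Qed.

Lemma kappa_ge_1 p : 1 <= kappa p.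
Proof. assert (H := kappa_ge p); nra. Qed.

Definition mass : R := lsum (fun p => ln (INR p) / INR p / ln (INR p / X)) ps.

(** The number of blocks is about eps / (theta b), so the harmonic sum falls short of ln (1/theta)
    by ln (b/eps) + ln 2, which [theta_ln] makes at most eps ln (1/theta). *)
Lemma mass_ge : (1 - 2 * eps) * ln (/ theta) <= mass.
Proof.
assert (Hb := b_gt_0).
assert (H := weighted_mass_ge X b X_ge_1 Hb eps J b_ge_13 ltac:(lra) J_pos).
eapply Rle_trans; [ | exact H].
assert (H1 : ln (/ theta) - ln (b / eps) <= ln (INR J + 1)).
{ assert (0 < / theta) by (apply Rinv_0_lt_compat; lra).
  assert (0 < b / eps) by (apply Rdiv_lt_0_compat; lra).
  rewrite <- ln_div by assumption; apply ln_le; [apply Rdiv_lt_0_compat; assumption | ].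
  apply (Rmult_le_reg_r b); [exact Hb | ].
  replace (/ theta / (b / eps) * b) with (eps / theta) by (field; lra); lra. }
assert (H2 := Mertens.ln2_lt1).
assert (H3 : ln (b / eps) + 2 <= eps * ln (/ theta)).
{ assert (T := theta_ln); apply (Rmult_le_compat_l eps) in T; [ | lra].
  replace (eps * ((ln (b / eps) + 2) / eps)) with (ln (b / eps) + 2) in T
    by (field; lra); exact T. }
assert (H4 := ln_inv_theta).
apply Rle_trans with ((1 - eps) * ((1 - eps) * ln (/ theta))).
- nra.
- apply Rmult_le_compat_l; lra.
Qed.

Definition energy : R := lsum (fun p => Rpower (INR p) (- (2 * sigma)) / kappa p) ps.

(** One has p^(-2 sigma) = p^(-1) X^(-2 theta) e^(-2 theta kappa), where theta kappa <= eps by the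
    upper cutoff, and 1/p is at least (ln p / p) / ((1 + 2 eps) L). *)
Lemma energy_ge :
  (1 - 2 * eps) * mass * Xt / ((1 + 2 * eps) * L) <= energy.
Proof.
assert (HL := L_ge_100).
replace ((1 - 2 * eps) * mass * Xt / ((1 + 2 * eps) * L))
  with (mass * ((1 - 2 * eps) * (Xt * / ((1 + 2 * eps) * L))))
  by (field; lra).
unfold mass, energy; rewrite <- lsum_scal_r.
apply lsum_le; intros p Hp; rewrite (kappa_ps p Hp).
assert (Hl := ln_p_bounds p Hp).
destruct (in_ps p Hp) as [_ [H1 [[H2 H3] H4]]].
assert (HX := X_ge_1).
set (k := ln (INR p / X)) in *.
unfold Rdiv; rewrite (Rmult_comm _ (/ k)), (Rmult_comm _ (/ k)), Rmult_assoc.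
assert (Hk : 0 < / k) by (apply Rinv_0_lt_compat; lra).
apply Rmult_le_compat_l; [lra | ].
assert (Hp0 : 0 < / INR p) by (apply Rinv_0_lt_compat; lra).
replace (Rpower (INR p) (- (2 * sigma)))
  with (/ INR p * (Xt * exp (- (2 * theta * k)))).
2:{ unfold Xt, Rpower; rewrite <- exp_plus, <- (exp_ln (INR p)) at 1 by lra.
    rewrite <- exp_Ropp, <- exp_plus; f_equal; rewrite H4; unfold sigma; field. }
assert (HR := Xt_gt_0).
assert (He : 1 - 2 * eps <= exp (- (2 * theta * k))).
{ assert (H := exp_ineq1_le (- (2 * theta * k))).
  assert (theta * k <= eps); [ | lra].
  destruct J_range as [HJ _].
  apply Rle_trans with (theta * (eps / theta)); [apply Rmult_le_compat_l; lra | ].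
  right; field; lra. }
assert (HlL : ln (INR p) * / ((1 + 2 * eps) * L) <= 1).
{ apply (Rmult_le_reg_r ((1 + 2 * eps) * L)); [nra | ].
  rewrite Rmult_assoc, Rinv_l by nra; lra. }
assert (HlL0 : 0 <= ln (INR p) * / ((1 + 2 * eps) * L)).
{ apply Rmult_le_pos; [lra | apply Rlt_le, Rinv_0_lt_compat; nra]. }
replace (ln (INR p) * / INR p * ((1 - 2 * eps) * (Xt * / ((1 + 2 * eps) * L))))
  with (/ INR p * (Xt * ((1 - 2 * eps) * (ln (INR p) * / ((1 + 2 * eps) * L))))) by ring.
apply Rmult_le_compat_l; [lra | apply Rmult_le_compat_l; [lra | ]].
apply Rle_trans with ((1 - 2 * eps) * 1); [apply Rmult_le_compat_l; lra | lra].
Qed.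

(** The truncation level for the cost. The missing 4 eps b1 D pays in [card_le] for the sum in
    Rankin's trick (eps), the frequency bound (eps) and the constant of the resonance inequality (2
    eps). *)
Definition budget : R := (1 - 4 * eps) * b1 * D.
(** The level at which the squared coefficients are normalized. It is below [budget] so that the
    mean cost leaves room for Markov's inequality. *)
Definition budget1 : R := (1 - 4 * eps) * budget.

Lemma budget1_range : 0 < budget1 <= D.
Proof.
assert (HD := D_gt_0); unfold budget1, budget; split.
- repeat apply Rmult_lt_0_compat; lra.
- assert (0 < (1 - 4 * eps) * b1 <= 1) by nra.
  assert ((1 - 4 * eps) * ((1 - 4 * eps) * b1) <= 1) by nra; nra.
Qed.

Lemma mass_ge_100 : 100 <= mass.
Proof.
assert (H := mass_ge); assert (H1 := ln_inv_theta); nra.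
Qed.

Lemma energy_gt : Xt / L <= energy.
Proof.
assert (HL := L_ge_100); assert (HM := mass_ge_100).
eapply Rle_trans; [ | apply energy_ge].
assert (HR := Xt_gt_0).
apply (Rmult_le_reg_r ((1 + 2 * eps) * L)); [nra | ].
replace ((1 - 2 * eps) * mass * Xt / ((1 + 2 * eps) * L) *
  ((1 + 2 * eps) * L)) with (Xt * ((1 - 2 * eps) * mass))
  by (field; lra).
replace (Xt / L * ((1 + 2 * eps) * L))
  with (Xt * (1 + 2 * eps)) by (field; lra).
apply Rmult_le_compat_l; nra.
Qed.

Lemma energy_gt_0 : 0 < energy.
Proof.
assert (HL := L_ge_100); eapply Rlt_le_trans; [ | apply energy_gt].
apply Rdiv_lt_0_compat; [apply exp_pos | lra].
Qed.

Definition amp : R := sqrt (budget1 / (2 * energy)).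

Lemma amp_gt_0 : 0 < amp.
Proof.
assert (H := energy_gt_0); assert (H1 := budget1_range).
apply sqrt_lt_R0, Rdiv_lt_0_compat; lra.
Qed.

Lemma amp_sq : amp ^ 2 = budget1 / (2 * energy).
Proof.
assert (H := energy_gt_0); assert (H1 := budget1_range).
apply pow2_sqrt, Rlt_le, Rdiv_lt_0_compat; lra.
Qed.

(** The Lagrange optimum for maximizing the sum of 2 f w when the sum of 2 f^2 kappa is prescribed.
    [amp] makes the latter equal to [budget1], and the maximum is sqrt (2 budget1 energy). *)
Definition coef (p : nat) : R := amp * w p / kappa p.

Lemma coef_gt_0 p : 0 < coef p.
Proof.
assert (H := kappa_ge_1 p).
apply Rdiv_lt_0_compat; [apply Rmult_lt_0_compat; [apply amp_gt_0 | apply exp_pos] | lra].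
Qed.

Lemma Rpower_sq p : w p ^ 2 = Rpower (INR p) (- (2 * sigma)).
Proof.
unfold w; simpl; rewrite Rmult_1_r, <- Rpower_plus; f_equal; ring.
Qed.

(** The lower cutoff acts here: [energy_gt] gives amp^2 <= X^(1 + 2 theta) / 2, so the square is at
    most (X/p)^(1 + 2 theta) / 2 <= e^(-b) / 2. *)
Lemma coef_sq p : In p ps -> coef p ^ 2 <= eps / 2.
Proof.
intros Hp; destruct (in_ps p Hp) as [_ [H1 [[H2 H3] H4]]].
assert (HX := X_ge_1); assert (HL := L_ge_100).
assert (Hk := kappa_ge_1 p); assert (He := energy_gt_0); assert (HB := budget1_range).
replace (coef p ^ 2) with (amp ^ 2 * w p ^ 2 * / kappa p ^ 2)
  by (unfold coef; field; lra).
rewrite amp_sq, Rpower_sq.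
assert (Hk2 : / kappa p ^ 2 <= 1).
{ rewrite <- Rinv_1; apply Rinv_le_contravar; [lra | nra]. }
assert (Hk0 : 0 < / kappa p ^ 2) by (apply Rinv_0_lt_compat; nra).
assert (HR : 0 < Rpower (INR p) (- (2 * sigma))) by apply exp_pos.
assert (HR' := Xt_gt_0).
assert (Hamp : budget1 / (2 * energy) <= D * (L / (2 * Xt))).
{ unfold Rdiv at 1; apply Rmult_le_compat; [lra | apply Rlt_le, Rinv_0_lt_compat; lra | lra | ].
  replace (L / (2 * Xt)) with (/ (2 * (Xt / L)))
    by (field; lra).
  apply Rinv_le_contravar; [apply Rmult_lt_0_compat; [lra | apply Rdiv_lt_0_compat; lra] | ].
  assert (H := energy_gt); lra. }
assert (Hamp0 : 0 < budget1 / (2 * energy)) by (apply Rdiv_lt_0_compat; lra).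
apply Rle_trans with (D * (L / (2 * Xt)) * Rpower (INR p) (- (2 * sigma))).
- rewrite <- (Rmult_1_r (D * _ * _)).
  apply Rmult_le_compat; [apply Rmult_le_pos; lra | lra | | exact Hk2].
  apply Rmult_le_compat_r; lra.
- replace (D * (L / (2 * Xt))) with (X * / Xt / 2)
    by (unfold X; field; unfold X in HR'; lra).
  unfold Rdiv at 2, Xt; rewrite <- Rpower_Ropp, Ropp_involutive.
  replace (X * Rpower X (2 * theta) / 2 * Rpower (INR p) (- (2 * sigma)))
    with (exp (- ((1 + 2 * theta) * ln (INR p / X))) / 2).
  + assert (Hexp : exp (- ((1 + 2 * theta) * ln (INR p / X))) <= exp (- b)).
    { apply exp_mono; nra. }
    lra.
  + unfold Rpower; rewrite <- (exp_ln X) at 2 by lra; rewrite H4.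
    replace (exp (ln X) * exp (2 * theta * ln X) / 2 *
      exp (- (2 * sigma) * (ln X + ln (INR p / X))))
      with (exp (ln X + 2 * theta * ln X + - (2 * sigma) * (ln X + ln (INR p / X))) / 2)
      by (rewrite !exp_plus; field).
    do 2 f_equal; unfold sigma; field.
Qed.

Lemma coef_le_1 p : In p ps -> coef p <= 1.
Proof.
intros Hp; assert (H := coef_sq p Hp); nra.
Qed.

Lemma u_ge : 1 <= u /\ 400 <= eps ^ 3 * b1 ^ 2 * u /\ 100000000000 <= eps * b1 * u.
Proof.
assert (H3 : 0 < eps ^ 3 * b1 ^ 2)
  by (apply Rmult_lt_0_compat; apply pow_lt; lra).
assert (H1 : 0 < eps * b1) by (apply Rmult_lt_0_compat; lra).
assert (P1 : 0 < 400 / (eps ^ 3 * b1 ^ 2)) by (apply Rdiv_lt_0_compat; lra).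
assert (P2 : 0 < 100000000000 / (eps * b1)) by (apply Rdiv_lt_0_compat; lra).
assert (Q1 : 400 <= eps ^ 3 * b1 ^ 2 * u).
{ apply Rle_trans with (eps ^ 3 * b1 ^ 2 * (400 / (eps ^ 3 * b1 ^ 2))).
  - right; field; lra.
  - apply Rmult_le_compat_l; lra. }
assert (Q2 : 100000000000 <= eps * b1 * u).
{ apply Rle_trans with (eps * b1 * (100000000000 / (eps * b1))).
  - right; field; lra.
  - apply Rmult_le_compat_l; lra. }
split; [ | split; assumption].
assert (eps * b1 <= 1) by nra; nra.
Qed.

Lemma D_u : D = u ^ 40.
Proof.
unfold u; rewrite <- Rpower_pow by apply exp_pos; rewrite Rpower_mult.
replace (/ 40 * INR 40) with 1; [symmetry; apply Rpower_1, D_gt_0 | ].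
rewrite INR_IZR_INZ; simpl; field.
Qed.

Lemma weight_le p : In p ps -> w p <= / sqrt (INR p).
Proof.
intros Hp; destruct (in_ps p Hp) as [_ [H1 _]]; assert (HX := X_ge_1).
rewrite <- Rpower_sqrt by lra; rewrite <- Rpower_Ropp.
apply Rle_Rpower; [lra | unfold sigma; lra].
Qed.

Lemma weight_small p : In p ps -> w p <= eps / 2.
Proof.
intros Hp; destruct (in_ps p Hp) as [_ [H1 _]]; assert (HX := X_ge_D).
destruct u_ge as [U1 [_ U3]].
eapply Rle_trans; [apply weight_le, Hp | ].
assert (Hq : u <= sqrt (INR p)).
{ rewrite <- (sqrt_pow2 u) by lra; apply sqrt_le_1_alt.
  assert (u ^ 2 <= u ^ 40) by (apply Rle_pow; [exact U1 | lia]).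
  rewrite <- D_u in *; lra. }
apply Rle_trans with (/ u); [apply Rinv_le_contravar; lra | ].
apply (Rmult_le_reg_r u); [lra | rewrite Rinv_l by lra].
assert (b1 * (eps * u) <= 1 * (eps * u)).
{ apply Rmult_le_compat_r; [apply Rmult_le_pos; lra | lra]. }
lra.
Qed.

Definition gain_ln : R := lsum (fun p => coef p * w p * ln (INR p)) ps.

(** Up to a constant this bounds the mean logarithm of the quotient. The trivial estimate coef <= 1
    and a sum over all integers give the square root of the largest prime, about D^(1/2), times
    small powers of D; this is negligible against D = u^40. *)
Lemma gain_ln_le : 0 <= gain_ln <= u ^ 26.
Proof.
assert (HL := L_ge_100); assert (HD := D_gt_0); assert (HX := X_ge_1).
destruct u_ge as [U1 [_ U3]].
split.
{ apply lsum_ge_0; intros p Hp; assert (H := ln_p_bounds p Hp).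
  apply Rmult_le_pos; [apply Rmult_le_pos | lra]; apply Rlt_le;
    [apply coef_gt_0 | apply exp_pos]. }
apply Rle_trans with (2 * L * lsum (fun p => / sqrt (INR p)) ps).
{ rewrite <- lsum_scal; apply lsum_le; intros p Hp.
  assert (H := ln_p_bounds p Hp); assert (H1 := weight_le p Hp).
  assert (H2 := coef_le_1 p Hp); assert (H3 := coef_gt_0 p).
  assert (H4 := w_gt_0 p).
  rewrite (Rmult_comm (2 * L)); apply Rmult_le_compat; [nra | lra | nra | nra]. }
assert (HJ : 1 <= INR J) by (apply (le_INR 1), J_pos).
assert (HJb := Jb_le).
assert (Hs : lsum (fun p => / sqrt (INR p)) ps <= 2 * sqrt (X * exp (INR J * b))).
{ apply primes_in_inv_sqrt; split.
  - apply Rmult_le_pos; [lra | apply Rlt_le, exp_pos].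
  - apply Rmult_le_compat_l; [lra | apply exp_mono; nra]. }
assert (Hq : sqrt (X * exp (INR J * b)) <= u ^ 22).
{ rewrite <- (sqrt_pow2 (u ^ 22)) by (apply pow_le; lra); apply sqrt_le_1_alt.
  replace ((u ^ 22) ^ 2) with (u ^ 40 * u ^ 2 * u ^ 2) by ring.
  rewrite <- D_u; unfold X; apply Rmult_le_compat; [nra | apply Rlt_le, exp_pos | | ].
  - apply Rmult_le_compat_l; lra.
  - replace (u ^ 2) with (exp (/ 40 * L + / 40 * L)).
    + apply exp_mono; nra.
    + rewrite exp_plus; unfold u, Rpower, L; ring. }
assert (E4 : 4 <= u).
{ assert (eps * b1 <= 1) by nra; nra. }
apply Rle_trans with (2 * u ^ 2 * (2 * u ^ 22)).
- apply Rmult_le_compat; try lra.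
  apply lsum_ge_0; intros p Hp; apply Rlt_le, Rinv_0_lt_compat, sqrt_lt_R0.
  destruct (in_ps p Hp) as [_ [H1 _]]; lra.
- replace (2 * u ^ 2 * (2 * u ^ 22)) with (u ^ 24 * 4) by ring.
  replace (u ^ 26) with (u ^ 24 * (u * u)) by ring.
  apply Rmult_le_compat_l; [apply pow_le; lra | nra].
Qed.

(** The factor 1 + eps supplies the decay e^(-eps kappa) that makes the sum in Rankin's trick
    converge, and raises the cost only by a factor close to 1. *)
Definition cost (p : nat) : R := (1 + eps) * kappa p.

Lemma sum_cost_sq : lsum (fun p => 2 * coef p ^ 2 * kappa p) ps = budget1.
Proof.
assert (He := energy_gt_0).
rewrite (lsum_ext _ (fun p => 2 * amp ^ 2 * (Rpower (INR p) (- (2 * sigma)) / kappa p))).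
- rewrite lsum_scal; fold energy; rewrite amp_sq; field; lra.
- intros p _; rewrite <- Rpower_sq; unfold coef.
  assert (H := kappa_ge_1 p); field; lra.
Qed.

Lemma sum_gain : lsum (fun p => 2 * (coef p * w p)) ps
  = sqrt (2 * budget1 * energy).
Proof.
assert (He := energy_gt_0); assert (Ha := amp_gt_0).
rewrite (lsum_ext _ (fun p => 2 * amp * (Rpower (INR p) (- (2 * sigma)) / kappa p))).
- rewrite lsum_scal; fold energy.
  rewrite <- (sqrt_pow2 (2 * amp * energy)) by (repeat apply Rmult_le_pos; lra).
  f_equal; replace ((2 * amp * energy) ^ 2) with (4 * amp ^ 2 * energy ^ 2) by ring.
  rewrite amp_sq; field; lra.
- intros p _; rewrite <- Rpower_sq; unfold coef.
  assert (H := kappa_ge_1 p); field; lra.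
Qed.

Lemma cost_le_ln p : In p ps -> cost p <= ln (INR p).
Proof.
intros Hp; unfold cost; rewrite (kappa_ps p Hp).
destruct (in_ps p Hp) as [_ [_ [[_ H3] H4]]]; rewrite H4, ln_X.
assert (H5 := Jb_le); assert (H6 := ln_L_ge_0); assert (HL := L_ge_100); nra.
Qed.

(** The bound for the frequencies. It enters the number of terms through e^(4 spread), yet is a
    constant multiple of D and so dominates the typical frequency. *)
Definition spread : R := eps * b1 * D / 4.

Lemma spread_u : spread = eps * b1 / 4 * (u ^ 13 * u ^ 27).
Proof. unfold spread; rewrite D_u at 1; field. Qed.

Lemma mean_cost_le :
  lsum (fun p => cost p * (2 * coef p ^ 2 + 2 * (coef p * w p))
     + 4 * (coef p * w p) * ln (INR p)) ps <= budget * (1 - 2 * eps).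
Proof.
destruct gain_ln_le as [G0 G1]; destruct u_ge as [U1 [U2 U3]]; assert (HD := D_u).
apply Rle_trans with ((1 + eps) * budget1 + 6 * gain_ln).
- rewrite <- sum_cost_sq; unfold gain_ln; rewrite <- !lsum_scal, <- lsum_plus.
  apply lsum_le; intros p Hp; assert (H := cost_le_ln p Hp).
  assert (H3 := coef_gt_0 p).
  assert (H4 := w_gt_0 p).
  assert (H5 : cost p * (coef p * w p) <= ln (INR p) * (coef p * w p))
    by (apply Rmult_le_compat_r; [apply Rmult_le_pos; lra | exact H]).
  unfold cost in *; lra.
- unfold budget1.
  assert (HB : b1 * u ^ 26 * u / 2 <= budget).
  { unfold budget; rewrite HD.
    apply Rle_trans with (b1 / 2 * u ^ 40).
    - replace (b1 * u ^ 26 * u / 2) with (b1 / 2 * u ^ 27) by field.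
      apply Rmult_le_compat_l; [lra | apply Rle_pow; [exact U1 | lia]].
    - apply Rmult_le_compat_r; [apply pow_le; lra | nra]. }
  assert (H6 : 6 * u ^ 26 <= eps * budget).
  { apply Rle_trans with (eps * (b1 * u ^ 26 * u / 2)); [ | apply Rmult_le_compat_l; lra].
    replace (eps * (b1 * u ^ 26 * u / 2)) with (eps * b1 * u / 2 * u ^ 26) by field.
    apply Rmult_le_compat_r; [apply pow_le; lra | lra]. }
  assert (HB0 : 0 < budget).
  { eapply Rlt_le_trans; [ | exact HB].
    assert (0 < u ^ 26) by (apply pow_lt; lra).
    apply Rdiv_lt_0_compat; [repeat apply Rmult_lt_0_compat; lra | lra]. }
  assert ((1 + eps) * ((1 - 4 * eps) * budget) <= (1 - 3 * eps) * budget) by nra.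
  lra.
Qed.

Lemma mean_quot_le :
  lsum (fun p => 4 * (coef p * w p) * ln (INR p)) ps <= eps / 2 * spread.
Proof.
destruct gain_ln_le as [G0 G1]; destruct u_ge as [U1 [U2 U3]].
rewrite (lsum_ext _ (fun p => 4 * (coef p * w p * ln (INR p))))
  by (intros; ring).
rewrite lsum_scal; fold gain_ln; rewrite spread_u.
apply Rle_trans with (4 * u ^ 26); [lra | ].
assert (H1 : 32 <= eps ^ 2 * b1 * u).
{ assert (eps ^ 3 * b1 ^ 2 * u <= eps ^ 2 * b1 * u); [ | lra].
  replace (eps ^ 3 * b1 ^ 2 * u) with (eps * b1 * (eps ^ 2 * b1 * u)) by ring.
  assert (0 <= eps ^ 2 * b1 * u)
    by (repeat apply Rmult_le_pos; try apply pow2_ge_0; lra).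
  assert (eps * b1 <= 1) by nra; nra. }
replace (eps / 2 * (eps * b1 / 4 * (u ^ 13 * u ^ 27)))
  with (eps ^ 2 * b1 * u / 8 * (u ^ 26 * u ^ 13)) by field.
assert (H13 : 1 <= u ^ 13) by (apply pow_R1_Rle; exact U1).
assert (H26 : 0 < u ^ 26) by (apply pow_lt; lra).
assert (u ^ 26 <= u ^ 26 * u ^ 13) by nra.
apply Rle_trans with (4 * (u ^ 26 * u ^ 13)); [lra | ].
apply Rmult_le_compat_r; [nra | lra].
Qed.

Lemma mean_sq_le :
  lsum (fun p => (2 * coef p ^ 2 + 2 * (coef p * w p)) * ln (INR p) ^ 2) ps
  + lsum (fun p => 2 * (coef p * w p) * ln (INR p)) ps ^ 2
  <= eps / 2 * spread ^ 2.
Proof.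
destruct gain_ln_le as [G0 G1]; destruct u_ge as [U1 [U2 U3]]; assert (HL := L_ge_100).
assert (HB := budget1_range).
rewrite (lsum_ext (fun p => 2 * (coef p * w p) * ln (INR p))
  (fun p => 2 * (coef p * w p * ln (INR p)))) by (intros; ring).
rewrite (lsum_scal 2); fold gain_ln.
assert (H1 : lsum (fun p => (2 * coef p ^ 2 + 2 * (coef p * w p))
   * ln (INR p) ^ 2) ps <= 4 * L ^ 2 * budget1 + 4 * L * gain_ln).
{ rewrite <- sum_cost_sq; unfold gain_ln; rewrite <- !lsum_scal, <- lsum_plus.
  apply lsum_le; intros p Hp; assert (H := ln_p_bounds p Hp).
  assert (H2 := kappa_ge_1 p); assert (H3 := coef_gt_0 p).
  assert (H4 := w_gt_0 p).
  set (l := ln (INR p)) in *.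
  assert (Hl : 0 <= l <= 2 * L) by nra.
  assert (Hl2 : l ^ 2 <= 4 * L ^ 2) by nra.
  assert (Hc : 0 < coef p ^ 2) by (apply pow_lt, H3).
  assert (K1 : 2 * coef p ^ 2 * l ^ 2 <= 4 * L ^ 2 * (2 * coef p ^ 2 * kappa p)).
  { apply Rle_trans with (2 * coef p ^ 2 * (4 * L ^ 2)); [apply Rmult_le_compat_l; lra | ].
    assert (0 <= coef p ^ 2 * L ^ 2) by (apply Rmult_le_pos; [lra | apply pow2_ge_0]).
    nra. }
  assert (K2 : 2 * (coef p * w p) * l ^ 2 <= 4 * L * (coef p * w p * l)).
  { replace (2 * (coef p * w p) * l ^ 2) with (2 * (coef p * w p) * (l * l)) by ring.
    replace (4 * L * (coef p * w p * l)) with (2 * (coef p * w p) * (2 * L * l)) by ring.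
    apply Rmult_le_compat_l; [apply Rmult_le_pos; [lra | apply Rmult_le_pos; lra] | nra]. }
  lra. }
assert (HL2 : L ^ 2 <= (u ^ 2) ^ 2) by (apply pow_incr; lra).
assert (HG2 : gain_ln ^ 2 <= (u ^ 26) ^ 2) by (apply pow_incr; lra).
assert (K1 : 4 * L ^ 2 * budget1 <= 4 * (u ^ 2) ^ 2 * u ^ 40).
{ rewrite D_u in HB; apply Rmult_le_compat; try lra; assert (H := pow2_ge_0 L); lra. }
assert (K2 : 4 * L * gain_ln <= 4 * u ^ 2 * u ^ 26) by (apply Rmult_le_compat; lra).
assert (P1 : 4 * (u ^ 2) ^ 2 * u ^ 40 <= 4 * u ^ 52).
{ replace (4 * (u ^ 2) ^ 2 * u ^ 40) with (4 * u ^ 44) by ring.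
  apply Rmult_le_compat_l; [lra | apply Rle_pow; [exact U1 | lia]]. }
assert (P2 : 4 * u ^ 2 * u ^ 26 <= 4 * u ^ 52).
{ replace (4 * u ^ 2 * u ^ 26) with (4 * u ^ 28) by ring.
  apply Rmult_le_compat_l; [lra | apply Rle_pow; [exact U1 | lia]]. }
assert (P3 : (2 * gain_ln) ^ 2 <= 4 * u ^ 52).
{ replace (u ^ 52) with ((u ^ 26) ^ 2) by ring.
  replace ((2 * gain_ln) ^ 2) with (4 * gain_ln ^ 2) by ring; lra. }
apply Rle_trans with (12 * u ^ 52); [lra | ].
rewrite spread_u.
replace (eps / 2 * (eps * b1 / 4 * (u ^ 13 * u ^ 27)) ^ 2)
  with (eps ^ 3 * b1 ^ 2 * u / 32 * (u ^ 52 * u ^ 27)) by field.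
assert (H27 : 1 <= u ^ 27) by (apply pow_R1_Rle; exact U1).
assert (H52 : 0 < u ^ 52) by (apply pow_lt; lra).
assert (u ^ 52 <= u ^ 52 * u ^ 27) by nra.
apply Rle_trans with (12 * (u ^ 52 * u ^ 27)); [lra | ].
apply Rmult_le_compat_r; [nra | lra].
Qed.

(** This estimate dictates X = D L: then e^(-kappa) = X/p = D (L/p) <= D (ln p / p), and Mertens'
    estimate with the remaining decay e^(-eps kappa) gives a small multiple of D. *)
Lemma sum_exp_cost_le : lsum (fun p => exp (- cost p)) ps <= eps * b1 / 2 * D.
Proof.
assert (HL := L_ge_100); assert (HD := D_gt_0); assert (HX := X_ge_1).
apply Rle_trans with (D * lsum (fun p => ln (INR p) / INR p * exp (- (eps * ln (INR p / X)))) ps).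
- rewrite <- lsum_scal; apply lsum_le; intros p Hp.
  unfold cost; rewrite (kappa_ps p Hp).
  assert (Hl := ln_p_bounds p Hp); destruct (in_ps p Hp) as [_ [H1 _]].
  set (k := ln (INR p / X)).
  replace (- ((1 + eps) * k)) with (- k + - (eps * k)) by ring.
  rewrite exp_plus, <- Rmult_assoc; apply Rmult_le_compat_r; [apply Rlt_le, exp_pos | ].
  unfold k; rewrite exp_Ropp, exp_ln by (apply Rdiv_lt_0_compat; lra).
  replace (/ (INR p / X)) with (D * (L / INR p)) by (unfold X; field; unfold X in *; lra).
  apply Rmult_le_compat_l; [lra | ].
  apply Rmult_le_compat_r; [apply Rlt_le, Rinv_0_lt_compat; lra | lra].
- rewrite Rmult_comm; apply Rmult_le_compat_r; [lra | ].
  eapply Rle_trans; [ | exact b_decay_card].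
  apply decay_mass_le; [exact HX | apply b_gt_0 | lra | exact b_decay_half].
Qed.

Definition target : R := Rpower b1 (1 - sigma) * sqrt (ln (/ theta)) *
  (Rpower D (1 - sigma) / Rpower L sigma).

Lemma target_sq : target ^ 2 =
  b1 * / Rpower b1 (2 * theta) * ln (/ theta) * (D * Xt / L).
Proof.
assert (HL := L_ge_100); assert (HD := D_gt_0); assert (Hln := ln_inv_theta).
unfold target.
replace ((Rpower b1 (1 - sigma) * sqrt (ln (/ theta)) * (Rpower D (1 - sigma) / Rpower L sigma)) ^ 2)
  with ((Rpower b1 (1 - sigma)) ^ 2 * sqrt (ln (/ theta)) ^ 2 *
        (Rpower D (1 - sigma) ^ 2 * (/ Rpower L sigma) ^ 2))
  by (field; apply Rgt_not_eq, exp_pos).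
rewrite pow2_sqrt by lra.
assert (E1 : Rpower b1 (1 - sigma) ^ 2 = b1 * / Rpower b1 (2 * theta)).
{ rewrite <- Rpower_Ropp; rewrite <- (Rpower_1 b1) at 2 by lra.
  rewrite <- Rpower_plus; simpl; rewrite Rmult_1_r, <- Rpower_plus.
  f_equal; unfold sigma; field. }
assert (E2 : Rpower D (1 - sigma) ^ 2 = D * Rpower D (- (2 * theta))).
{ rewrite <- (Rpower_1 D) at 2 by lra.
  rewrite <- Rpower_plus; simpl; rewrite Rmult_1_r, <- Rpower_plus.
  f_equal; unfold sigma; field. }
assert (E3 : (/ Rpower L sigma) ^ 2 = Rpower L (- (2 * theta)) / L).
{ unfold Rdiv; rewrite <- (Rpower_1 L) at 3 by lra.
  rewrite <- !Rpower_Ropp; rewrite <- Rpower_plus; simpl; rewrite Rmult_1_r, <- Rpower_plus.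
  f_equal; unfold sigma; field. }
assert (E4 : Xt = Rpower D (- (2 * theta)) * Rpower L (- (2 * theta))).
{ unfold X; symmetry; apply Rpower_mult_distr; lra. }
rewrite E1, E2, E3, E4; field; repeat split; try lra; apply Rgt_not_eq, exp_pos.
Qed.

Lemma target_ge_0 : 0 <= target.
Proof.
unfold target; repeat apply Rmult_le_pos; try (apply Rlt_le, exp_pos).
- apply sqrt_pos.
- apply Rlt_le, Rinv_0_lt_compat, exp_pos.
Qed.

(** After squaring, 2 budget1 energy is compared with 2 target^2. They differ by b1^(2 theta) >= 1 -
    eps and by factors 1 - O(eps), and 20 eps absorbs them all. *)
Lemma gain_ge : sqrt 2 * (1 - 20 * eps) * target <=
  lsum (fun p => 2 * (coef p * w p)) ps / (1 + eps) ^ 2.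
Proof.
assert (HL := L_ge_100); assert (HD := D_gt_0); assert (Hln := ln_inv_theta).
assert (HE := energy_ge); assert (HM := mass_ge); assert (HT0 := target_ge_0).
rewrite sum_gain.
assert (H2 : 0 < (1 + eps) ^ 2) by (apply pow_lt; lra).
apply (Rmult_le_reg_r ((1 + eps) ^ 2)); [exact H2 | ].
unfold Rdiv; rewrite (Rmult_assoc (sqrt (_ * energy))), Rinv_l, Rmult_1_r by lra.
assert (Hs2 := sqrt_pos 2).
rewrite <- (sqrt_pow2 (sqrt 2 * _ * _ * _))
  by (apply Rmult_le_pos; [apply Rmult_le_pos; [apply Rmult_le_pos | ] | ]; lra).
apply sqrt_le_1_alt.
replace ((sqrt 2 * (1 - 20 * eps) * target * (1 + eps) ^ 2) ^ 2)
  with (sqrt 2 ^ 2 * ((1 - 20 * eps) ^ 2 * (1 + eps) ^ 4) * target ^ 2) by ring.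
rewrite pow2_sqrt, target_sq by lra.
assert (HR : 0 < D * Xt / L).
{ apply Rdiv_lt_0_compat; [apply Rmult_lt_0_compat; [lra | apply exp_pos] | lra]. }
set (Rr := D * Xt / L) in *.
set (l := ln (/ theta)) in *.
set (bt := Rpower b1 (2 * theta)) in *.
assert (Hbt : / bt <= / (1 - eps)) by (apply Rinv_le_contravar; lra).
assert (Hb1l : 0 <= b1 * l * Rr)
  by (apply Rmult_le_pos; [apply Rmult_le_pos | ]; lra).
assert (HE' : 2 * budget1 * ((1 - 2 * eps) * ((1 - 2 * eps) * l) *
   Xt / ((1 + 2 * eps) * L)) <= 2 * budget1 * energy).
{ assert (HB := budget1_range); apply Rmult_le_compat_l; [lra | ].
  eapply Rle_trans; [ | exact HE].
  apply Rmult_le_compat_r; [apply Rlt_le, Rinv_0_lt_compat; nra | ].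
  apply Rmult_le_compat_r; [apply Rlt_le, exp_pos | ].
  apply Rmult_le_compat_l; lra. }
eapply Rle_trans; [ | exact HE'].
replace (2 * budget1 * ((1 - 2 * eps) * ((1 - 2 * eps) * l) *
   Xt / ((1 + 2 * eps) * L)))
  with (2 * ((1 - 4 * eps) ^ 2 * (1 - 2 * eps) ^ 2 / (1 + 2 * eps)) * (b1 * l * Rr))
  by (unfold budget1, budget, Rr; field; lra).
apply Rle_trans with (2 * ((1 - 20 * eps) ^ 2 * (1 + eps) ^ 4 * / (1 - eps)) * (b1 * l * Rr)).
- replace (2 * ((1 - 20 * eps) ^ 2 * (1 + eps) ^ 4) * (b1 * / bt * l * Rr))
    with (2 * ((1 - 20 * eps) ^ 2 * (1 + eps) ^ 4 * / bt) * (b1 * l * Rr)) by ring.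
  apply Rmult_le_compat_r; [exact Hb1l | ].
  apply Rmult_le_compat_l; [lra | ].
  apply Rmult_le_compat_l; [apply Rmult_le_pos; [apply pow2_ge_0 | apply pow_le; lra] | exact Hbt].
- apply Rmult_le_compat_r; [exact Hb1l | apply Rmult_le_compat_l; [lra | ]].
  apply (Rmult_le_reg_r ((1 + 2 * eps) * (1 - eps))); [nra | ].
  replace ((1 - 20 * eps) ^ 2 * (1 + eps) ^ 4 * / (1 - eps) * ((1 + 2 * eps) * (1 - eps)))
    with ((1 - 20 * eps) ^ 2 * (1 + eps) ^ 4 * (1 + 2 * eps)) by (field; lra).
  replace ((1 - 4 * eps) ^ 2 * (1 - 2 * eps) ^ 2 / (1 + 2 * eps) * ((1 + 2 * eps) * (1 - eps)))
    with ((1 - 4 * eps) ^ 2 * (1 - 2 * eps) ^ 2 * (1 - eps)) by (field; lra).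
  assert (A1 : (1 + eps) ^ 2 <= 1 + 3 * eps) by nra.
  assert (A2 : (1 + eps) ^ 4 <= 1 + 7 * eps).
  { replace ((1 + eps) ^ 4) with ((1 + eps) ^ 2 * (1 + eps) ^ 2) by ring; nra. }
  assert (A3 : (1 + eps) ^ 4 * (1 + 2 * eps) <= 1 + 10 * eps) by nra.
  assert (A4 : (1 - 20 * eps) ^ 2 <= 1 - 30 * eps + 200 * eps ^ 2) by nra.
  assert (A5 : (1 - 20 * eps) * (1 + 10 * eps) <= 1 - 10 * eps) by nra.
  assert (A6 : (1 - 20 * eps) ^ 2 * ((1 + eps) ^ 4 * (1 + 2 * eps)) <= (1 - 20 * eps) * (1 - 10 * eps)).
  { apply Rle_trans with ((1 - 20 * eps) ^ 2 * (1 + 10 * eps)).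
    - apply Rmult_le_compat_l; [apply pow2_ge_0 | exact A3].
    - replace ((1 - 20 * eps) ^ 2 * (1 + 10 * eps))
        with ((1 - 20 * eps) * ((1 - 20 * eps) * (1 + 10 * eps))) by ring.
      apply Rmult_le_compat_l; lra. }
  assert (B1 : 1 - 8 * eps <= (1 - 4 * eps) ^ 2) by nra.
  assert (B2 : 1 - 4 * eps <= (1 - 2 * eps) ^ 2) by nra.
  assert (B3 : (1 - 8 * eps) * (1 - 4 * eps) <= (1 - 4 * eps) ^ 2 * (1 - 2 * eps) ^ 2)
    by (apply Rmult_le_compat; lra).
  assert (B4 : (1 - 8 * eps) * (1 - 4 * eps) * (1 - eps) <=
               (1 - 4 * eps) ^ 2 * (1 - 2 * eps) ^ 2 * (1 - eps))
    by (apply Rmult_le_compat_r; lra).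
  rewrite Rmult_assoc; eapply Rle_trans; [exact A6 | ].
  eapply Rle_trans; [ | exact B4]; nra.
Qed.

(** A crude growth bound, which lets the exponential gain absorb constants such as 50 / eps. *)
Lemma target_ge_u : b1 * u <= target.
Proof.
assert (HL := L_ge_100); assert (Hln := ln_inv_theta).
destruct u_ge as [U1 _].
unfold target.
assert (P1 : b1 <= Rpower b1 (1 - sigma)).
{ rewrite <- (Rpower_1 b1) at 1 by lra; unfold Rpower; apply exp_mono.
  assert (ln b1 <= ln 1) by (apply ln_le; lra); rewrite ln_1 in *; unfold sigma; nra. }
assert (P2 : 1 <= sqrt (ln (/ theta))).
{ rewrite <- sqrt_1; apply sqrt_le_1_alt; lra. }
assert (P3 : u ^ 19 <= Rpower D (1 - sigma)).
{ unfold u; rewrite <- Rpower_pow by apply exp_pos; rewrite Rpower_mult.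
  apply Rle_Rpower; [apply D_ge_1 | ].
  rewrite INR_IZR_INZ; simpl; unfold sigma; lra. }
assert (P4 : Rpower L sigma <= u ^ 2).
{ apply Rle_trans with (Rpower L 1); [apply Rle_Rpower; unfold sigma; lra | ].
  rewrite Rpower_1; lra. }
assert (P4' : 0 < Rpower L sigma) by apply exp_pos.
assert (P5 : u <= Rpower D (1 - sigma) / Rpower L sigma).
{ apply (Rmult_le_reg_r (Rpower L sigma)); [exact P4' | ].
  unfold Rdiv; rewrite Rmult_assoc, Rinv_l, Rmult_1_r by lra.
  apply Rle_trans with (u * u ^ 2); [apply Rmult_le_compat_l; lra | ].
  eapply Rle_trans; [ | exact P3].
  replace (u * u ^ 2) with (u ^ 3) by ring; apply Rle_pow; [exact U1 | lia]. }
apply Rmult_le_compat; [lra | lra | | exact P5].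
apply Rle_trans with (b1 * 1); [lra | apply Rmult_le_compat; lra].
Qed.

(** With T = e^D and T^beta = e^((1 - b1) D) the exponents add up to exactly D: the four losses are
    eps, eps, 2 eps and the 4 eps removed in [budget], all times b1 D. *)
Lemma card_le : exp (budget + 2 * lsum (fun p => exp (- cost p)) ps) * exp (4 * spread)
  * exp ((1 - b1) * D) * 100000000000 <= exp D.
Proof.
assert (HS := sum_exp_cost_le); destruct u_ge as [U1 [_ U3]].
assert (Hc : 100000000000 <= exp (2 * eps * b1 * D)).
{ assert (H := exp_ineq1_le (2 * eps * b1 * D)).
  assert (HuD : u <= D).
  { rewrite D_u; rewrite <- (pow_1 u) at 1; apply Rle_pow; [exact U1 | lia]. }
  assert (eps * b1 * u <= eps * b1 * D).
  { apply Rmult_le_compat_l; [apply Rmult_le_pos; lra | exact HuD]. }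
  lra. }
apply Rle_trans with (exp (budget + 2 * lsum (fun p => exp (- cost p)) ps) * exp (4 * spread)
  * exp ((1 - b1) * D) * exp (2 * eps * b1 * D)).
- apply Rmult_le_compat_l; [ | exact Hc].
  repeat apply Rmult_le_pos; apply Rlt_le, exp_pos.
- rewrite <- !exp_plus; apply exp_mono; unfold budget, spread; lra.
Qed.

Theorem large_value :
  1 <= eps * exp (sqrt 2 * (1 - 20 * eps) * target) ->
  exists t, exp ((1 - b1) * D) <= t <= exp D /\
    eps * exp (sqrt 2 * (1 - 20 * eps) * target) <= 50 * zeta_re sigma t.
Proof.
intros Hgain; destruct u_ge as [U1 [_ U3]].
assert (HuD : u <= D).
{ rewrite D_u; rewrite <- (pow_1 u) at 1; apply Rle_pow; [exact U1 | lia]. }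
assert (HbD : 100000000000 <= eps * b1 * D).
{ eapply Rle_trans; [exact U3 | apply Rmult_le_compat_l; [apply Rmult_le_pos; lra | lra]]. }
assert (Hg := exp_mono _ _ gain_ge).
apply (Rmult_le_compat_l eps) in Hg; [ | lra].
destruct (resonator_bound ps coef cost sigma budget spread eps eps) with
  (Y := exp ((1 - b1) * D)) (T := exp D) as [t [Ht Hz]].
- apply NoDup_primes_in.
- intros p Hp; apply in_ps, Hp.
- unfold sigma; lra.
- apply coef_gt_0.
- apply coef_le_1.
- intros p; unfold cost; assert (H := kappa_ge_1 p); nra.
- apply cost_le_ln.
- unfold spread; lra.
- unfold budget; repeat apply Rmult_lt_0_compat; lra.
- lra.
- intros p Hp; assert (H := coef_sq p Hp); lra.
- intros p Hp; assert (H := weight_small p Hp); assert (H1 := coef_le_1 p Hp).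
  assert (H3 := w_gt_0 p); change (2 * (coef p * w p) <= eps); nra.
- exact mean_cost_le.
- exact mean_quot_le.
- exact mean_sq_le.
- assert (H := exp_ineq1_le ((1 - b1) * D)).
  assert (0 <= (1 - b1) * D) by (apply Rmult_le_pos; lra); lra.
- replace D with ((1 - b1) * D + b1 * D) at 2 by ring; rewrite exp_plus, Rmult_comm.
  apply Rmult_le_compat_l; [apply Rlt_le, exp_pos | ].
  assert (H := exp_ineq1_le (b1 * D)).
  assert (eps * (b1 * D) <= 1 * (b1 * D)).
  { apply Rmult_le_compat_r; [apply Rmult_le_pos; lra | lra]. }
  lra.
- rewrite ln_exp; unfold spread; assert (H : eps * b1 <= 1) by nra.
  assert (eps * b1 * D <= 1 * D) by (apply Rmult_le_compat_r; lra); lra.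
- apply card_le.
- exact (Rle_trans _ _ _ Hgain Hg).
- exists t; split; [exact Ht | exact (Rle_trans _ _ _ Hg Hz)].
Qed.

End Choice.

(** * Large values and the limiting constant *)

Definition zeta_abs (sigma t : R) : R := Cmod (zeta (sigma + Ci * t)%C).

Lemma continuous_zeta_abs (sigma t : R) : 0 < sigma < 1 -> continuous (zeta_abs sigma) t.
Proof.
intros Hs; destruct (continuous_zeta_line sigma t Hs) as [H1 H2].
apply (continuous_comp (fun u : R => Re (zeta (sigma + Ci * u)%C) ^ 2
   + Im (zeta (sigma + Ci * u)%C) ^ 2) sqrt); [ | apply continuous_sqrt].
apply (continuous_plus (V := R_NormedModule)).
- apply (continuous_comp _ (fun x => x ^ 2)); [exact H1 | ].
  apply (ex_derive_continuous (V := R_NormedModule)); auto_derive; auto.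
- apply (continuous_comp _ (fun x => x ^ 2)); [exact H2 | ].
  apply (ex_derive_continuous (V := R_NormedModule)); auto_derive; auto.
Qed.

Lemma zeta_re_le_abs (sigma t : R) : zeta_re sigma t <= zeta_abs sigma t.
Proof. eapply Rle_trans; [apply Rle_abs | apply re_le_Cmod]. Qed.

(** The resonance inequality for the constant resonator: one frequency 0 and one edge with quotient
    1, so the main term is the first term of the Dirichlet series. *)
Lemma trivial_lower_bound (sigma Y T : R) :
  1 / 2 <= sigma < 1 -> 1 <= Y -> Y * 100000000000 <= T ->
  exists t, Y <= t <= T /\ / 50 <= zeta_abs sigma t.
Proof.
intros Hs HY HT.
destruct (@resonance unit unit [tt] (fun _ => 1) (fun _ => 0) T) with
  (E := [tt]) (src := fun x : unit => x) (tgt := fun x : unit => x)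
  (kk := fun _ : unit => 1%nat) (sigma := sigma) (Y := Y) (l0 := 0) as [t [Ht Hz]];
  try (intros; simpl; lra); try (intros; simpl; auto; fail).
- repeat constructor; intros [].
- intros; simpl; rewrite ln_1; ring.
- intros; rewrite Rabs_R0; lra.
- simpl; rewrite Rmult_0_r, exp_0; lra.
- simpl; unfold Rpower; rewrite ln_1, Rmult_0_r, exp_0; lra.
- exists t; split; [exact Ht | ].
  simpl in Hz; unfold Rpower in Hz; rewrite ln_1, Rmult_0_r, exp_0 in Hz.
  assert (H := zeta_re_le_abs sigma t); lra.
Qed.

Lemma exp_ge_sq (x : R) : 0 <= x -> x ^ 2 / 4 <= exp x.
Proof.
intros Hx; assert (H := exp_ineq1_le (x / 2)).
replace x with (x / 2 + x / 2) at 2 by field; rewrite exp_plus; nra.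
Qed.

Lemma ex_block_length (eps b1 : R) : 0 < eps <= 1 / 100 -> 0 < b1 < 1 ->
  exists b, 13 <= eps * b /\ exp (- b) <= eps / 4 /\ exp (- (eps * b)) <= / 2 /\
    2 * (b + 13) * exp (- (eps * b)) <= eps * b1 / 2.
Proof.
(* The exponential is bounded below only by a square, so the last condition reduces to 16 / (eps^2
   b) <= eps b1 / 2, that is, eps^3 b1 b >= 32. *)
intros He Hb; set (b := 64 / (eps ^ 3 * b1)).
assert (He3 : 0 < eps ^ 3 * b1) by (apply Rmult_lt_0_compat; [apply pow_lt; lra | lra]).
assert (E : eps ^ 3 * b1 * b = 64) by (unfold b; field; lra).
assert (Hb0 : 0 < b) by (apply Rdiv_lt_0_compat; lra).
assert (H1 : 64 <= eps * (eps * b)).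
{ rewrite <- E; replace (eps ^ 3 * b1 * b) with (eps * b1 * (eps * (eps * b))) by ring.
  assert (H : eps * b1 <= 1) by nra.
  assert (H0 : 0 <= eps * (eps * b)) by (apply Rmult_le_pos; [ | apply Rmult_le_pos]; lra).
  apply (Rmult_le_compat_r (eps * (eps * b))) in H; lra. }
assert (Hm : forall x, 0 <= x -> eps * x <= x / 100).
{ intros x Hx; apply (Rmult_le_compat_r x eps (1 / 100)) in Hx; lra. }
assert (H2 : 6400 <= eps * b).
{ assert (H := Hm (eps * b) ltac:(apply Rmult_le_pos; lra)); lra. }
assert (Hbb : 640000 <= b) by (assert (H := Hm b ltac:(lra)); lra).
exists b; split; [lra | ].
assert (X1 : exp (- b) <= / (1 + b)).
{ rewrite exp_Ropp; apply Rinv_le_contravar; [lra | apply exp_ineq1_le]. }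
assert (X2 : exp (- (eps * b)) <= / ((eps * b) ^ 2 / 4)).
{ rewrite exp_Ropp; apply Rinv_le_contravar; [nra | apply exp_ge_sq; lra]. }
repeat split.
- eapply Rle_trans; [exact X1 | ].
  apply (Rmult_le_reg_r (1 + b)); [lra | rewrite Rinv_l by lra; nra].
- eapply Rle_trans; [exact X2 | ].
  apply Rinv_le_contravar; [lra | nra].
- apply Rle_trans with (4 * b * / ((eps * b) ^ 2 / 4)).
  + apply Rmult_le_compat; [lra | apply Rlt_le, exp_pos | lra | exact X2].
  + replace (4 * b * / ((eps * b) ^ 2 / 4)) with (16 / (eps ^ 2 * b)) by (field; lra).
    apply (Rmult_le_reg_r (eps ^ 2 * b)); [nra | ].
    replace (16 / (eps ^ 2 * b) * (eps ^ 2 * b)) with 16 by (field; lra).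
    replace (eps * b1 / 2 * (eps ^ 2 * b)) with (eps ^ 3 * b1 * b / 2) by field; lra.
Qed.

Definition scale (sigma T : R) : R := Rpower (ln T) (1 - sigma) / Rpower (ln (ln T)) sigma.

Definition height (beta sigma : R) : R :=
  Rpower (1 - beta) (1 - sigma) * sqrt (Rabs (ln (sigma - 1 / 2))).

Lemma ln_ln_ge_1 (T : R) : exp (exp 1) <= T -> exp 1 <= ln T /\ 1 <= ln (ln T).
Proof.
intros HT; assert (HD : exp 1 <= ln T).
{ rewrite <- (ln_exp (exp 1)); apply ln_le; [apply exp_pos | exact HT]. }
split; [exact HD | rewrite <- (ln_exp 1); apply ln_le; [apply exp_pos | exact HD]].
Qed.

(** The threshold for T does not depend on [eps0]: since 1/log log T <= sigma - 1/2 < delta, all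
    conditions asking for large T become conditions on [delta]. *)
Lemma large_values (beta eps0 : R) : 0 < beta < 1 -> 0 < eps0 <= 1 ->
  exists delta, 0 < delta /\ forall T sigma,
    exp (exp 1) <= T -> 1 / 2 + 1 / ln (ln T) <= sigma -> sigma < 1 / 2 + delta ->
    exists t, Rpower T beta <= t <= T /\
      exp ((sqrt 2 - eps0) * height beta sigma * scale sigma T) <= zeta_abs sigma t.
Proof.
intros Hbeta He0.
(* The loss 20 sqrt 2 eps is at most eps0 / 2; the other half of eps0 absorbs ln (50 / eps). *)
set (eps := eps0 / 100); set (b1 := 1 - beta).
assert (He : 0 < eps <= 1 / 100) by (unfold eps; lra).
assert (Hb1 : 0 < b1 < 1) by (unfold b1; lra).
destruct (ex_block_length eps b1 He Hb1) as [b [B1 [B2 [B3 B4]]]].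
set (U0 := 400 / (eps ^ 3 * b1 ^ 2) + 100000000000 / (eps * b1)).
(* The summands ensure in turn L <= u^2, ln L <= eps L, u >= U0 (through u >= L/40) and ln (50 /
   eps) <= (eps0 / 2) target. *)
set (Lmin := 500 + 4 / eps ^ 2 + 40 * U0 + 5000 / (eps * (eps0 * b1))).
assert (Heb : 0 < eps * b1) by nra.
assert (Heb0 : 0 < eps * (eps0 * b1)) by (repeat apply Rmult_lt_0_compat; lra).
assert (He3 : 0 < eps ^ 3 * b1 ^ 2) by (apply Rmult_lt_0_compat; apply pow_lt; lra).
assert (He2 : 0 < eps ^ 2) by (apply pow_lt; lra).
assert (P1 : 0 < 4 / eps ^ 2) by (apply Rdiv_lt_0_compat; lra).
assert (P2 : 0 < 5000 / (eps * (eps0 * b1))) by (apply Rdiv_lt_0_compat; lra).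
assert (P3 : 0 < U0).
{ apply Rplus_lt_0_compat; apply Rdiv_lt_0_compat; lra. }
assert (PL : 500 < Lmin) by (unfold Lmin; lra).
set (d1 := exp (- ((ln (b / eps) + 2) / eps))).
assert (Hlb : ln b1 <= 0) by (rewrite <- ln_1; apply ln_le; lra).
set (d2 := eps / (2 * (1 - ln b1))).
assert (Hd2 : 0 < d2) by (apply Rdiv_lt_0_compat; lra).
assert (Hd3 : 0 < / Lmin) by (apply Rinv_0_lt_compat; lra).
exists (Rmin (Rmin d1 d2) (Rmin (1 / 100) (/ Lmin))); split.
{ repeat apply Rmin_pos; try lra; apply exp_pos. }
intros T sigma HT Hs1 Hs2.
set (D := ln T); set (L := ln D); set (theta := sigma - 1 / 2).
assert (HT0 : 0 < T) by (assert (H := exp_pos (exp 1)); lra).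
destruct (ln_ln_ge_1 T HT) as [HD HL]; fold D in HD, HL; fold L in HL.
assert (HD0 : 0 < D) by (assert (H := exp_pos 1); lra).
assert (HiL : 0 < / L) by (apply Rinv_0_lt_compat; lra).
fold D in Hs1; fold L in Hs1; replace (1 / L) with (/ L) in Hs1 by (field; lra).
assert (Ht0 : / L <= theta) by (unfold theta; lra).
assert (Ht1 : theta < Rmin (Rmin d1 d2) (Rmin (1 / 100) (/ Lmin)))
  by (unfold theta; lra).
destruct (Rmin_Rgt_l _ _ _ Ht1) as [Hm1 Hm2].
apply Rmin_Rgt_l in Hm1, Hm2; destruct Hm1 as [Htd1 Htd2]; destruct Hm2 as [Htd3 Htd4].
assert (Hth : 0 < theta) by lra.
assert (HLm : Lmin <= L).
{ apply Rlt_le; rewrite <- (Rinv_inv Lmin), <- (Rinv_inv L).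
  apply Rinv_lt_contravar; [apply Rmult_lt_0_compat; lra | lra]. }
assert (Htl : 1 <= theta * L).
{ apply (Rmult_le_compat_r L) in Ht0; [ | lra]; rewrite Rinv_l in Ht0; lra. }
assert (Hln : (ln (b / eps) + 2) / eps <= ln (/ theta)).
{ rewrite ln_Rinv by exact Hth.
  assert (H : ln theta <= ln d1) by (apply ln_le; lra).
  unfold d1 in H; rewrite ln_exp in H; lra. }
assert (Hbt : 1 - eps <= Rpower b1 (2 * theta)).
{ unfold Rpower; assert (H := exp_ineq1_le (2 * theta * ln b1)).
  assert (theta * (1 - ln b1) <= eps / 2); [ | nra].
  apply Rle_trans with (d2 * (1 - ln b1)); [apply Rmult_le_compat_r; lra | ].
  unfold d2; right; field; lra. }
assert (Hb0 : 0 < b) by nra.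
destruct (nfloor_ex (eps / theta / b)) as [J HJ].
{ apply Rlt_le; repeat apply Rdiv_lt_0_compat; lra. }
assert (HJb : INR J * b <= eps / theta < (INR J + 1) * b).
{ assert (E : eps / theta = eps / theta / b * b) by (field; lra).
  split; rewrite E; [apply Rmult_le_compat_r | apply Rmult_lt_compat_r]; lra. }
assert (Hu : Rpower D (/ 40) = exp (L / 40)).
{ unfold Rpower; fold L; f_equal; field. }
assert (HuL : L / 40 <= Rpower D (/ 40)).
{ rewrite Hu; assert (H := exp_ineq1_le (L / 40)); lra. }
assert (HlnL : ln L <= eps * L).
{ assert (H := ln_le_Rpower L (1 / 2) ltac:(lra)).
  replace (1 / 2) with (/ 2) in H by field; rewrite Rpower_sqrt in H by lra.
  assert (Hq : 2 / eps <= sqrt L).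
  { rewrite <- (sqrt_pow2 (2 / eps)).
    - apply sqrt_le_1_alt; replace ((2 / eps) ^ 2) with (4 / eps ^ 2) by (field; lra).
      unfold Lmin in HLm; lra.
    - apply Rlt_le, Rdiv_lt_0_compat; lra. }
  apply (Rmult_le_compat_l eps) in Hq; [ | lra].
  replace (eps * (2 / eps)) with 2 in Hq by (field; lra).
  rewrite <- (sqrt_sqrt L) at 2 by lra; assert (H0 := sqrt_pos L); nra. }
assert (HuL2 : L <= Rpower D (/ 40) ^ 2).
{ rewrite Hu; replace (exp (L / 40) ^ 2) with (exp (L / 60) * exp (L / 60) * exp (L / 60)).
  - assert (H := exp_ineq1_le (L / 60)).
    assert (Hx : L / 60 <= exp (L / 60)) by lra.
    assert (L / 60 * (L / 60) * (L / 60) <= exp (L / 60) * exp (L / 60) * exp (L / 60)).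
    { apply Rmult_le_compat; [nra | lra | | lra]; apply Rmult_le_compat; lra. }
    assert (L <= L / 60 * (L / 60) * (L / 60)); [ | lra].
    assert (500 <= L) by lra; nra.
  - simpl; rewrite Rmult_1_r, <- !exp_plus; f_equal; field. }
assert (HuU : U0 <= Rpower D (/ 40)) by (unfold Lmin in HLm; lra).
assert (Etgt : target b1 theta D = height beta sigma * scale sigma T).
{ unfold target, height, scale; fold b1 D L.
  replace (1 / 2 + theta) with sigma by (unfold theta; ring).
  f_equal; f_equal; f_equal; fold theta.
  rewrite ln_Rinv by exact Hth.
  assert (ln theta <= ln 1) by (apply ln_le; lra); rewrite ln_1 in *.
  rewrite Rabs_left1; lra. }
assert (Hsq : 1 <= sqrt 2 <= 3 / 2).
{ split; [rewrite <- sqrt_1; apply sqrt_le_1_alt; lra | ].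
  rewrite <- (sqrt_pow2 (3 / 2)) by lra; apply sqrt_le_1_alt; lra. }
assert (Htu : b1 * Rpower D (/ 40) <= target b1 theta D).
{ apply (target_ge_u eps b1 b theta D J); try assumption; lra. }
set (tg := target b1 theta D) in *.
assert (Htg : ln (50 / eps) <= eps0 / 2 * tg).
{ assert (H50 : 0 < 50 / eps) by (apply Rdiv_lt_0_compat; lra).
  apply Rle_trans with (50 / eps); [assert (H := Mertens.ln_le_sub1 _ H50); lra | ].
  apply Rle_trans with (eps0 / 2 * (b1 * (L / 40))).
  - apply (Rmult_le_reg_l eps); [lra | ].
    replace (eps * (50 / eps)) with 50 by (field; lra).
    replace (eps * (eps0 / 2 * (b1 * (L / 40)))) with (eps * (eps0 * b1) * L / 80) by field.
    assert (H : 5000 <= eps * (eps0 * b1) * L); [ | lra].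
    apply Rle_trans with (eps * (eps0 * b1) * (5000 / (eps * (eps0 * b1)))).
    + right; field; lra.
    + apply Rmult_le_compat_l; [lra | unfold Lmin in HLm; lra].
  - apply Rmult_le_compat_l; [lra | ].
    eapply Rle_trans; [ | exact Htu]; apply Rmult_le_compat_l; lra. }
assert (Htg0 : 0 <= tg).
{ eapply Rle_trans; [ | exact Htu]; apply Rmult_le_pos; [lra | apply Rlt_le, exp_pos]. }
assert (Hfin : 50 * exp ((sqrt 2 - eps0) * tg) <= eps * exp (sqrt 2 * (1 - 20 * eps) * tg)).
{ apply (Rmult_le_reg_l (/ eps)); [apply Rinv_0_lt_compat; lra | ].
  rewrite <- !Rmult_assoc, Rinv_l, Rmult_1_l by lra.
  replace (/ eps * 50) with (50 / eps) by (field; lra).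
  rewrite <- (exp_ln (50 / eps)) at 1 by (apply Rdiv_lt_0_compat; lra).
  rewrite <- exp_plus; apply exp_mono.
  assert (sqrt 2 * (20 * eps) * tg <= eps0 / 2 * tg).
  { apply Rmult_le_compat_r; [exact Htg0 | ].
    apply Rle_trans with (3 / 2 * (20 * eps)); [apply Rmult_le_compat_r; lra | ].
    unfold eps; lra. }
  lra. }
destruct (large_value eps b1 b theta D J) as [t [Ht Hz]]; try assumption; try lra.
{ eapply Rle_trans; [ | exact Hfin].
  assert (H := exp_ineq1_le ((sqrt 2 - eps0) * tg)).
  assert (0 <= (sqrt 2 - eps0) * tg) by (apply Rmult_le_pos; lra); lra. }
exists t; split.
- unfold Rpower; unfold b1 in Ht; replace (1 - (1 - beta)) with beta in Ht by ring.
  unfold D in Ht; rewrite exp_ln in Ht by exact HT0; exact Ht.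
- rewrite Rmult_assoc, <- Etgt; fold tg.
  fold tg in Hz; replace (1 / 2 + theta) with sigma in Hz by (unfold theta; ring).
  assert (H := zeta_re_le_abs sigma t); lra.
Qed.

(** The cap sqrt 2 * height makes the supremum finite and gives the upper half of its asymptotic
    behaviour. *)
Definition admissible (beta T0 sigma x : R) : Prop :=
  x <= sqrt 2 * height beta sigma /\
  forall T, T0 <= T -> 1 / 2 + 1 / ln (ln T) <= sigma ->
    exists t, Rpower T beta <= t <= T /\ exp (x * scale sigma T) <= zeta_abs sigma t.

(* Taking the largest admissible constant avoids choosing the error [eps] as a function of [sigma]. *)
Definition best (beta T0 sigma : R) : R := real (Lub_Rbar (admissible beta T0 sigma)).

Lemma height_ge_0 (beta sigma : R) : 0 <= height beta sigma.
Proof. apply Rmult_le_pos; [apply Rlt_le, exp_pos | apply sqrt_pos]. Qed.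

Lemma scale_gt_0 (sigma T : R) : 0 < scale sigma T.
Proof. apply Rdiv_lt_0_compat; apply exp_pos. Qed.

Lemma scale_ge (sigma T : R) : 1 / 2 <= sigma < 1 -> exp (exp 1) <= T ->
  1 - sigma <= scale sigma T.
Proof.
intros Hs HT; set (D := ln T); set (L := ln D).
destruct (ln_ln_ge_1 T HT) as [HD HL]; fold D in HD, HL; fold L in HL.
unfold scale; fold D L.
assert (H1 : Rpower L sigma <= L).
{ rewrite <- (Rpower_1 L) at 2 by lra; apply Rle_Rpower; lra. }
assert (H2 : (1 - sigma) * L <= Rpower D (1 - sigma)).
{ unfold Rpower; fold L; assert (H := exp_ineq1_le ((1 - sigma) * L)); lra. }
assert (H0 : 0 < Rpower L sigma) by apply exp_pos.
apply Rle_div_r; [exact H0 | nra].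
Qed.

Section Endgame.
Variable beta : R.
Hypothesis beta_range : 0 < beta < 1.

(** The summand e gives log log T >= 1. The other one gives T^(1 - beta) >= 10^11 through e^x >= 1 +
    x, as the constant of the resonance inequality demands. *)
Let T0 := exp (exp 1 + 100000000000 / (1 - beta)).

Lemma T0_ge : exp (exp 1) <= T0.
Proof.
apply exp_mono; assert (0 < 100000000000 / (1 - beta)) by (apply Rdiv_lt_0_compat; lra); lra.
Qed.

Lemma window_large (T : R) : T0 <= T ->
  1 <= Rpower T beta /\ Rpower T beta * 100000000000 <= T.
Proof.
intros HT; assert (HT0 : 0 < T) by (assert (H := exp_pos (exp 1 + 100000000000 / (1 - beta)));
  unfold T0 in HT; lra).
assert (HD : exp 1 + 100000000000 / (1 - beta) <= ln T).
{ rewrite <- (ln_exp (exp 1 + _)); apply ln_le; [apply exp_pos | exact HT]. }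
assert (H1 := exp_pos 1).
assert (H2 : 0 < 100000000000 / (1 - beta)) by (apply Rdiv_lt_0_compat; lra).
split.
- unfold Rpower; assert (H := exp_ineq1_le (beta * ln T)).
  assert (0 <= beta * ln T) by (apply Rmult_le_pos; lra); lra.
- rewrite <- (exp_ln T) at 2 by exact HT0; unfold Rpower.
  replace (exp (ln T)) with (exp (beta * ln T) * exp ((1 - beta) * ln T))
    by (rewrite <- exp_plus; f_equal; ring).
  apply Rmult_le_compat_l; [apply Rlt_le, exp_pos | ].
  assert (H := exp_ineq1_le ((1 - beta) * ln T)).
  assert ((1 - beta) * (100000000000 / (1 - beta)) <= (1 - beta) * ln T)
    by (apply Rmult_le_compat_l; lra).
  replace ((1 - beta) * (100000000000 / (1 - beta))) with 100000000000 in * by (field; lra).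
  lra.
Qed.

(** The set of admissible constants is nonempty even far from 1/2: [scale] is at least 1 - sigma, so
    the exponent is at most -50, and e^(-50) < 1/50. *)
Lemma admissible_trivial (sigma : R) : 1 / 2 < sigma < 1 ->
  admissible beta T0 sigma (- (50 / (1 - sigma))).
Proof.
intros Hs; assert (H50 : 0 < 50 / (1 - sigma)) by (apply Rdiv_lt_0_compat; lra).
split.
- assert (H := height_ge_0 beta sigma); assert (H1 := sqrt_pos 2).
  assert (0 <= sqrt 2 * height beta sigma) by (apply Rmult_le_pos; assumption); lra.
- intros T HT _; destruct (window_large T HT) as [W1 W2].
  destruct (trivial_lower_bound sigma (Rpower T beta) T ltac:(lra) W1 W2) as [t [Ht Hz]].
  exists t; split; [exact Ht | ].
  eapply Rle_trans; [ | exact Hz].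
  assert (Hg := scale_ge sigma T ltac:(lra) (Rle_trans _ _ _ T0_ge HT)).
  assert (H : 50 <= 50 / (1 - sigma) * scale sigma T).
  { apply Rle_trans with (50 / (1 - sigma) * (1 - sigma)); [right; field; lra | ].
    apply Rmult_le_compat_l; lra. }
  rewrite Ropp_mult_distr_l_reverse, exp_Ropp.
  apply Rinv_le_contravar; [lra | ].
  assert (H1 := exp_ineq1_le (50 / (1 - sigma) * scale sigma T)); lra.
Qed.

Lemma best_is_lub (sigma : R) : 1 / 2 < sigma < 1 ->
  is_lub_Rbar (admissible beta T0 sigma) (best beta T0 sigma).
Proof.
intros Hs; unfold best.
assert (H := Lub_Rbar_correct (admissible beta T0 sigma)).
destruct (Lub_Rbar (admissible beta T0 sigma)) as [c | | ]; [exact H | | ]; exfalso.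
- destruct H as [_ H].
  apply (H (Finite (sqrt 2 * height beta sigma))); intros x [Hx _]; exact Hx.
- destruct H as [H _]; apply (H _ (admissible_trivial sigma Hs)).
Qed.

(** The point where |zeta| is maximal does not depend on the admissible constant, so the bound
    passes to the supremum. *)
Lemma best_attained (sigma T : R) : T0 <= T -> 1 / 2 + 1 / ln (ln T) <= sigma < 1 ->
  1 / 2 < sigma ->
  exists t, Rpower T beta <= t <= T /\
    (forall u, Rpower T beta <= u <= T -> zeta_abs sigma u <= zeta_abs sigma t) /\
    exp (best beta T0 sigma * scale sigma T) <= zeta_abs sigma t.
Proof.
intros HT Hs Hs0; destruct (window_large T HT) as [W1 W2].
destruct (continuity_ab_maj (zeta_abs sigma) (Rpower T beta) T) as [t [Ht1 Ht2]]; [lra | | ].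
{ intros u _; apply continuity_pt_filterlim, continuous_zeta_abs; lra. }
exists t; split; [exact Ht2 | split; [exact Ht1 | ]].
assert (Hg := scale_gt_0 sigma T).
destruct (best_is_lub sigma ltac:(lra)) as [_ Hlub].
assert (Hpos : 0 < zeta_abs sigma t).
{ destruct (proj2 (admissible_trivial sigma ltac:(lra)) T HT (proj1 Hs)) as [u [Hu1 Hu2]].
  eapply Rlt_le_trans; [apply exp_pos | eapply Rle_trans; [exact Hu2 | apply Ht1, Hu1]]. }
assert (Hb : best beta T0 sigma <= ln (zeta_abs sigma t) / scale sigma T).
{ apply (Hlub (Finite (ln (zeta_abs sigma t) / scale sigma T))).
  intros x [_ Hx]; destruct (Hx T HT (proj1 Hs)) as [u [Hu1 Hu2]].
  apply (Rmult_le_reg_r (scale sigma T)); [exact Hg | ].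
  unfold Rdiv; rewrite Rmult_assoc, Rinv_l, Rmult_1_r by lra.
  rewrite <- (ln_exp (x * scale sigma T)); apply ln_le; [apply exp_pos | ].
  eapply Rle_trans; [exact Hu2 | apply Ht1, Hu1]. }
rewrite <- (exp_ln (zeta_abs sigma t)) by exact Hpos; apply exp_mono.
apply (Rmult_le_compat_r (scale sigma T)) in Hb; [ | lra].
unfold Rdiv in Hb; rewrite Rmult_assoc, Rinv_l, Rmult_1_r in Hb; lra.
Qed.

Lemma height_gt_0 (sigma : R) : 1 / 2 < sigma < 1 -> 0 < height beta sigma.
Proof.
intros Hs; apply Rmult_lt_0_compat; [apply exp_pos | apply sqrt_lt_R0, Rabs_pos_lt].
assert (ln (sigma - 1 / 2) < ln 1) by (apply ln_increasing; lra); rewrite ln_1 in *; lra.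
Qed.

Lemma best_asymptotic :
  filterlim (fun sigma => best beta T0 sigma / height beta sigma - sqrt 2)
    (at_right (1 / 2)) (locally 0).
Proof.
apply filterlim_locally; intros eps.
set (e := Rmin 1 (eps / 2)).
assert (Heps := cond_pos eps).
assert (He : 0 < e <= 1) by (unfold e; split; [apply Rmin_pos; lra | apply Rmin_l]).
destruct (large_values beta e beta_range He) as [delta [Hd Hlarge]].
assert (Hd' : 0 < Rmin delta (1 / 2)) by (apply Rmin_pos; lra).
exists (mkposreal _ Hd'); intros sigma Hb Hs.
change (Rabs (sigma - 1 / 2) < Rmin delta (1 / 2)) in Hb.
rewrite Rabs_pos_eq in Hb by lra.
assert (Hb1 : sigma - 1 / 2 < delta) by (eapply Rlt_le_trans; [exact Hb | apply Rmin_l]).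
assert (Hb2 : sigma - 1 / 2 < 1 / 2) by (eapply Rlt_le_trans; [exact Hb | apply Rmin_r]).
destruct (best_is_lub sigma ltac:(lra)) as [Hub Hlub].
assert (Hh := height_gt_0 sigma ltac:(lra)).
assert (H1 : best beta T0 sigma <= sqrt 2 * height beta sigma).
{ apply (Hlub (Finite (sqrt 2 * height beta sigma))); intros x [Hx _]; exact Hx. }
assert (H2 : (sqrt 2 - e) * height beta sigma <= best beta T0 sigma).
{ apply Hub; split; [apply Rmult_le_compat_r; lra | ].
  intros T HT HsT; apply Hlarge; [eapply Rle_trans; [apply T0_ge | exact HT] | exact HsT | lra]. }
change (Rabs (best beta T0 sigma / height beta sigma - sqrt 2 - 0) < eps).
assert (K1 : best beta T0 sigma / height beta sigma <= sqrt 2).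
{ apply Rle_div_l; [exact Hh | exact H1]. }
assert (K2 : sqrt 2 - e <= best beta T0 sigma / height beta sigma).
{ apply Rle_div_r; [exact Hh | exact H2]. }
assert (e <= eps / 2) by apply Rmin_r.
apply Rabs_lt_between; lra.
Qed.

End Endgame.

Lemma log_abs_mono (z w : C) : Cmod z <= Cmod w -> Rbar_le (log_abs z) (log_abs w).
Proof.
intros H; unfold log_abs; destruct (Ceq_dec z 0) as [Hz | Hz]; [exact I | ].
apply Cmod_gt_0 in Hz; destruct (Ceq_dec w 0) as [-> | Hw].
- rewrite Cmod_0 in H; lra.
- apply ln_le; assumption.
Qed.

Theorem corollary1p4 :
  forall beta : R, 0 < beta < 1 ->
  exists c : R -> R,
    (exists e : R -> R,
       filterlim e (at_right (1 / 2)) (locally 0) /\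
       at_right (1 / 2) (fun sigma =>
         c sigma = (sqrt 2 + e sigma) * Rpower (1 - beta) (1 - sigma)
                   * sqrt (Rabs (ln (sigma - 1 / 2))))) /\
    exists T0 : R, forall T : R, T0 <= T ->
      forall sigma : R, 1 / 2 + 1 / ln (ln T) <= sigma < 1 ->
      exists M : Rbar,
        is_max_on (fun t => log_abs (zeta (sigma + Ci * t)%C)) (Rpower T beta) T M /\
        Rbar_le (c sigma * (Rpower (ln T) (1 - sigma)
                            / Rpower (ln (ln T)) sigma)) M.
Proof.
intros beta Hbeta.
set (T0 := exp (exp 1 + 100000000000 / (1 - beta))).
exists (best beta T0); split.
- exists (fun sigma => best beta T0 sigma / height beta sigma - sqrt 2); split.
  + apply best_asymptotic, Hbeta.
  + assert (Hd : 0 < 1 / 2) by lra.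
    exists (mkposreal _ Hd); intros sigma Hb Hs.
    change (Rabs (sigma - 1 / 2) < 1 / 2) in Hb; apply Rabs_lt_between in Hb.
    assert (Hh := height_gt_0 beta sigma ltac:(lra)).
    rewrite Rmult_assoc; fold (height beta sigma); field; lra.
- exists T0; intros T HT sigma Hs.
  destruct (ln_ln_ge_1 T (Rle_trans _ _ _ (T0_ge beta Hbeta) HT)) as [_ HL].
  assert (Hs0 : 1 / 2 < sigma).
  { assert (0 < 1 / ln (ln T)) by (apply Rdiv_lt_0_compat; lra); lra. }
  destruct (best_attained beta Hbeta sigma T HT Hs Hs0) as [t [Ht [Hmax Hbest]]].
  exists (log_abs (zeta (sigma + Ci * t)%C)); split; [split | ].
  + exists t; split; [exact Ht | reflexivity].
  + intros u Hu; apply log_abs_mono, Hmax, Hu.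
  + change (best beta T0 sigma * (Rpower (ln T) (1 - sigma) / Rpower (ln (ln T)) sigma))
      with (best beta T0 sigma * scale sigma T).
    assert (Hp : 0 < Cmod (zeta (sigma + Ci * t)%C))
      by (eapply Rlt_le_trans; [apply exp_pos | exact Hbest]).
    unfold log_abs; destruct (Ceq_dec _ 0) as [E | E].
    * rewrite E, Cmod_0 in Hp; lra.
    * simpl; rewrite <- (ln_exp (best beta T0 sigma * scale sigma T)).
      apply ln_le; [apply exp_pos | exact Hbest].
Qed.
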